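(* Let $\omega$ be a connection form. The Lax operator algebra $\overline{\mathfrak g}$ is an almost-graded Lie module over $\mathcal D^1$ via $$e\,.\,L:=\nabla^{(\omega)}_eL,\qquad h\,.\,L:=h\cdot L,\qquad e\in\mathcal L,\ h\in\mathcal A,\ L\in\overline{\mathfrak g}.$$
   Context: Setting. $\Sigma$ is a compact Riemann surface of genus $g$ with two distinct marked points $P_+,P_-$; $n\in\mathbb N$; $W=\{\gamma_1,\dots,\gamma_{ng}\}\subset\Sigma\setminus\{P_+,P_-\}$ is a set of $ng$ further points, all marked points being in generic position; $z_\pm,z_s$ are fixed local coordinates centred at $P_\pm,\gamma_s$. $\mathfrak g$ is one of the complex matrix Lie algebras $\mathfrak{gl}(n)$, $\mathfrak{sl}(n)$, $\mathfrak{so}(n)$ (skew-symmetric matrices), $\mathfrak{sp}(2n)=\{X: X^t\sigma+\sigma X=0\}$ ($\sigma$ a nondegenerate skew-symmetric $2n\times 2n$ matrix), $\mathfrak s(n)$ (scalar $n\times n$ matrices). To each $\gamma_s$ a vector $\alpha_s\in\mathbb C^n$ is attached ($\alpha_s\in\mathbb C^{2n}$ for $\mathfrak{sp}(2n)$; $\alpha_s^t\alpha_s=0$ for $\mathfrak{so}(n)$). Lax operator algebra. $\overline{\mathfrak g}$ is the Lie algebra, under the pointwise commutator, of all meromorphic $L:\Sigma\to\mathfrak g$, holomorphic outside $W\cup\{P_+,P_-\}$, whose Laurent expansion $L=\sum_k L_{s,k}z_s^k$ at each $\gamma_s$ satisfies: for $\mathfrak{gl}(n),\mathfrak{sl}(n)$: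 $L_{s,k}=0$ for $k<-1$ and there are $\beta_s\in\mathbb C^n,\kappa_s\in\mathbb C$ with $L_{s,-1}=\alpha_s\beta_s^t$, $\beta_s^t\alpha_s=0$, $L_{s,0}\alpha_s=\kappa_s\alpha_s$; for $\mathfrak{so}(n)$: the same with $L_{s,-1}=\alpha_s\beta_s^t-\beta_s\alpha_s^t$; for $\mathfrak{sp}(2n)$: $L_{s,k}=0$ for $k<-2$ and there are $\beta_s\in\mathbb C^{2n},\nu_s,\kappa_s\in\mathbb C$ with $L_{s,-2}=\nu_s\alpha_s\alpha_s^t\sigma$, $L_{s,-1}=(\alpha_s\beta_s^t+\beta_s\alpha_s^t)\sigma$, $\beta_s^t\sigma\alpha_s=0$, $L_{s,0}\alpha_s=\kappa_s\alpha_s$, $\alpha_s^t\sigma L_{s,1}\alpha_s=0$; for $\mathfrak s(n)$: $L$ is holomorphic at $W$. The algebras $\mathcal A,\mathcal L,\mathcal D^1$. $\mathcal A$ (resp. $\mathcal L$) is the associative algebra of meromorphic functions (resp. Lie algebra of meromorphic vector fields) on $\Sigma$ holomorphic outside $\{P_+,P_-\}$. They have Krichever–Novikov bases $\{A_m\}_{m\in\mathbb Z}$, $\{e_m\}_{m\in\mathbb Z}$ with $A_m=z_+^m+O(z_+^{m+1})$, $e_m=(z_+^{m+1}+O(z_+^{m+2}))\frac{d}{dz_+}$ at $P_+$ and complementary orders at $P_-$ (for generic $m$: $-m-g$, resp. $-m-3g+1$; boundedly modified for finitely many $m$); $\mathcal A_m=\mathbb CA_m$, $\mathcal L_m=\mathbb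 Ce_m$ give almost-gradings. $\mathcal D^1=\mathcal A\oplus\mathcal L$ with bracket $[(g,e),(h,f)]=(e\,.\,h-f\,.\,g,[e,f])$, graded by $\mathcal D^1_m=\mathcal A_m\oplus\mathcal L_m$. Almost-grading of $\overline{\mathfrak g}$. $\overline{\mathfrak g}=\bigoplus_{m\in\mathbb Z}\overline{\mathfrak g}_m$, where $\overline{\mathfrak g}_m=\{L\in\overline{\mathfrak g}: \exists X_\pm\in\mathfrak g,\ L=X_+z_+^m+O(z_+^{m+1})\text{ at }P_+,\ L=X_-z_-^{-m-g}+O(z_-^{-m-g+1})\text{ at }P_-\}$ for $m\ge1$ or $m\le -g-1$, and also for all other $m$ if $\mathfrak g$ is semisimple and some $\alpha_s\neq0$. In the remaining cases with $-g\le m\le0$ the order condition at $P_-$ is adapted: $\overline{\mathfrak s}(n)\cong\mathcal A$ carries the grading of $\mathcal A$, $\overline{\mathfrak{gl}}(n)_m=\overline{\mathfrak{sl}}(n)_m\oplus\overline{\mathfrak s}(n)_m$, and $\overline{\mathfrak g}_m=\mathfrak g\otimes A_m$ if all $\alpha_s=0$. Known: $\dim\overline{\mathfrak g}_m=\dim\mathfrak g$, and there is $M$ with $[\overline{\mathfrak g}_m,\overline{\mathfrak g}_k]\subseteq\bigoplus_{h=m+k}^{m+k+M}\overline{\mathfrak g}_h$. A module $V=\bigoplus V_m$ over $\mathcal D^1$ is almost-graded if $\dim V_m<\infty$ and there are constants $K_0,K_1$ with $\mathcal D^1_k\,.\,V_m\subseteq\bigoplus_{h=k+m-K_0}^{k+m+K_1}V_h$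 for all $k,m$. Connection forms. A connection form $\omega$ is a meromorphic matrix-valued 1-form on $\Sigma$, with values in $\mathfrak g$ for $\mathfrak{so}(n),\mathfrak{sp}(2n)$ and in $\mathfrak{gl}(n)$ for $\mathfrak{gl}(n),\mathfrak{sl}(n),\mathfrak s(n)$, holomorphic outside $W\cup\{P_-\}$ (in particular holomorphic at $P_+$), holomorphic at $\gamma_s$ if $\alpha_s=0$, and if $\alpha_s\ne0$ with expansion $\omega=(\omega_{s,-1}z_s^{-1}+\omega_{s,0}+\omega_{s,1}z_s+\cdots)dz_s$ such that for some vector $\tilde\beta_s$ and $\tilde\kappa_s\in\mathbb C$: $\omega_{s,0}\alpha_s=\tilde\kappa_s\alpha_s$ and ($\mathfrak{gl},\mathfrak{sl},\mathfrak s$) $\omega_{s,-1}=\alpha_s\tilde\beta_s^t$, $\tilde\beta_s^t\alpha_s=1$; ($\mathfrak{so}$) $\omega_{s,-1}=\alpha_s\tilde\beta_s^t-\tilde\beta_s\alpha_s^t$, $\tilde\beta_s^t\alpha_s=1$; ($\mathfrak{sp}$) $\omega_{s,-1}=(\alpha_s\tilde\beta_s^t+\tilde\beta_s\alpha_s^t)\sigma$, $\tilde\beta_s^t\sigma\alpha_s=1$, $\alpha_s^t\sigma\omega_{s,1}\alpha_s=0$. $\nabla^{(\omega)}_eL$ denotes the entrywise derivative of $L$ along $e$ plus $[\omega(e),L]$. *)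

(* Defs.v *)
From HB Require Import structures.
From mathcomp Require Import all_boot all_order all_algebra.
From mathcomp Require Import complex.
From mathcomp Require Import all_classical all_reals all_analysis.

Set Implicit Arguments.
Unset Strict Implicit.
Unset Printing Implicit Defensive.

Import Order.TTheory GRing.Theory Num.Theory.
Import numFieldNormedType.Exports.

Local Open Scope classical_set_scope.
Local Open Scope ring_scope.

(* Infinite-dimensional spaces are given as subsets of an ambient lmodType. *)

Section LinearAlgebra.
Variable K : fieldType.

Definition subspace (V : lmodType K) (A : set V) : Prop :=
  A 0 /\ forall a u v, A u -> A v -> A (a *: u + v).

Definition line (V : lmodType K) (v : V) : set V :=
  [set u | exists a : K, u = a *: v].

Definition has_dim (V : lmodType K) (A : set V) (d : nat) : Prop :=
  exists b : 'I_d -> V,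
    A = [set v | exists a : 'I_d -> K, v = \sum_i a i *: b i] /\
    forall a : 'I_d -> K, \sum_i a i *: b i = 0 -> forall i, a i = 0.

Definition sum_over (V : lmodType K) (G : int -> set V) (P : set int) : set V :=
  [set v | exists (s : seq int) (w : int -> V),
     [/\ uniq s, forall h, h \in s -> P h /\ G h (w h)
       & v = \sum_(h <- s) w h]].

Definition direct_sum (V : lmodType K) (A : set V) (G : int -> set V) : Prop :=
  [/\ forall m, subspace (G m),
      A = sum_over G setT
    & forall (s : seq int) (w : int -> V),
        uniq s -> (forall h, h \in s -> G h (w h)) ->
        \sum_(h <- s) w h = 0 -> forall h, h \in s -> w h = 0].

Definition lie_module (V U : lmodType K) (A : set V) (br : V -> V -> V)
    (M : set U) (act : V -> U -> U) : Prop :=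
  [/\ subspace M,
      forall x u, A x -> M u -> M (act x u),
      forall a x y u, A x -> A y -> M u ->
        act (a *: x + y) u = a *: act x u + act y u,
      forall a x u v, A x -> M u -> M v ->
        act x (a *: u + v) = a *: act x u + act x v
    & forall x y u, A x -> A y -> M u ->
        act (br x y) u = act x (act y u) - act y (act x u)].

Definition almost_graded_lie_module (V U : lmodType K) (A : set V)
    (br : V -> V -> V) (D : int -> set V)
    (M : set U) (G : int -> set U) (act : V -> U -> U) : Prop :=
  [/\ lie_module A br M act,
      direct_sum M G,
      forall m, exists d, has_dim (G m) d
    & exists K0 K1 : int, forall k m x u, D k x -> G m u ->
        sum_over G [set h | k + m - K0 <= h <= k + m + K1] (act x u)].

End LinearAlgebra.

Section Laurent.
Variables (R : realType) (X : topologicalType).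
Notation C := (R[i]^o).

(* Here z : X -> C is a coordinate near p: f is the sum of the Laurent series
   of coefficients c, with finite principal part, in z - z(p), on a punctured
   neighbourhood of p. *)
Definition laurent (z : X -> C) (p : X) (f : X -> C) (c : int -> C) : Prop :=
  exists N : nat,
    (forall k : int, k < - N%:Z -> c k = 0) /\
    \forall y \near p^',
      series (fun j : nat => c (j%:Z - N%:Z) * (z y - z p) ^ (j%:Z - N%:Z))
        @ \oo --> f y.

Definition mero_at (z : X -> C) (p : X) (f : X -> C) : Prop :=
  exists c, laurent z p f c.

Definition holo_at (z : X -> C) (p : X) (f : X -> C) : Prop :=
  exists c, [/\ laurent z p f c, forall k : int, k < 0 -> c k = 0 & f p = c 0].

Definition has_order (z : X -> C) (p : X) (f : X -> C) (m : int) : Prop :=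
  exists c, [/\ laurent z p f c, forall k : int, k < m -> c k = 0 & c m != 0].

Definition has_leading (z : X -> C) (p : X) (f : X -> C) (m : int) (a : C) :
    Prop :=
  exists c, [/\ laurent z p f c, forall k : int, k < m -> c k = 0 & c m = a].

(* The derivative df/dz at x, that is, of f o z^-1 at z(x). *)
Definition ddz (z : X -> C) (f : X -> C) (x : X) : C :=
  lim ((fun y => (f y - f x) / (z y - z x)) @ x^').

Variable N : nat.

Definition mx_laurent (z : X -> C) (p : X) (L : X -> 'M[R[i]]_N)
    (c : int -> 'M[R[i]]_N) : Prop :=
  forall a b, laurent z p (fun y => L y a b) (fun k => c k a b).

Definition mx_mero_at (z : X -> C) (p : X) (L : X -> 'M[R[i]]_N) : Prop :=
  exists c, mx_laurent z p L c.

Definition mx_holo_at (z : X -> C) (p : X) (L : X -> 'M[R[i]]_N) : Prop :=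
  forall a b, holo_at z p (fun y => L y a b).

Definition mx_has_leading (z : X -> C) (p : X) (L : X -> 'M[R[i]]_N)
    (m : int) (Y : 'M[R[i]]_N) : Prop :=
  exists c, [/\ mx_laurent z p L c, forall k : int, k < m -> c k = 0
              & c m = Y].

Definition mx_ddz (z : X -> C) (L : X -> 'M[R[i]]_N) (x : X) : 'M[R[i]]_N :=
  \matrix_(a, b) ddz z (fun y => L y a b) x.

End Laurent.

(* The atlas is not required to be maximal. *)
Record riemann_surface (R : realType) := RiemannSurface {
  rs_top :> topologicalType ;
  rs_chart : Type ;
  rs_dom : rs_chart -> set rs_top ;
  rs_coord : rs_chart -> rs_top -> R[i]^o ;
  rs_hausdorff : hausdorff_space rs_top ;
  rs_connected : connected [set: rs_top] ;
  rs_cover : forall x, exists i, rs_dom i x ;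
  rs_dom_open : forall i, open (rs_dom i) ;
  rs_coord_inj : forall i x y, rs_dom i x -> rs_dom i y ->
    rs_coord i x = rs_coord i y -> x = y ;
  rs_coord_cont : forall i x, rs_dom i x ->
    rs_coord i y @[y --> x] --> rs_coord i x ;
  rs_coord_open : forall i (B : set rs_top), open B -> B `<=` rs_dom i ->
    open (rs_coord i @` B) ;
  rs_compat : forall i j x, rs_dom i x -> rs_dom j x ->
    holo_at (rs_coord i) x (rs_coord j)
}.

Section Surface.
Variables (R : realType) (X : riemann_surface R).
Notation C := (R[i]^o).
Notation chart := (rs_chart X).
Notation dom := (@rs_dom R X).
Notation z := (@rs_coord R X).

Definition chart_at (x : X) : chart := projT1 (cid (rs_cover x)).

(* Vector fields and 1-forms are given by their coefficients in all charts:
   e = e_i d/dz_i and w = w_i dz_i, extended by 0 outside dom i. *)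
Definition holomorphic_form (w : chart -> X -> C) : Prop :=
  [/\ forall i x, ~ dom i x -> w i x = 0,
      forall i j x, dom i x -> dom j x -> w i x = ddz (z i) (z j) x * w j x
    & forall i x, dom i x -> holo_at (z i) x (w i)].

Definition has_genus (g : nat) : Prop :=
  has_dim [set w : chart -> X -> C | holomorphic_form w] g.

End Surface.

Record marked_points (R : realType) (X : riemann_surface R) (r : nat) :=
  MarkedPoints {
  Pp : X ;
  Pm : X ;
  gam : 'I_r -> X ;
  zp : rs_chart X ;
  zm : rs_chart X ;
  zs : 'I_r -> rs_chart X ;
  Pp_neq_Pm : Pp <> Pm ;
  gam_inj : injective gam ;
  gam_neq_Pp : forall s, gam s <> Pp ;
  gam_neq_Pm : forall s, gam s <> Pm ;
  zp_centred : rs_dom zp Pp /\ rs_coord zp Pp = 0 ;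
  zm_centred : rs_dom zm Pm /\ rs_coord zm Pm = 0 ;
  zs_centred : forall s, rs_dom (zs s) (gam s) /\ rs_coord (zs s) (gam s) = 0
}.

Section KricheverNovikov.
Variables (R : realType) (X : riemann_surface R) (r : nat).
Variable S : marked_points X r.
Notation C := (R[i]^o).
Notation chart := (rs_chart X).
Notation dom := (@rs_dom R X).
Notation z := (@rs_coord R X).

(* A meromorphic object holomorphic outside a finite set F is represented by
   the function on X that has its values outside F and is 0 on F.  The
   meromorphic object and its representative determine each other. *)

Definition kn_functions : set (X -> C) :=
  [set h | [/\ forall i x, dom i x -> x <> Pp S -> x <> Pm S ->
                 holo_at (z i) x h,
               mero_at (z (zp S)) (Pp S) h, mero_at (z (zm S)) (Pm S) h
             & h (Pp S) = 0 /\ h (Pm S) = 0]].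

Definition kn_fields : set (chart -> X -> C) :=
  [set e | [/\ forall i x, ~ dom i x \/ x = Pp S \/ x = Pm S -> e i x = 0,
               forall i j x, dom i x -> dom j x ->
                 e j x = ddz (z i) (z j) x * e i x,
               forall i x, dom i x -> x <> Pp S -> x <> Pm S ->
                 holo_at (z i) x (e i),
               mero_at (z (zp S)) (Pp S) (e (zp S))
             & mero_at (z (zm S)) (Pm S) (e (zm S))]].

Definition field_act (e : chart -> X -> C) (h : X -> C) : X -> C :=
  fun x => e (chart_at x) x * ddz (z (chart_at x)) h x.

Definition field_bracket (e f : chart -> X -> C) : chart -> X -> C :=
  fun i x => e i x * ddz (z i) (f i) x - f i x * ddz (z i) (e i) x.

Definition D1 : set ((X -> C) * (chart -> X -> C))%type :=
  [set x | kn_functions x.1 /\ kn_fields x.2].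

Definition D1_bracket (x y : (X -> C) * (chart -> X -> C)) :
    (X -> C) * (chart -> X -> C) :=
  (field_act x.2 y.1 - field_act y.2 x.1, field_bracket x.2 y.2).

Definition kn_function_basis (g : nat) (A : int -> X -> C) : Prop :=
  [/\ direct_sum kn_functions (fun m => line (A m)),
      forall m, has_leading (z (zp S)) (Pp S) (A m) m 1
    & exists M : nat, forall m : int, (M < `|m|)%N ->
        has_order (z (zm S)) (Pm S) (A m) (- m - g%:Z)].

Definition kn_field_basis (g : nat) (e : int -> chart -> X -> C) : Prop :=
  [/\ direct_sum kn_fields (fun m => line (e m)),
      forall m, has_leading (z (zp S)) (Pp S) (e m (zp S)) (m + 1) 1
    & exists M : nat, forall m : int, (M < `|m|)%N ->
        has_order (z (zm S)) (Pm S) (e m (zm S)) (- m - 3 * g%:Z + 1)].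

Definition D1_grading (A : int -> X -> C) (e : int -> chart -> X -> C)
    (m : int) : set ((X -> C) * (chart -> X -> C))%type :=
  [set x | line (A m) x.1 /\ line (e m) x.2].

End KricheverNovikov.

Inductive lax_type (R : realType) (N : nat) :=
  | Tgl | Tsl | Tso | Tsp of 'M[R[i]]_N | Ts.

Arguments Tgl {R N}.
Arguments Tsl {R N}.
Arguments Tso {R N}.
Arguments Ts {R N}.

Section MatrixLieAlgebras.
Variables (R : realType) (N : nat).
Notation C := (R[i]).
Implicit Type t : lax_type R N.

Definition lax_type_wf (n : nat) t : Prop :=
  match t with
  | Tsp sigma => [/\ N = (2 * n)%N, sigma^T = - sigma & sigma \in unitmx]
  | _ => N = n
  end.

Definition lie_alg t : set 'M[C]_N :=
  match t with
  | Tgl => setT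
  | Tsl => [set Y | \tr Y = 0]
  | Tso => [set Y | Y^T = - Y]
  | Tsp sigma => [set Y | Y^T *m sigma + sigma *m Y = 0]
  | Ts => [set Y | exists a : C, Y = a%:M]
  end.

Definition comm (Y Z : 'M[C]_N) : 'M[C]_N := Y *m Z - Z *m Y.

Definition semisimple (L : set 'M[C]_N) : Prop :=
  forall I : set 'M[C]_N, subspace I -> I `<=` L ->
    (forall Y Z, L Y -> I Z -> I (comm Y Z)) ->
    (forall Y Z, I Y -> I Z -> comm Y Z = 0) ->
    I `<=` [set 0].

(* The vectors alpha_s that may be attached to a point gamma_s. *)
Definition tyurin_ok t (al : 'cV[C]_N) : Prop :=
  match t with Tso => al^T *m al = 0 | _ => True end.

Definition eigvec (Y : 'M[C]_N) (al : 'cV[C]_N) : Prop :=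
  exists k : C, Y *m al = k *: al.

(* Conditions on the Laurent coefficients c of L at gamma_s. *)
Definition lax_condition t (al : 'cV[C]_N) (c : int -> 'M[C]_N) : Prop :=
  match t with
  | Tgl | Tsl =>
      [/\ forall k : int, k < - 1 -> c k = 0,
          exists be : 'cV[C]_N, c (- 1) = al *m be^T /\ be^T *m al = 0
        & eigvec (c 0) al]
  | Tso =>
      [/\ forall k : int, k < - 1 -> c k = 0,
          exists be : 'cV[C]_N,
            c (- 1) = al *m be^T - be *m al^T /\ be^T *m al = 0
        & eigvec (c 0) al]
  | Tsp sigma =>
      [/\ forall k : int, k < - 2 -> c k = 0,
          exists nu : C, c (- 2) = nu *: (al *m al^T *m sigma),
          exists be : 'cV[C]_N,
            c (- 1) = (al *m be^T + be *m al^T) *m sigma /\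
            be^T *m sigma *m al = 0,
          eigvec (c 0) al
        & al^T *m sigma *m c 1 *m al = 0]
  | Ts => forall k : int, k < 0 -> c k = 0
  end.

(* Conditions on the Laurent coefficients c of a connection form at gamma_s,
   when alpha_s is nonzero. *)
Definition connection_condition t (al : 'cV[C]_N) (c : int -> 'M[C]_N) : Prop :=
  (forall k : int, k < - 1 -> c k = 0) /\ eigvec (c 0) al /\
  match t with
  | Tgl | Tsl | Ts =>
      exists be : 'cV[C]_N, c (- 1) = al *m be^T /\ be^T *m al = 1%:M
  | Tso =>
      exists be : 'cV[C]_N,
        c (- 1) = al *m be^T - be *m al^T /\ be^T *m al = 1%:M
  | Tsp sigma =>
      (exists be : 'cV[C]_N,
         c (- 1) = (al *m be^T + be *m al^T) *m sigma /\
         be^T *m sigma *m al = 1%:M) /\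
      al^T *m sigma *m c 1 *m al = 0
  end.

Definition connection_values t : set 'M[C]_N :=
  match t with
  | Tgl | Tsl | Ts => setT
  | Tso | Tsp _ => lie_alg t
  end.

End MatrixLieAlgebras.

Section LaxOperators.
Variables (R : realType) (X : riemann_surface R) (r N : nat).
Variables (S : marked_points X r) (al : 'I_r -> 'cV[R[i]]_N).
Notation C := (R[i]^o).
Notation chart := (rs_chart X).
Notation dom := (@rs_dom R X).
Notation z := (@rs_coord R X).
Implicit Type t : lax_type R N.

Definition gammas : set X := range (gam S).

Definition marked : set X := [set Pp S; Pm S] `|` gammas.

Definition lax_algebra t : set (X -> 'M[R[i]]_N) :=
  [set L | [/\ forall x, lie_alg t (L x),
               forall x, marked x -> L x = 0,
               forall i x, dom i x -> ~ marked x -> mx_holo_at (z i) x L,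
               mx_mero_at (z (zp S)) (Pp S) L /\ mx_mero_at (z (zm S)) (Pm S) L
             & forall s, exists c, mx_laurent (z (zs S s)) (gam S s) L c /\
                 lax_condition t (al s) c]].

Definition standard_component (g : nat) t (m : int) : set (X -> 'M[R[i]]_N) :=
  [set L | [/\ lax_algebra t L,
               exists2 Y, lie_alg t Y & mx_has_leading (z (zp S)) (Pp S) L m Y
             & exists2 Y, lie_alg t Y &
                 mx_has_leading (z (zm S)) (Pm S) L (- m - g%:Z) Y]].

Definition tensor_component t (A : int -> X -> C) (m : int) :
    set (X -> 'M[R[i]]_N) :=
  [set L | exists2 Y, lie_alg t Y &
     L = fun x => if x \in marked then 0 else A m x *: Y].

Definition some_al_neq0 : Prop := exists s, al s != 0.

(* In the third case standard_component g Tsl m is the component of degree m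
   for sl, because sl is semisimple.  The last case covers the case where all
   alpha_s vanish, the scalar matrices, and the abelian algebra so(2). *)
Definition lax_grading (g : nat) t (A : int -> X -> C) (m : int) :
    set (X -> 'M[R[i]]_N) :=
  if (1 <= m) || (m <= - g%:Z - 1) then standard_component g t m
  else if `[< semisimple (lie_alg t) /\ some_al_neq0 >]
  then standard_component g t m
  else match t with
    | Tgl => if `[< some_al_neq0 >] then
               [set L | exists L1 L2, [/\ standard_component g Tsl m L1,
                  tensor_component Ts A m L2 & L = L1 + L2]]
             else tensor_component Tgl A m
    | _ => tensor_component t A m
    end.

Definition connection_form t (w : chart -> X -> 'M[R[i]]_N) : Prop :=
  [/\ forall i x, dom i x -> ~ gammas x -> x <> Pm S ->
        connection_values t (w i x),
      forall i j x, dom i x -> dom j x -> ~ gammas x -> x <> Pm S ->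
        w i x = ddz (z i) (z j) x *: w j x,
      forall i x, dom i x -> ~ gammas x -> x <> Pm S ->
        mx_holo_at (z i) x (w i),
      mx_mero_at (z (zm S)) (Pm S) (w (zm S))
    & forall s, exists c, mx_laurent (z (zs S s)) (gam S s) (w (zs S s)) c /\
        if al s == 0 then forall k : int, k < 0 -> c k = 0
        else connection_condition t (al s) c].

Definition nabla (w : chart -> X -> 'M[R[i]]_N) (e : chart -> X -> C)
    (L : X -> 'M[R[i]]_N) : X -> 'M[R[i]]_N :=
  fun x => if x \in marked then 0 else
    let i := chart_at x in
    e i x *: mx_ddz (z i) L x + comm (e i x *: w i x) (L x).

Definition D1_act (w : chart -> X -> 'M[R[i]]_N)
    (x : (X -> C) * (chart -> X -> C)) (L : X -> 'M[R[i]]_N) :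
    X -> 'M[R[i]]_N :=
  (fun y => x.1 y *: L y) + nabla w x.2 L.

End LaxOperators.

(* Main.v *)
Require Import Defs.
From mathcomp Require Import all_boot all_order all_algebra.
From mathcomp Require Import complex.
From mathcomp Require Import all_classical all_reals all_analysis.
From mathcomp Require Import ring lra zify.

(** The operator [nabla w e L] is e times D, with D = dL/dz + [w, L].  A
    change of chart multiplies e by the inverse of the factor by which it
    multiplies w and d/dz, so the formula is the same in every chart
    ([nabla_chart]) and all the identities of a Lie module can be checked at
    one point in one chart.  The
    only one with content is the bracket identity ([D1_act_br]): it says that
    the connection is flat, and it holds because the dimension is one.  In
    e.(f.L) - f.(e.L) all terms that contain d^2L/dz^2, [dw/dz, L], [w, dL/dz]
    or [w, [w, L]] are symmetric in e and f, and what is left is [e, f].L and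
    the terms from the derivatives of the functions.

    That the algebra is stable under the action is a local question at the
    points gamma_s.  If alpha_s is nonzero, D a priori has a pole of one order
    more than L may have.  The residue of w is normalised by the condition that
    its coupling of beta and alpha is 1; therefore the commutator with the
    residue multiplies the leading coefficient of L by the order of its pole,
    and this cancels the leading term of dL/dz.  The remaining conditions
    follow by expanding the next coefficients of D (the lemmas [gl_...],
    [so_...], [sp_...]); then e.D is a product with a holomorphic function
    ([lax_scale]).  If alpha_s = 0 or all values are scalar matrices, nothing
    has a pole and [w, L] is harmless.  The result is [lax_nabla].

    For the almost-grading, homogeneous elements of degrees k and m have a
    product of order at least k + m at P_+ and at least - (k + m) - const at
    P_-.  Conversely, orders control degrees ([trim]).  Let a be a degree
    outside a finite window, so that the component of degree a is cut out by
    the conditions ord >= a at P_+ and ord >= - a - g at P_-.  If L has order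
    at least a at P_+, the sum of its components of degree < a equals L minus
    its components of degree >= a; so this partial sum has order at least a at
    P_+, it has order at least - a - g at P_- because its terms have low degree,
    and it lies in the component of degree a.  Since the sum of the components
    is direct, it is zero.  The same argument at P_- bounds the degrees from
    above.

    Underneath lies the calculus of Laurent expansions that are given by
    pointwise convergence in a coordinate.  Convergence at one point bounds the
    coefficients geometrically ([geo_bounded_cvg]); products ([psum_mul]),
    termwise derivatives ([psum_deriv]) and uniqueness ([psum_eq0]) follow from
    such bounds, and the coordinate carries them to the surface. *)

Set Implicit Arguments.
Unset Strict Implicit.
Unset Printing Implicit Defensive.
Import Order.TTheory GRing.Theory Num.Theory.
Import numFieldNormedType.Exports.
Local Open Scope classical_set_scope.
Local Open Scope ring_scope.

(** * Series dominated by a geometric series *)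

Section GeometricSeries.
Variable R : realType.
Notation C := (R[i]^o).
Implicit Types (a b u : nat -> C) (v w : C).

Lemma pos_complex (e : C) : 0 < e -> exists2 r : R, 0 < r & e = (r%:C)%C.
Proof.
move=> e0; exists (complex.Re e); last first.
  by rewrite RRe_real // ger0_real // ltW.
by move: e0; rewrite ltcE /= => /andP[].
Qed.

Lemma cvg_half_pow (M : C) : (fun n => M * 2^-1 ^+ n : C) @ \oo --> (0 : C).
Proof.
rewrite -(mulr0 M); apply: cvgM; first exact: cvg_cst.
apply/cvgr0Pnorm_lt => e /pos_complex[r r0 ->].
have := @cvg_geometric R 1 2^-1.
rewrite ger0_norm ?invf_lt1 // ?ltr1n // => /(_ isT).
move/cvgr0Pnorm_lt => /(_ r r0).
apply: filterS => n /=; rewrite mul1r !ger0_norm ?exprn_ge0 //.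
have -> : (2^-1 : C) ^+ n = ((2^-1 ^+ n)%:C)%C.
  by rewrite rmorphXn /= fmorphV /= rmorph_nat.
by rewrite ltcR.
Qed.

Lemma cvg_half_le (u : nat -> C) (l M : C) :
  (forall n, `|u n - l| <= M * 2^-1 ^+ n) -> u @ \oo --> l.
Proof.
move=> H; apply/cvgrPdist_lt => e e0.
have /cvgr0Pnorm_lt/(_ e e0) := cvg_half_pow M.
apply: filterS => n; apply: le_lt_trans; rewrite distrC.
apply: (le_trans (H n)); apply: real_ler_norm.
by rewrite realE (le_trans (normr_ge0 _) (H n)).
Qed.

Lemma half_sum_le (M : C) m : 0 <= M -> \sum_(0 <= n < m) M * 2^-1 ^+ n <= M * 2.
Proof.
move=> M0.
suff -> : \sum_(0 <= n < m) M * 2^-1 ^+ n = M * 2 - M * 2 * 2^-1 ^+ m.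
  by rewrite gerBl mulr_ge0 // ?exprn_ge0 // mulr_ge0.
elim: m => [|m IH]; first by rewrite big_nil; rewrite mulr1 subrr.
by rewrite big_nat_recr //= IH exprS; field.
Qed.

Lemma cvg_complex (x y : nat -> R) (l m : R) :
  x @ \oo --> l -> y @ \oo --> m ->
  (fun n => Complex (x n) (y n) : C) @ \oo --> (Complex l m : C).
Proof.
move=> xl ym; apply/cvgrPdist_lt => e /pos_complex[r r0 ->].
have r20 : 0 < r / 2 by rewrite divr_gt0.
move/cvgrPdist_lt: xl => /(_ _ r20) xl; move/cvgrPdist_lt: ym => /(_ _ r20) ym.
near=> n.
have h1 : `|l - x n| < r / 2 by near: n.
have h2 : `|m - y n| < r / 2 by near: n.
rewrite [X in `|X|](_ : _ = ((l - x n)%:C + 'i * (m - y n)%:C)%C); last first.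
  by rewrite [LHS]complexE.
rewrite (le_lt_trans (ler_normD _ _)) // normrM.
have -> : `|'i%C : C| = 1 :> C by rewrite normc_def /= expr0n expr1n add0r sqrtr1.
have nR (q : R) : `|(q%:C)%C : C| = (`|q|%:C)%C :> C.
  by rewrite normc_def /= expr0n addr0 sqrtr_sqr.
by rewrite mul1r !nR -rmorphD /= ltcR; rewrite [r](splitr r) ltrD.
Unshelve. all: by end_near.
Qed.

(** Completeness enters only here: the real and the imaginary parts are
    dominated by a real geometric series. *)
Lemma series_half_cvg u (M : C) :
  (forall n, `|u n| <= M * 2^-1 ^+ n) -> cvgn (series u).
Proof.
move=> H.
have M0 : 0 <= M by have := le_trans (normr_ge0 _) (H 0%N); rewrite mulr1.
have [r Mr] : exists r : R, M = (r%:C)%C.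
  by exists (complex.Re M); rewrite RRe_real // ger0_real.
have r0 : 0 <= r by move: M0; rewrite Mr lecE /= => /andP[].
have K (f : nat -> R) : (forall n, (`|f n|%:C)%C <= `|u n|) -> cvgn (series f).
  move=> fu; apply: normed_cvg.
  apply: (@series_le_cvg R _ (geometric r 2^-1)) => //=.
  - by move=> n; rewrite mulr_ge0 // exprn_ge0.
  - move=> n; rewrite -lecR; apply: (le_trans (fu n)); apply: (le_trans (H n)).
    by rewrite Mr rmorphM rmorphXn /= fmorphV /= rmorph_nat.
  - by apply: is_cvg_geometric_series; rewrite ger0_norm // invf_lt1 // ltr1n.
have c1 := K (fun n => complex.Re (u n)) (fun n => normc_ge_Re (u n)).
have c2 : cvgn (series (fun n => complex.Im (u n))).
  apply: K => n; have := normc_ge_Re (u n * - 'i%C).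
  have n1 : `|- 'i%C : C| = 1 :> C.
    by rewrite normrN normc_def /= expr0n expr1n add0r sqrtr1.
  rewrite normrM n1.
  rewrite mulr1; congr (_ <= _); congr (`|_|%:C)%C.
  by case: (u n) => x y /=; rewrite oppr0 mulr0 sub0r mulrN mulr1 opprK.
have := cvg_complex c1 c2.
set F := fun n : nat => _; suff -> : F = series u by move=> h; apply: cvgP h.
apply/funext => n; rewrite /F /series /=; elim: n => [|n IH].
  by rewrite !big_nil.
rewrite !big_nat_recr //= -IH; case: (u n) => x y //=.
Qed.

End GeometricSeries.

(** * Complex power series *)

Section PowerSeries.
Variable R : realType.
Notation C := (R[i]^o).
Implicit Types (a b u : nat -> C) (v w : C).

(** These are the coefficients of the power series with a positive radius of
    convergence.  The exponent n + 1 lets one constant B serve both as the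
    factor and as the inverse radius. *)
Definition geo_bounded a := exists B : C, forall n, `|a n| <= B ^+ n.+1.

(** The value is unspecified where the series diverges. *)
Definition psum a w : C := lim (series (fun n => a n * w ^+ n : C) @ \oo).

Lemma geo_bounded_le a (M D : C) : 0 <= D -> (forall n, `|a n| <= M * D ^+ n) -> geo_bounded a.
Proof.
move=> D0 H; have M0 : 0 <= M.
  by have := le_trans (normr_ge0 _) (H 0%N); rewrite expr0 mulr1.
exists (M + D) => n; apply: (le_trans (H n)); rewrite exprS.
by apply: ler_pM; rewrite ?exprn_ge0 ?lerDl // lerXn2r ?nnegrE ?addr_ge0 ?lerDr.
Qed.

Lemma geo_boundedE a : geo_bounded a -> exists2 B : C, 0 < B & forall n, `|a n| <= B * B ^+ n.
Proof.
move=> [B H]; have B0 : 0 <= B.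
  by have := le_trans (normr_ge0 _) (H 0%N); rewrite expr1.
exists (B + 1); first by rewrite ltr_wpDl.
move=> n; apply: (le_trans (H n)); rewrite -exprS.
by rewrite lerXn2r ?nnegrE ?addr_ge0 ?lerDl.
Qed.

Lemma geo_boundedE2 a b : geo_bounded a -> geo_bounded b ->
  exists B : C, [/\ 0 < B, forall n, `|a n| <= B * B ^+ n
                  & forall n, `|b n| <= B * B ^+ n].
Proof.
move=> /geo_boundedE[B B0 H] /geo_boundedE[D D0 K]; exists (B + D); split=> [|n|n].
- by rewrite addr_gt0.
- apply: (le_trans (H n)); rewrite -!exprS.
  by rewrite lerXn2r ?nnegrE ?addr_ge0 ?lerDl ?ltW // ?addr_gt0.
- apply: (le_trans (K n)); rewrite -!exprS.
  by rewrite lerXn2r ?nnegrE ?addr_ge0 ?lerDr ?ltW // ?addr_gt0.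
Qed.

Lemma geo_boundedD a b : geo_bounded a -> geo_bounded b -> geo_bounded (fun n => a n + b n).
Proof.
move=> ga hb; have [B [B0 H K]] := geo_boundedE2 ga hb.
apply: (@geo_bounded_le _ (B + B) B); first exact: ltW.
by move=> n; rewrite mulrDl (le_trans (ler_normD _ _)) // lerD.
Qed.

Lemma geo_boundedZ (k : C) a : geo_bounded a -> geo_bounded (fun n => k * a n).
Proof.
move=> /geo_boundedE[B B0 H]; apply: (@geo_bounded_le _ (`|k| * B) B); first exact: ltW.
by move=> n; rewrite normrM -mulrA ler_wpM2l.
Qed.

Lemma geo_bounded0 : geo_bounded (fun=> 0).
Proof. by exists 1 => n; rewrite normr0 exprn_ge0. Qed.

Lemma geo_boundedS a : geo_bounded a -> geo_bounded (fun n => a n.+1).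
Proof.
move=> /geo_boundedE[B B0 H]; apply: (@geo_bounded_le _ (B * B) B); first exact: ltW.
by move=> n; rewrite -mulrA -exprS.
Qed.

(** The coefficients of x + w * a(w), that is, a shift by one degree. *)
Definition consn (x : C) a : nat -> C := fun n => if n is m.+1 then a m else x.

Lemma geo_bounded_cons x a : geo_bounded a -> geo_bounded (consn x a).
Proof.
move=> /geo_boundedE[B B0 H]; apply: (@geo_bounded_le _ (`|x| + 1) (B + 1)).
  by rewrite addr_ge0 // ltW.
case=> [|n] /=; first by rewrite expr0 mulr1 lerDl.
apply: (le_trans (H n)); rewrite -exprS.
apply: (@le_trans _ _ ((B + 1) ^+ n.+1)).
  by rewrite lerXn2r ?nnegrE ?addr_ge0 ?ltW ?lerDl //= ltrDl.
by rewrite ler_peMl ?lerDr // exprn_ge0 // addr_ge0 // ltW.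
Qed.

Lemma nat_le_pow2 n : (n%:R : C) <= 2 ^+ n.
Proof. by rewrite -natrX ler_nat ltnW // ltn_expl. Qed.

Lemma natS_le_pow2 n : (n.+1%:R : C) <= 2 ^+ n.
Proof. by rewrite -natrX ler_nat ltn_expl. Qed.

Lemma geo_bounded_mulS a : geo_bounded a -> geo_bounded (fun n => n.+1%:R * a n.+1).
Proof.
move=> /geo_boundedE[B B0 H]; apply: (@geo_bounded_le _ (B * B) (2 * B)).
  by rewrite mulr_ge0 // ltW.
move=> n; have -> : B * B * (2 * B) ^+ n = 2 ^+ n * (B * B ^+ n.+1).
  by rewrite exprMn exprS; ring.
rewrite normrM normr_nat; apply: ler_pM => //; exact: natS_le_pow2.
Qed.

Definition cauchy a b : nat -> C := fun n => \sum_(i < n.+1) a i * b (n - i)%N.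

Lemma geo_bounded_cauchy a b : geo_bounded a -> geo_bounded b -> geo_bounded (cauchy a b).
Proof.
move=> ga hb; have [B [B0 H K]] := geo_boundedE2 ga hb.
apply: (@geo_bounded_le _ (B * B) (2 * B)); first by rewrite mulr_ge0 // ltW.
move=> n; rewrite (le_trans (ler_norm_sum _ _ _)) //.
apply: (@le_trans _ _ (\sum_(i < n.+1) (B * B * B ^+ n))).
  apply: ler_sum => i _; rewrite normrM.
  have -> : B * B * B ^+ n = (B * B ^+ i) * (B * B ^+ (n - i)).
    by rewrite mulrACA -exprD subnKC // leq_ord.
  exact: ler_pM.
rewrite sumr_const card_ord -[leLHS]mulr_natl.
have -> : B * B * (2 * B) ^+ n = 2 ^+ n * (B * B * B ^+ n).
  by rewrite exprMn; ring.
by rewrite ler_wpM2r ?natS_le_pow2 // !mulr_ge0 ?exprn_ge0 // ltW.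
Qed.

(** Inside half the radius given by the geometric bound the terms decrease like
    powers of 1/2. *)
Lemma psum_dom a : geo_bounded a -> exists2 s : C, 0 < s &
  forall w, `|w| <= s -> exists M, forall n, `|a n * w ^+ n| <= M * 2^-1 ^+ n.
Proof.
move=> /geo_boundedE[B B0 H]; exists (2 * B)^-1; first by rewrite invr_gt0 mulr_gt0.
move=> w ws; exists B => n; rewrite normrM normrX.
have : `|w| ^+ n <= (2 * B)^-1 ^+ n.
  by rewrite lerXn2r ?nnegrE // invr_ge0 mulr_ge0 // ltW.
have := H n => h1 h2.
apply: (le_trans (ler_pM (normr_ge0 _) (exprn_ge0 n (normr_ge0 w)) h1 h2)).
rewrite -mulrA -exprMn invfM mulrCA divff ?mulr1 //; exact: lt0r_neq0.
Qed.

Lemma psum_cvg a : geo_bounded a -> exists2 s : C, 0 < s &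
  forall w, `|w| <= s -> series (fun n => a n * w ^+ n : C) @ \oo --> psum a w.
Proof.
move=> /psum_dom[s s0 H]; exists s => // w /H[M]; exact: series_half_cvg.
Qed.

Lemma near0_norm (P : C -> Prop) (s : C) : 0 < s ->
  (forall w, `|w| <= s -> P w) -> \forall w \near (0 : C), P w.
Proof. by move=> s0 H; apply: filterS (nbhs0_le s0) => w; apply: H. Qed.

Lemma psum_cvg_near a : geo_bounded a ->
  \forall w \near (0 : C), series (fun n => a n * w ^+ n : C) @ \oo --> psum a w.
Proof. by move=> /psum_cvg[s s0 H]; apply: near0_norm s0 H. Qed.

Lemma psum_lim a w (l : C) :
  series (fun n => a n * w ^+ n : C) @ \oo --> l -> psum a w = l.
Proof. by move=> h; apply: cvg_lim => //; apply: norm_hausdorff. Qed.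

(** The terms of a convergent series are bounded, and one nonzero point of
    convergence is enough to bound the coefficients geometrically. *)
Lemma geo_bounded_cvg a w : w != 0 ->
  cvgn (series (fun n => a n * w ^+ n : C)) -> geo_bounded a.
Proof.
move=> w0 /cvg_series_cvg_0 h.
have cv : cvgn (fun n => a n * w ^+ n : C) by apply: cvgP h.
have /ex_bound bnd := cvg_seq_bounded cv.
have [M HM] := bnd (@globally_properfilter _ _ 0%N I).
apply: (@geo_bounded_le _ M `|w|^-1); first by rewrite invr_ge0.
move=> n; rewrite exprVn ler_pdivlMr ?exprn_gt0 ?normr_gt0 //.
by rewrite -normrX -normrM; apply: HM.
Qed.

Lemma cvg_ext u (v : nat -> C) (l m : C) :
  u @ \oo --> l -> u =1 v -> l = m -> v @ \oo --> m.
Proof. by move=> h /funext <- <-. Qed.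

Lemma psum_add a b : geo_bounded a -> geo_bounded b ->
  \forall w \near (0 : C), psum (fun n => a n + b n) w = psum a w + psum b w.
Proof.
move=> /psum_cvg_near ga /psum_cvg_near hb.
apply: filterS2 ga hb => w ha hb; apply: psum_lim.
apply: cvg_ext (cvgD ha hb) _ erefl => m; rewrite /= fctE.
rewrite /series /= -big_split /=; apply: eq_bigr => i _; by rewrite mulrDl.
Qed.

Lemma psum_scale (k : C) a : geo_bounded a ->
  \forall w \near (0 : C), psum (fun n => k * a n) w = k * psum a w.
Proof.
move=> /psum_cvg_near; apply: filterS => w ha; apply: psum_lim.
apply: cvg_ext (cvgM (cvg_cst k) ha) _ erefl => m /=.
rewrite /series /= mulr_sumr /=; apply: eq_bigr => i _; by rewrite mulrA.
Qed.

Lemma psum_cons (x : C) a : geo_bounded a ->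
  \forall w \near (0 : C), psum (consn x a) w = x + w * psum a w.
Proof.
move=> /psum_cvg_near; apply: filterS => w ha; apply: psum_lim.
rewrite -cvg_shiftS.
apply: cvg_ext (cvgD (cvg_cst x) (cvgM (cvg_cst w) ha)) _ erefl => m /=.
rewrite fctE /=.
rewrite /series /= big_nat_recl //= mulr1 mulr_sumr; congr (_ + _).
by apply: eq_bigr => i _; rewrite exprS mulrCA.
Qed.

Lemma psum0 a : psum a 0 = a 0%N.
Proof.
apply: psum_lim; rewrite -cvg_shiftS; set F := (F in F @ _ --> _).
suff -> : F = fun=> a 0%N by apply: cvg_cst.
apply/funext => m; rewrite /F /series /= big_nat_recl //= mulr1 big1 ?addr0 //.
by move=> i _; rewrite expr0n mulr0.
Qed.

Lemma normr_lim_le (u : nat -> C) (l M : C) :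
  u @ \oo --> l -> (forall n, `|u n| <= M) -> `|l| <= M.
Proof.
move=> ul H; apply/ler_addgt0Pr => e e0.
have /cvgrPdist_lt/(_ e e0) := ul.
case=> N _ /(_ N) /= /(_ (leqnn N)) h.
rewrite -(subrK (u N) l) (le_trans (ler_normD _ _)) // addrC lerD //.
exact: ltW.
Qed.

End PowerSeries.

Section HasDerivative.
Variables (R : realType) (X : topologicalType).
Notation C := (R[i]^o).

(** The limit that defines [ddz]; as a relation it also records that the
    derivative exists. *)
Definition has_d (z f : X -> C) (x : X) (d : C) : Prop :=
  (fun y => (f y - f x) / (z y - z x)) @ x^' --> d.

End HasDerivative.

Section PowerSeriesCalculus.
Variable R : realType.
Notation C := (R[i]^o).
Implicit Types (a b u : nat -> C) (v w : C).

Lemma quarter_bound n (q : C) : 0 <= q -> q <= 8^-1 -> n.+1%:R * q ^+ n <= 4^-1 ^+ n.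
Proof.
move=> q0 q8; have -> : (4^-1 : C) = 2 * 8^-1 by field.
rewrite exprMn; apply: ler_pM; rewrite ?exprn_ge0 //.
  exact: natS_le_pow2.
by rewrite lerXn2r ?nnegrE.
Qed.

(** Both factors are truncated to polynomials p and q of degree below m.  The
    product of the partial sums is the sum of all coefficients of p * q, the
    partial sum of the Cauchy product is the sum of the first m of them, and the
    other m coefficients are at most (B / 2^m)^2 each on a small disc. *)
Lemma psum_mul a b : geo_bounded a -> geo_bounded b ->
  \forall w \near (0 : C), psum (cauchy a b) w = psum a w * psum b w.
Proof.
move=> ga hb; have [B [B0 Ha Hb]] := geo_boundedE2 ga hb.
have s0 : 0 < (8 * B)^-1 by rewrite invr_gt0 mulr_gt0.
have : \forall w \near (0 : C), `|w| <= (8 * B)^-1 by apply: near0_norm s0 _.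
move=> ns; apply: filterS3 ns (psum_cvg_near ga) (psum_cvg_near hb).
move=> w ws ca cb; apply: psum_lim.
set U := series (fun n => a n * w ^+ n : C) in ca *.
set V := series (fun n => b n * w ^+ n : C) in cb *.
set P := series _.
suff D : (fun m => P m - U m * V m : C) @ \oo --> (0 : C).
  apply: (cvg_ext (cvgD D (cvgM ca cb))); last by rewrite add0r.
  by move=> m; rewrite /= fctE /= subrK.
apply: (@cvg_half_le _ _ _ (B * B)) => m; rewrite subr0.
pose p := \poly_(i < m) (a i * w ^+ i : C); pose q := \poly_(i < m) (b i * w ^+ i : C).
have hp : p.[1] = U m.
  rewrite horner_poly /U /series /= big_mkord.
  by apply: eq_bigr => i _; rewrite expr1n mulr1.
have hq : q.[1] = V m.
  rewrite horner_poly /V /series /= big_mkord.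
  by apply: eq_bigr => i _; rewrite expr1n mulr1.
have spq : (size (p * q)%R <= m + m)%N.
  apply: (leq_trans (size_polyMleq _ _)); apply: (leq_trans (leq_pred _)).
  by rewrite leq_add // size_poly.
have -> : U m * V m = \sum_(0 <= i < m + m) (p * q)`_i.
  rewrite -hp -hq -hornerM (horner_coef_wide _ spq) big_mkord.
  by apply: eq_bigr => i _; rewrite expr1n mulr1.
have -> : P m = \sum_(0 <= i < m) (p * q)`_i.
  rewrite /P /series /= !big_mkord; apply: eq_bigr => i _.
  rewrite coefM /cauchy mulr_suml; apply: eq_bigr => j _.
  rewrite !coef_poly (leq_ltn_trans (leq_ord j)) //.
  rewrite (leq_ltn_trans (leq_subr _ _)) // mulrACA -exprD subnKC //.
  exact: leq_ord.
rewrite (@big_cat_nat _ _ _ m 0 (m + m)) //= ?leq_addr // opprD addrA subrr sub0r normrN.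
have qb : `|w| * B <= 8^-1.
  have := ler_wpM2r (ltW B0) ws.
  by rewrite invfM -mulrA mulVf ?mulr1 // lt0r_neq0.
have qb0 : 0 <= `|w| * B by rewrite mulr_ge0 // ltW.
have termb i : `|(p * q)`_i| <= B * B * 4^-1 ^+ i.
  rewrite coefM (le_trans (ler_norm_sum _ _ _)) //.
  apply: (@le_trans _ _ (\sum_(j < i.+1) (B * B * (`|w| * B) ^+ i))).
    apply: ler_sum => j _; rewrite normrM.
    have E (c : nat -> C) k : (forall n, `|c n| <= B * B ^+ n) ->
        `|(\poly_(i < m) (c i * w ^+ i))`_k| <= B * (`|w| * B) ^+ k.
      move=> Hc; rewrite coef_poly; case: ifP => _; last first.
        by rewrite normr0 mulr_ge0 ?exprn_ge0 // ltW.
      rewrite normrM normrX exprMn [`|w| ^+ k * _]mulrC mulrA.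
      by rewrite ler_wpM2r ?exprn_ge0.
    have -> : B * B * (`|w| * B) ^+ i =
        (B * (`|w| * B) ^+ j) * (B * (`|w| * B) ^+ (i - j)).
      by rewrite mulrACA -exprD subnKC // leq_ord.
    by apply: ler_pM => //; apply: E.
  rewrite sumr_const card_ord -[leLHS]mulr_natl mulrCA.
  by apply: ler_wpM2l; [rewrite mulr_ge0 ?(ltW B0)|exact: quarter_bound].
rewrite (le_trans (ler_norm_sum _ _ _)) //.
apply: (@le_trans _ _ (\sum_(m <= i < m + m) (B * B * 4^-1 ^+ m))).
  rewrite big_nat_cond [leRHS]big_nat_cond; apply: ler_sum => i.
  rewrite andbT => /andP[mi _]; apply: (le_trans (termb i)).
  rewrite ler_wpM2l ?mulr_ge0 ?(ltW B0) // ler_wiXn2l // ?invr_ge0 //.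
  by rewrite invf_le1 // ler1n.
rewrite sumr_const_nat addnK -[leLHS]mulr_natl mulrCA.
rewrite ler_wpM2l ?mulr_ge0 ?(ltW B0) //.
have -> : (4^-1 : C) = 2^-1 * 2^-1 by field.
rewrite exprMn mulrA -[leRHS]mul1r ler_wpM2r ?exprn_ge0 //.
by rewrite exprVn ler_pdivrMr ?exprn_gt0 // mul1r nat_le_pow2.
Qed.

(** The second-order Taylor remainder of v^n at w.  Multiplying by s^2 avoids
    the exponent n - 2. *)
Lemma pow_quot_bound (v w s : C) n : `|v| <= s -> `|w| <= s ->
  s ^+ 2 * `|v ^+ n - w ^+ n - n%:R * w ^+ n.-1 * (v - w)|
    <= n%:R ^+ 2 * s ^+ n * `|v - w| ^+ 2.
Proof.
move=> vs ws; have s0 : 0 <= s by apply: le_trans vs.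
elim: n => [|n IH]; first by rewrite !expr0 subrr !mul0r subrr normr0 mulr0 expr0n !mul0r.
set E := v ^+ n - _ - _ in IH.
have -> : v ^+ n.+1 - w ^+ n.+1 - n.+1%:R * w ^+ n * (v - w) =
   v * E + n%:R * w ^+ n.-1 * (v - w) ^+ 2.
  rewrite /E; case: n {E IH} => [|n]; first by rewrite !expr0 !expr1; ring.
  rewrite -[n.+2%:R]natr1 -[n.+1%:R]natr1 /= !exprS; ring.
apply: (le_trans (ler_wpM2l (exprn_ge0 2 s0) (ler_normD _ _))).
rewrite mulrDr.
have -> : n.+1%:R ^+ 2 * s ^+ n.+1 * `|v - w| ^+ 2 =
   s * (n%:R ^+ 2 * s ^+ n * `|v - w| ^+ 2) + (n + n.+1)%:R * s ^+ n.+1 * `|v - w| ^+ 2.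
  rewrite -[n.+1%:R]natr1 natrD -[n.+1%:R]natr1 [s ^+ n.+1]exprS; ring.
apply: lerD.
  by rewrite normrM mulrCA; apply: ler_pM => //; rewrite mulr_ge0 // exprn_ge0.
rewrite normrM normrX mulrA ler_wpM2r ?exprn_ge0 // normrM normr_nat normrX mulrCA.
case: n {E IH} => [|n]; first by rewrite mul0r mulr_ge0 ?exprn_ge0.
apply: ler_pM => //; first by rewrite mulr_ge0 ?exprn_ge0.
  by rewrite ler_nat leq_addr.
by rewrite !exprS expr0 mulr1 -mulrA !ler_wpM2l // lerXn2r ?nnegrE.
Qed.

Definition pderiv_coef a : nat -> C := fun n => n.+1%:R * a n.+1.

(** The Taylor bound for monomials is summed against the geometric bound on the
    coefficients; with v and w in a disc of radius 1 / (8 B) the factors n^2 are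
    absorbed. *)
Lemma psum_deriv_bound a : geo_bounded a -> exists s K : C, [/\ 0 < s, 0 <= K &
  forall v w, `|v| <= s -> `|w| <= s ->
    `|psum a v - psum a w - psum (pderiv_coef a) w * (v - w)| <= K * `|v - w| ^+ 2].
Proof.
move=> ga; have [B B0 HB] := geo_boundedE ga.
have [s1 s10 ca] := psum_cvg ga.
have [s2 s20 cd] := psum_cvg (geo_bounded_mulS ga).
(* n^2 <= 4^n, so on the disc of radius 1 / (8 B) the terms are below powers of 1/2. *)
pose t := (8 * B)^-1; have t0 : 0 < t by rewrite invr_gt0 mulr_gt0.
(* The order of the complex numbers is partial, so a harmonic sum replaces the minimum. *)
have [s [s0 ss1 ss2 st]] : exists s : C, [/\ 0 < s, s <= s1, s <= s2 & s <= t].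
  exists ((s1^-1 + s2^-1 + t^-1)^-1).
  have h1 : 0 < s1^-1 by rewrite invr_gt0.
  have h2 : 0 < s2^-1 by rewrite invr_gt0.
  have h3 : 0 < t^-1 by rewrite invr_gt0.
  have h : 0 < s1^-1 + s2^-1 + t^-1 by rewrite !addr_gt0.
  split; first by rewrite invr_gt0.
  - by rewrite -[leRHS]invrK lef_pV2 ?posrE // -addrA lerDl addr_ge0  ?(ltW h1) ?(ltW h2) ?(ltW h3).
  - by rewrite -[leRHS]invrK lef_pV2 ?posrE // addrAC lerDr addr_ge0  ?(ltW h1) ?(ltW h2) ?(ltW h3).
  - by rewrite -[leRHS]invrK lef_pV2 ?posrE // lerDr addr_ge0  ?(ltW h1) ?(ltW h2) ?(ltW h3).
exists s, (s ^- 2 * (B * 2)); split => //.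
  apply: mulr_ge0; first by rewrite invr_ge0 exprn_ge0 ?(ltW s0).
  by rewrite mulr_ge0 ?(ltW B0).
move=> v w vs ws.
have cv := ca v (le_trans vs ss1); have cw := ca w (le_trans ws ss1).
have cdw := cd w (le_trans ws ss2).
have cdw' : (fun m => \sum_(0 <= n < m) (n%:R * a n * w ^+ n.-1 : C)) @ \oo --> psum (pderiv_coef a) w.
  rewrite -cvg_shiftS; apply: cvg_ext cdw _ erefl => m.
  by rewrite /series /= [RHS]big_nat_recl //= !mul0r add0r.
apply: (normr_lim_le (cvgB (cvgB cv cw) (cvgM cdw' (cvg_cst (v - w))))) => m /=.
rewrite ?fctE /series /= -!sumrB mulr_suml -sumrB.
rewrite (le_trans (ler_norm_sum _ _ _)) //.
apply: (@le_trans _ _ (\sum_(0 <= n < m) (s ^- 2 * B * `|v - w| ^+ 2) * 2^-1 ^+ n)).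
  apply: ler_sum => n _.
  rewrite [X in `|X|](_ : _ = a n * (v ^+ n - w ^+ n - n%:R * w ^+ n.-1 * (v - w))); last by ring.
  rewrite normrM -(mulrA (s ^- 2)) -(mulrA (s ^- 2)) ler_pdivlMl ?exprn_gt0 // mulrCA.
  apply: (le_trans (ler_wpM2l (normr_ge0 _) (pow_quot_bound _ vs ws))).
  rewrite [leLHS](_ : _ = `|a n| * (n%:R ^+ 2 * s ^+ n) * `|v - w| ^+ 2); last by ring.
  rewrite [leRHS](_ : _ = (B * 2^-1 ^+ n) * `|v - w| ^+ 2); last by ring.
  rewrite ler_wpM2r ?exprn_ge0 //.
  apply: (@le_trans _ _ (B * (4 ^+ n * (B ^+ n * s ^+ n)))).
    rewrite [leRHS](_ : _ = (B * B ^+ n) * (4 ^+ n * s ^+ n)); last by ring.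
    apply: ler_pM => //; first by rewrite mulr_ge0 ?exprn_ge0 // ltW.
    rewrite ler_wpM2r ?exprn_ge0 ?(ltW s0) ?(ltW B0) //.
    have -> : (4 : C) ^+ n = 2 ^+ n ^+ 2.
      by rewrite -exprM mulnC exprM; congr (_ ^+ n); ring.
    by rewrite lerXn2r ?nnegrE ?exprn_ge0 // nat_le_pow2.
  rewrite ler_wpM2l ?(ltW B0) // -!exprMn lerXn2r ?nnegrE //.
    by rewrite !mulr_ge0 ?(ltW s0) ?(ltW B0).
  have Bt : B * t = 8^-1 by rewrite /t; field; rewrite lt0r_neq0.
  have := ler_wpM2l (ltW B0) st; rewrite Bt.
  move=> h; apply: (le_trans (ler_wpM2l _ h)) => //.
  by rewrite (_ : 4 * 8^-1 = 2^-1 :> C) //; field.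
apply: (le_trans (half_sum_le _ _)).
  by rewrite !mulr_ge0 ?invr_ge0 ?exprn_ge0 ?(ltW s0) ?(ltW B0).
by rewrite [leLHS](_ : _ = s ^- 2 * (B * 2) * `|v - w| ^+ 2) //; ring.
Qed.

Lemma psum_deriv a : geo_bounded a -> \forall w \near (0 : C), has_d id (psum a) w (psum (pderiv_coef a) w).
Proof.
move=> /psum_deriv_bound[s [K [s0 K0 H]]].
have ns : \forall w \near (0 : C), `|w| < s by apply: nbhs0_lt.
apply: filterS (near_join ns) => w nw.
have ws : `|w| < s by apply: nbhs_singleton nw.
apply/cvgrPdist_le => e e0.
have K1 : 0 < K + 1 by rewrite ltr_wpDl.
have d0 : 0 < e / (K + 1) by rewrite divr_gt0.
have nd : \forall v \near w, `|w - v| <= e / (K + 1).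
  have /cvgrPdist_le/(_ _ d0) : (fun v : C => v) @ w --> w by exact: cvg_id.
  exact.
rewrite near_withinE; apply: filterS2 nw nd => v /ltW vs vwd vw.
have vw0 : v - w != 0 by rewrite subr_eq0.
rewrite distrC -[X in _ - X](mulfK vw0) -mulrBl normrM normfV.
rewrite ler_pdivrMr ?normr_gt0 //.
apply: (le_trans (H _ _ vs (ltW ws))).
rewrite expr2 mulrA ler_wpM2r // distrC.
apply: (@le_trans _ _ ((K + 1) * `|w - v|)); first by rewrite ler_wpM2r // lerDl.
by rewrite mulrC -ler_pdivlMr.
Qed.

End PowerSeriesCalculus.

(** * Derivatives with respect to a coordinate *)

Section ComplexLimits.
Variables (R : realType) (T : Type) (F : set_system T).
Hypothesis FF : Filter F.
Notation C := (R[i]^o).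
Implicit Types f g : T -> C.

Lemma climD f g (a b : C) : f @ F --> a -> g @ F --> b ->
  (fun y => f y + g y) @ F --> (a + b : C).
Proof. exact: cvgD. Qed.

Lemma climC (a : C) : (fun=> a : C) @ F --> a.
Proof. exact: cvg_cst. Qed.

Lemma climN f (a : C) : f @ F --> a -> (fun y => - f y) @ F --> (- a : C).
Proof. exact: cvgN. Qed.

Lemma climM f g (a b : C) : f @ F --> a -> g @ F --> b ->
  (fun y => f y * g y) @ F --> (a * b : C).
Proof. move=> h1 h2. apply: (cvgM h1 h2). Qed.

Lemma climV f (a : C) : a != 0 -> f @ F --> a ->
  (fun y => (f y)^-1) @ F --> (a^-1 : C).
Proof. move=> h1 h2. apply: (cvgV h1 h2). Qed.

Lemma clim_ext f g (a : C) : (\forall y \near F, f y = g y) ->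
  f @ F --> a -> g @ F --> a.
Proof.
move=> E fl; apply: cvg_trans fl; apply: near_eq_cvg.
by apply: filterS E => y ->.
Qed.

End ComplexLimits.

Section DerivativeRules.
Variables (R : realType) (X : topologicalType).
Notation C := (R[i]^o).
Variables (z : X -> C) (x : X).
Hypothesis zx : ProperFilter x^'.
Hypothesis zc : z @ x --> z x.
Hypothesis zi : \forall y \near x^', z y != z x.
Implicit Types f g : X -> C.

Let xF : Filter x^'. Proof. exact: zx. Qed.

Lemma has_d_ddz f d : has_d z f x d -> ddz z f x = d.
Proof. by move=> h; apply: cvg_lim => //; apply: norm_hausdorff. Qed.

Lemma has_d_ext f g d :
  (\forall y \near x, f y = g y) -> has_d z f x d -> has_d z g x d.
Proof.
move=> E; apply: (clim_ext xF); have -> : f x = g x := nbhs_singleton E.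
by apply: nbhs_dnbhs; apply: filterS E => y ->.
Qed.

Lemma has_d_cvg f d : has_d z f x d -> f @ x^' --> f x.
Proof.
move=> h.
have zc' : z @ x^' --> z x by apply: cvg_trans zc => A; apply: nbhs_dnbhs.
have h1 := climD xF (climM xF h (climD xF zc' (@climC _ _ _ xF (- z x)))) (@climC _ _ _ xF (f x)).
rewrite subrr mulr0 add0r in h1.
refine (clim_ext xF _ h1).
by apply: filterS zi => y yx; rewrite divfK ?subr_eq0 // subrK.
Qed.

Lemma has_d_cst (k : C) : has_d z (fun=> k) x 0.
Proof.
rewrite /has_d; set F := (F in F @ _ --> _).
suff -> : F = fun=> 0 by apply: cvg_cst.
by apply/funext => y; rewrite /F subrr mul0r.
Qed.

Lemma has_dD f g d e : has_d z f x d -> has_d z g x e ->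
  has_d z (fun y => f y + g y) x (d + e).
Proof.
move=> hf hg; apply: (clim_ext xF) (climD xF hf hg).
by apply: nearW => y; rewrite -mulrDl opprD addrACA.
Qed.

Lemma has_dM f g d e : has_d z f x d -> has_d z g x e ->
  has_d z (fun y => f y * g y) x (d * g x + f x * e).
Proof.
move=> hf hg.
apply: (clim_ext xF) (climD xF (climM xF hf (@climC _ _ _ xF (g x))) (climM xF (has_d_cvg hf) hg)).
by apply: nearW => y; ring.
Qed.

Lemma has_dZ (k : C) f d : has_d z f x d -> has_d z (fun y => k * f y) x (k * d).
Proof.
by move=> hf; have := has_dM (has_d_cst k) hf; rewrite mul0r add0r.
Qed.

Lemma has_d_sum I (r : seq I) (f : I -> X -> C) (d : I -> C) :
  (forall i, has_d z (f i) x (d i)) ->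
  has_d z (fun y => \sum_(i <- r) f i y) x (\sum_(i <- r) d i).
Proof.
move=> H; elim: r => [|i r IH].
  rewrite big_nil; have := has_d_cst 0; apply: has_d_ext.
  by apply: nearW => y; rewrite big_nil.
rewrite big_cons; have := has_dD (H i) IH; apply: has_d_ext.
by apply: nearW => y; rewrite big_cons.
Qed.

Lemma has_dV f d : f x != 0 -> has_d z f x d ->
  has_d z (fun y => (f y)^-1) x (- (d * (f x)^-1 * (f x)^-1)).
Proof.
move=> fx0 hf.
have fc := has_d_cvg hf.
have fy0 : \forall y \near x^', f y != 0.
  have f0 : 0 < `|f x| by rewrite normr_gt0.
  move/cvgrPdist_lt : fc => /(_ _ f0); apply: filterS => y.
  by apply: contraTneq => ->; rewrite subr0 ltxx.
apply: (clim_ext xF) (climN xF (climM xF (climM xF hf (climV xF fx0 fc)) (@climC _ _ _ xF (f x)^-1))).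
near=> y.
have y0 : f y != 0 by near: y.
have yx : z y - z x != 0 by rewrite subr_eq0; near: y.
by field; rewrite fx0 yx y0.
Unshelve. all: by end_near. Qed.

Lemma has_d_chain (z' f : X -> C) d e : (\forall y \near x^', z' y != z' x) ->
  has_d z z' x d -> has_d z' f x e -> has_d z f x (d * e).
Proof.
move=> zi' hz hf; apply: (clim_ext xF) (climM xF hz hf).
apply: filterS2 zi zi' => y y0 y1.
by field; rewrite !subr_eq0 y0 y1.
Qed.

End DerivativeRules.

(** * Local coordinates *)

Section LocalCoordinates.
Variables (R : realType) (X : topologicalType).
Notation C := (R[i]^o).
Hypothesis X1 : accessible_space X.

(** What a chart of a Riemann surface provides on its domain U.  Openness of z
    replaces the inverse map z^-1. *)
Definition local_coord (z : X -> C) (U : set X) : Prop :=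
  [/\ open U,
      forall x y, U x -> U y -> z x = z y -> x = y,
      forall x, U x -> z @ x --> z x
    & forall B : set X, open B -> B `<=` U -> open (z @` B)].

(** In a space where points are closed, a punctured neighbourhood of p is a
    neighbourhood of each of its points. *)
Lemma near_join' (p : X) (P : X -> Prop) :
  (\forall y \near p^', P y) -> \forall y \near p^', \forall x \near y, P x.
Proof.
rewrite !near_withinE => h; have := near_join h; apply: filterS => y hy yp.
have op : open (~` [set p]).
  by rewrite openC; apply: accessible_closed_set1.
have yop : nbhs y (~` [set p]) by apply: open_nbhs_nbhs; split => //; apply/eqP.
by apply: filterS2 hy yop => x h1 /eqP; apply: h1.
Qed.

Variables (z : X -> C) (U : set X).
Hypothesis zU : local_coord z U.

Lemma lc_near p : U p -> \forall y \near p, U y.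
Proof. by case: zU => oU _ _ _ Up; apply: open_nbhs_nbhs; split. Qed.

Lemma lc_cont p : U p -> z @ p --> z p.
Proof. by case: zU => _ _ zc _; apply: zc. Qed.

Lemma lc_inj p : U p -> \forall y \near p^', z y != z p.
Proof.
move=> Up; rewrite near_withinE; have := lc_near Up; apply: filterS => y Uy.
by apply: contraNneq; case: zU => _ inj _ _ e; apply/eqP; apply: inj.
Qed.

Lemma lc_cvg p (k : C) : U p -> (fun y => z y - k) @ p^' --> (z p - k)^'.
Proof.
move=> Up A; rewrite /= !near_simpl !near_withinE => hA.
have h1 : (fun y => z y - k) @ p --> z p - k.
  by apply: climD; [exact: lc_cont|exact: cvg_cst].
have h2 : \forall y \near p, z y - k != z p - k -> A (z y - k) := h1 _ hA.
have h3 := lc_inj Up; rewrite near_withinE in h3.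
apply: filterS2 h2 h3 => y hy zy yp; apply: hy.
by apply: contraNneq (zy yp) => /addIr ->.
Qed.

Lemma lc_push p (P : C -> Prop) : U p -> (\forall w \near (0 : C), P w) ->
  \forall y \near p, P (z y - z p).
Proof.
move=> Up hP.
have h1 : (fun y => z y - z p) @ p --> (0 : C).
  rewrite -(subrr (z p)).
  by apply: climD; [exact: lc_cont|exact: cvg_cst].
exact: h1 _ hP.
Qed.

(** Because z is open, every small nonzero w is a value of z - z(p); this carries
    properties from the surface back to the complex plane. *)
Lemma lc_pull p (Q : X -> Prop) : U p -> (\forall y \near p^', Q y) ->
  \forall w \near (0 : C)^', exists2 y, Q y & z y - z p = w.
Proof.
move=> Up; rewrite near_withinE => hQ.
have : nbhs p [set y | U y /\ (y != p -> Q y)].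
  by apply: filterS2 (lc_near Up) hQ.
rewrite nbhsE => -[B [oB Bp] BQ].
have oz : open (z @` B).
  by case: zU => _ _ _ zo; apply: zo oB _ => y /BQ[].
have nz : nbhs (z p) (z @` B) by apply: open_nbhs_nbhs; split => //; exists p.
have /nbhs_normP[e /= e0 eB] := nz.
rewrite near_withinE; apply: filterS (nbhs0_lt e0) => w we w0.
have [|y By zy] := eB (w + z p).
  by rewrite /= opprD addrCA subrr addr0 normrN.
exists y; last by rewrite zy addrK.
have [_] := BQ _ By; apply; apply: contraNneq w0 => yp.
by move: zy; rewrite yp -[LHS]add0r => /addIr ->.
Qed.

(** A point of a surface is not isolated, because its image under an open map is
    not. *)
Lemma lc_proper p : U p -> ProperFilter p^'.
Proof.
move=> Up; apply: Build_ProperFilter_ex => // A hA.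
have P0 : ProperFilter (0 : C)^' by exact: Proper_dnbhs_regular_numFieldType.
have [w [y Ay _]] := @filter_ex _ _ P0 _ (lc_pull Up hA); by exists y.
Qed.

Lemma has_d_comp (F : C -> C) p y d : U y -> has_d id F (z y - z p) d ->
  has_d z (fun x => F (z x - z p)) y d.
Proof.
move=> Uy hF.
have h := @lc_cvg y (z p) Uy.
move=> A hA; have h1 : \forall x \near y^',
  A ((F (z x - z p) - F (z y - z p)) / (id (z x - z p) - id (z y - z p))).
  exact: h _ (hF A hA).
apply: filterS h1 => x; congr A; congr (_ / _).
by rewrite /= opprD addrACA opprK addNr addr0.
Qed.

End LocalCoordinates.

(** * Uniqueness of the coefficients *)

Section Uniqueness.
Variable R : realType.
Notation C := (R[i]^o).

Lemma C_proper (w : C) : ProperFilter w^'.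
Proof. exact: Proper_dnbhs_regular_numFieldType. Qed.

Lemma id_cont (w : C) : id @ w --> id w.
Proof. by move=> A. Qed.

Lemma id_inj_near (w : C) : \forall v \near w^', id v != id w.
Proof. by rewrite near_withinE; apply: filterE. Qed.

(** The value at 0 is the limit of the values near 0, so the constant term
    vanishes; the remaining series is w times a series to which the same argument
    applies. *)
Lemma psum_eq0 (a : nat -> C) : geo_bounded a ->
  (\forall w \near (0 : C)^', psum a w = 0) -> forall n, a n = 0.
Proof.
move=> ga H n.
have a0 (b : nat -> C) : geo_bounded b -> (\forall w \near (0 : C)^', psum b w = 0) -> b 0%N = 0.
  move=> hb0 Hb; have h : has_d id (psum b) 0 (psum (pderiv_coef b) 0).
    exact: nbhs_singleton (psum_deriv hb0).
  have := has_d_cvg (C_proper 0) (@id_cont 0) (id_inj_near 0) h.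
  rewrite psum0 => h1.
  have h2 : (fun=> 0 : C) @ (0 : C)^' --> b 0%N.
    by apply: clim_ext h1.
  have h3 : (fun=> 0 : C) @ (0 : C)^' --> (0 : C).
    by apply: climC.
  have P0 := C_proper 0.
  exact: (cvg_unique (@norm_hausdorff _ _) h2 h3).
elim: n a ga H => [|n IH] a ga H; first exact: a0.
apply: (IH (fun n => a n.+1)); first exact: geo_boundedS.
have a00 := a0 _ ga H.
have aE : consn (a 0%N) (fun n => a n.+1) = a by apply/funext; case.
have E := psum_cons (a 0%N) (geo_boundedS ga); rewrite aE in E.
rewrite near_withinE in H; rewrite near_withinE; apply: filterS2 E H.
move=> w E H w0; have := H w0; rewrite E a00 add0r => /eqP.
by rewrite mulf_eq0 (negPf w0) => /eqP.
Qed.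

End Uniqueness.

(** * Laurent expansions *)

Lemma C_nearW (R : realType) (w : R[i]^o) (P : R[i]^o -> Prop) :
  (forall v, P v) -> \forall v \near w, P v.
Proof. by move=> H; apply: filterE. Qed.

Section LaurentGerms.
Variables (R : realType) (X : topologicalType).
Notation C := (R[i]^o).
Hypothesis X1 : accessible_space X.
Variables (z : X -> C) (U : set X) (p : X).
Hypotheses (zU : local_coord z U) (Up : U p).
Implicit Types (f g : X -> C) (c d : int -> C) (N M : nat).

Definition tail N c : nat -> C := fun j => c (j%:Z - N%:Z).

(** f has the Laurent coefficients c and a pole of order at most N, the pole being
    split off as an explicit factor so that only a power series remains. *)
Definition laurent_le N f c : Prop :=
  [/\ geo_bounded (tail N c), forall k : int, k < - N%:Z -> c k = 0
    & \forall y \near p^', f y = (z y - z p) ^- N * psum (tail N c) (z y - z p)].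

Let pF : ProperFilter p^' := lc_proper zU Up.
Let p_filter : Filter p^' := @filter_filter _ _ pF.

Lemma exprz_tail N (w : C) j : w != 0 -> w ^ (j%:Z - N%:Z) = w ^- N * w ^+ j.
Proof. by move=> w0; rewrite expfzDr // exprnN mulrC. Qed.

Lemma laurent_tail N c (w l : C) : w != 0 ->
  series (fun j : nat => c (j%:Z - N%:Z) * w ^ (j%:Z - N%:Z)) @ \oo --> l <->
  series (fun j => tail N c j * w ^+ j : C) @ \oo --> w ^+ N * l.
Proof.
move=> w0; have wN : w ^+ N != 0 by rewrite expf_neq0.
split=> h.
  apply: cvg_ext (climM _ (@climC _ _ _ _ (w ^+ N)) h) _ erefl => m.
  rewrite /series /= mulr_sumr; apply: eq_bigr => j _.
  by rewrite exprz_tail // mulrCA mulVKf.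
apply: cvg_ext (climM _ (@climC _ _ _ _ (w ^- N)) h) _ _; last by rewrite mulKf.
move=> m; rewrite /series /= mulr_sumr; apply: eq_bigr => j _.
by rewrite exprz_tail // mulrCA.
Qed.

Lemma near_neq0 : \forall y \near p^', z y - z p != 0.
Proof. by apply: filterS (lc_inj zU Up) => y; rewrite subr_eq0. Qed.

Lemma laurent_ex f c : laurent z p f c -> exists N, laurent_le N f c.
Proof.
move=> [N [c0 H]]; exists N.
have hI := @filterI _ _ p_filter _ _ near_neq0 H; split=> //.
  have [y [w0 h]] := @filter_ex _ _ pF _ hI.
  apply: (geo_bounded_cvg w0); exact: cvgP ((laurent_tail N c (f y) w0).1 h).
apply: filterS hI => y [w0 h].
by rewrite (psum_lim ((laurent_tail N c (f y) w0).1 h)) mulKf // expf_neq0.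
Qed.

Lemma laurent_leW N f c : laurent_le N f c -> laurent z p f c.
Proof.
move=> [g0 c0 H]; exists N; split=> //.
have h := lc_push zU Up (psum_cvg_near g0).
have h' : \forall y \near p^', series (fun j => tail N c j * (z y - z p) ^+ j : C)
  @ \oo --> psum (tail N c) (z y - z p) by apply: nbhs_dnbhs h.
apply: filterS3 near_neq0 H h' => y w0 fy hy.
apply: (laurent_tail N c (f y) w0).2.
by rewrite fy mulVKf // expf_neq0.
Qed.

Lemma laurent_le_ext N f g c : (\forall y \near p^', f y = g y) -> laurent_le N f c -> laurent_le N g c.
Proof. by move=> E [g0 c0 H]; split=> //; apply: filterS2 E H => y <-. Qed.

Lemma tail_S N c : (forall k : int, k < - N%:Z -> c k = 0) ->
  tail N.+1 c = consn 0 (tail N c).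
Proof.
move=> c0; apply/funext => -[|j] /=; rewrite /tail.
  by apply: c0; rewrite sub0r ltrN2 ltz_nat.
by congr c; rewrite -addn1 -[N.+1]addn1 !PoszD opprD addrACA subrr addr0.
Qed.

Lemma psum_tail_S N c : geo_bounded (tail N c) -> \forall y \near p^',
  (z y - z p) ^- N.+1 * psum (consn 0 (tail N c)) (z y - z p) =
  (z y - z p) ^- N * psum (tail N c) (z y - z p).
Proof.
move=> g0; have h : \forall y \near p^', _ := nbhs_dnbhs (lc_push zU Up (psum_cons 0 g0)).
apply: filterS2 near_neq0 h => y w0 ->.
by rewrite add0r exprS invfM mulrCA -!mulrA mulVKf // mulrC.
Qed.

Lemma laurent_le_S N f c : laurent_le N f c -> laurent_le N.+1 f c.
Proof.
move=> [g0 c0 H]; have E := tail_S c0; split.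
- by rewrite E; apply: geo_bounded_cons.
- by move=> k kN; apply: c0; apply: (lt_trans kN); rewrite ltrN2 ltz_nat.
- by rewrite E; apply: filterS2 (psum_tail_S g0) H => y -> .
Qed.

Lemma laurent_le_widen N M f c : (N <= M)%N -> laurent_le N f c -> laurent_le M f c.
Proof.
by move=> /subnK <-; elim: (M - N)%N => // n IH /IH; rewrite addSn; apply: laurent_le_S.
Qed.

Lemma laurent_le_P N f c : laurent_le N.+1 f c -> (forall k : int, k < - N%:Z -> c k = 0) -> laurent_le N f c.
Proof.
move=> [g0 _ H] c0; have E := tail_S c0.
have gN : geo_bounded (tail N c) by move: (geo_boundedS g0); rewrite E.
split=> //; rewrite E in H.
by apply: filterS2 (psum_tail_S gN) H => y <-.
Qed.

(** The order N is free as soon as it bounds the pole: it is first raised to a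
    common value and then lowered one step at a time. *)
Lemma laurent_le_at N f c : laurent z p f c -> (forall k : int, k < - N%:Z -> c k = 0) ->
  laurent_le N f c.
Proof.
move=> /laurent_ex[M h] c0.
have {h} : laurent_le (M + N) f c by apply: laurent_le_widen h; rewrite leq_addr.
elim: M => // M IH; rewrite addSn => /laurent_le_P h; apply: IH; apply: h => k kM.
by apply: c0; apply: (lt_le_trans kM); rewrite lerN2 lez_nat leq_addl.
Qed.

Lemma laurent_le0 N : laurent_le N (fun=> 0) (fun=> 0).
Proof.
split=> //; first exact: geo_bounded0.
apply: nearW => y; rewrite (_ : psum _ _ = 0) ?mulr0 //; apply: psum_lim.
apply: cvg_ext (@climC _ _ _ _ 0) _ erefl => m.
by rewrite /series /= big1 // => i _; rewrite /tail mul0r.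
Qed.

Lemma laurent_leD N f g c d : laurent_le N f c -> laurent_le N g d ->
  laurent_le N (fun y => f y + g y) (fun k => c k + d k).
Proof.
move=> [g0 c0 H] [g1 c1 H1]; split; first exact: geo_boundedD.
  by move=> k kN; rewrite c0 // c1 // addr0.
have h := nbhs_dnbhs (lc_push zU Up (psum_add g0 g1)).
by apply: filterS3 H H1 h => y -> -> E; rewrite -mulrDr -E.
Qed.

Lemma laurent_leZ N (k : C) f c : laurent_le N f c -> laurent_le N (fun y => k * f y) (fun j => k * c j).
Proof.
move=> [g0 c0 H]; split; first exact: geo_boundedZ.
  by move=> j jN; rewrite c0 // mulr0.
have h := nbhs_dnbhs (lc_push zU Up (psum_scale k g0)).
by apply: filterS2 H h => y -> E; rewrite mulrCA -E.
Qed.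

Lemma laurent_le_sum I (r : seq I) N (f : I -> X -> C) (c : I -> int -> C) :
  (forall i, laurent_le N (f i) (c i)) ->
  laurent_le N (fun y => \sum_(i <- r) f i y) (fun k => \sum_(i <- r) c i k).
Proof.
move=> H; elim: r => [|i r IH].
  have -> : (fun k => \sum_(i <- [::]) c i k) = fun=> 0.
    by apply/funext => k; rewrite big_nil.
  by apply: laurent_le_ext (laurent_le0 N); apply: nearW => y; rewrite big_nil.
have -> : (fun k => \sum_(j <- i :: r) c j k) = fun k => c i k + \sum_(j <- r) c j k.
  by apply/funext => k; rewrite big_cons.
by apply: laurent_le_ext (laurent_leD (H i) IH); apply: nearW => y; rewrite big_cons.
Qed.

(** Coefficients of the product of two expansions with poles of orders at most N
    and M. *)
Definition lconv N M c d (k : int) : C :=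
  if k + (N + M)%:Z is Posz n then cauchy (tail N c) (tail M d) n else 0.

Lemma tail_lconv N M c d : tail (N + M) (lconv N M c d) = cauchy (tail N c) (tail M d).
Proof. by apply/funext => n; rewrite /tail /lconv subrK. Qed.

Lemma laurent_leM N M f g c d : laurent_le N f c -> laurent_le M g d ->
  laurent_le (N + M) (fun y => f y * g y) (lconv N M c d).
Proof.
move=> [g0 c0 H] [g1 c1 H1]; split; rewrite ?tail_lconv; first exact: geo_bounded_cauchy.
  move=> k kN; rewrite /lconv; case E: (k + _) => [n|//].
  by have : k + (N + M)%:Z < 0; [rewrite -ltrBrDr sub0r|rewrite E].
have h := nbhs_dnbhs (lc_push zU Up (psum_mul g0 g1)).
by apply: filterS3 H H1 h => y -> -> E; rewrite E exprD invfM mulrACA.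
Qed.

(** Uniqueness of Laurent coefficients, for the zero function. *)
Lemma laurent_le_eq0 N f c : laurent_le N f c -> (\forall y \near p^', f y = 0) -> forall k, c k = 0.
Proof.
move=> [g0 c0 H] E k.
have E0 : \forall y \near p^', psum (tail N c) (z y - z p) = 0.
  apply: filterS3 near_neq0 E H => y w0 -> /esym/eqP.
  by rewrite mulf_eq0 invr_eq0 expf_eq0 (negPf w0) andbF => /eqP.
have E1 : \forall w \near (0 : C)^', psum (tail N c) w = 0.
  by apply: filterS (lc_pull zU Up E0) => w [y h <-].
have h := psum_eq0 g0 E1; case: (ltP k (- N%:Z)) => [|kN]; first exact: c0.
have kN0 : 0 <= k + N%:Z by rewrite -lerBlDr sub0r.
have := h (absz (k + N%:Z)); rewrite /tail gez0_abs // addrK; exact.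
Qed.

(** Induction on N with the product rule, from the derivative of 1 / v. *)
Lemma pow_deriv N (w : C) : w != 0 ->
  has_d id (fun v => v ^- N) w (- N%:R * w ^- N.+1).
Proof.
move=> w0; elim: N => [|N IH].
  rewrite oppr0 mul0r; refine (has_d_ext (C_proper w) _ (has_d_cst id w 1)).
  by apply: C_nearW => v; rewrite expr0 invr1.
have hid : has_d id id w 1.
  have E : \forall v \near w^', 1 = (v - w) / (v - w).
    by apply: filterS (id_inj_near w) => v vw; rewrite divff // subr_eq0.
  by apply: (clim_ext (@filter_filter _ _ (C_proper w)) E); apply: climC.
have hV := has_dV (C_proper w) (@id_cont _ w) (id_inj_near w) w0 hid.
have h := has_dM (C_proper w) (@id_cont _ w) (id_inj_near w) IH hV.
have -> : - N.+1%:R * w ^- N.+2 = - N%:R * w ^- N.+1 * (id w)^-1 +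
    w ^- N * - (1 * (id w)^-1 * (id w)^-1).
  by rewrite -natr1 !exprS /=; field; rewrite w0 expf_neq0.
refine (has_d_ext (C_proper w) _ h).
by apply: C_nearW => v; rewrite exprSr invfM /= mulrC.
Qed.

Definition dcoef c : int -> C := fun k => (k + 1)%:~R * c (k + 1).

(** The derivative of w^-N times a power series G is w^-(N+1) times w G' - N G, and
    this is again a power series; comparing coefficients gives (k + 1) c(k + 1).
    The derivative is returned as a function F of the coordinate together with the
    statement that it is the derivative at the nearby points. *)
Lemma laurent_le_dcoef N f c : laurent_le N f c -> exists F : C -> C,
  laurent_le N.+1 (fun y => F (z y - z p)) (dcoef c) /\
  \forall y \near p^', has_d z f y (F (z y - z p)).
Proof.
move=> [g0 c0 H].
have E : tail N.+1 (dcoef c) = fun j => consn 0 (pderiv_coef (tail N c)) j + - N%:R * tail N c j.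
  apply/funext => j; rewrite /tail /dcoef.
  have -> : (j%:Z - N.+1%:Z + 1 = j%:Z - N%:Z)%R.
    by rewrite -addn1 PoszD opprD addrA subrK.
  rewrite intrB mulrBl mulNr; congr (_ - _); case: j => [|j] /=.
    by rewrite mul0r.
  by [].
pose F (w : C) := w ^- N.+1 * psum (tail N.+1 (dcoef c)) w.
have gd := geo_bounded_mulS g0.
have ge : geo_bounded (fun j => - N%:R * tail N c j) by apply: geo_boundedZ.
exists F; split.
  split; last exact: nearW.
    by rewrite E; apply: geo_boundedD ge; apply: geo_bounded_cons.
  move=> k kN; rewrite /dcoef c0 ?mulr0 //.
  by move: kN; rewrite -addn1 PoszD opprD ltrBrDr.
have hF : \forall w \near (0 : C), w != 0 -> F w =
    - N%:R * w ^- N.+1 * psum (tail N c) w + w ^- N * psum (pderiv_coef (tail N c)) w.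
  apply: filterS3 (psum_add (geo_bounded_cons 0 gd) ge) (psum_cons 0 gd) (psum_scale (- N%:R) g0).
  move=> w e1 e2 e3 w0; rewrite /F E e1 e2 e3 add0r exprS; field.
  by rewrite w0 expf_neq0.
have h5 : \forall y \near p^', F (z y - z p) =
    - N%:R * (z y - z p) ^- N.+1 * psum (tail N c) (z y - z p) +
    (z y - z p) ^- N * psum (pderiv_coef (tail N c)) (z y - z p).
  by apply: filterS2 near_neq0 (nbhs_dnbhs (lc_push zU Up hF)) => y w0; apply.
have h4 := nbhs_dnbhs (lc_push zU Up (psum_deriv g0)).
have hU := nbhs_dnbhs (lc_near zU Up).
have h6 := near_join' X1 H.
have h7 : \forall y \near p^', U y /\ z y - z p != 0.
  by apply: filterS2 hU near_neq0 => y.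
have h8 : \forall y \near p^', has_d z (fun x => (z x - z p) ^- N *
    psum (tail N c) (z x - z p)) y (F (z y - z p)).
  apply: filterS3 h4 h5 h7 => y hy Fy [Uy w0].
  have := has_dM (C_proper _) (@id_cont _ _) (@id_inj_near _ _) (@pow_deriv N _ w0) hy.
  by rewrite Fy; apply: (has_d_comp zU Uy).
apply: filterS3 h6 h7 h8 => y fy [Uy _].
apply: has_d_ext; first exact: (lc_proper zU Uy).
by apply: filterS fy => x.
Qed.

End LaurentGerms.

(** * Orders and holomorphy at a point *)

Section Orders.
Variables (R : realType) (X : topologicalType).
Notation C := (R[i]^o).
Hypothesis X1 : accessible_space X.

(** The order at p is at least m; the zero function has every order. *)
Definition ord_ge (z : X -> C) (p : X) (f : X -> C) (m : int) : Prop :=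
  exists2 c, laurent z p f c & forall k : int, k < m -> c k = 0.

Variables (z : X -> C) (U : set X) (p : X).
Hypotheses (zU : local_coord z U) (Up : U p).
Implicit Types (f g : X -> C) (c d : int -> C) (N M : nat).

Let pF : ProperFilter p^' := lc_proper zU Up.
Let p_filter : Filter p^' := @filter_filter _ _ pF.

Lemma ord_ge_lau f m : ord_ge z p f m ->
  exists N0, forall N, (N0 <= N)%N -> exists2 c, laurent_le z p N f c & forall k : int, k < m -> c k = 0.
Proof.
move=> [c /(laurent_ex zU Up)[N h] c0]; exists N => M NM; exists c => //.
exact: (laurent_le_widen zU Up NM h).
Qed.

Lemma laurent_le_ord_ge N f c m : laurent_le z p N f c -> (forall k : int, k < m -> c k = 0) ->
  ord_ge z p f m.
Proof. by move=> h c0; exists c => //; apply: laurent_leW zU Up _ _ _ h. Qed.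

Lemma ord_geW f (m m' : int) : m' <= m -> ord_ge z p f m -> ord_ge z p f m'.
Proof. by move=> mm [c h c0]; exists c => // k km; apply: c0; apply: lt_le_trans mm. Qed.

Lemma ord_ge_ext f g m : (\forall y \near p^', f y = g y) -> ord_ge z p f m -> ord_ge z p g m.
Proof.
move=> E /ord_ge_lau[N /(_ N (leqnn N))[c h c0]].
by apply: (laurent_le_ord_ge _ c0); apply: laurent_le_ext E h.
Qed.

Lemma ord_geD f g m : ord_ge z p f m -> ord_ge z p g m -> ord_ge z p (fun y => f y + g y) m.
Proof.
move=> /ord_ge_lau[N hN] /ord_ge_lau[M hM].
have [c hc c0] := hN _ (leq_addr M N); have [d hd d0] := hM _ (leq_addl N M).
apply: (laurent_le_ord_ge (laurent_leD zU Up hc hd)) => k km.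
by rewrite c0 // d0 // addr0.
Qed.

Lemma ord_geZ (k : C) f m : ord_ge z p f m -> ord_ge z p (fun y => k * f y) m.
Proof.
move=> /ord_ge_lau[N /(_ N (leqnn N))[c h c0]].
apply: (laurent_le_ord_ge (laurent_leZ zU Up k h)) => j jm.
by rewrite c0 // mulr0.
Qed.

Lemma ord_ge0 m : ord_ge z p (fun=> 0) m.
Proof. exact: (laurent_le_ord_ge (laurent_le0 z p 0)). Qed.

Lemma ord_ge_sum I (r : seq I) (f : I -> X -> C) m : (forall i, ord_ge z p (f i) m) ->
  ord_ge z p (fun y => \sum_(i <- r) f i y) m.
Proof.
move=> H; elim: r => [|i r IH].
  by apply: ord_ge_ext (ord_ge0 m); apply: nearW => y; rewrite big_nil.
by apply: ord_ge_ext (ord_geD (H i) IH); apply: nearW => y; rewrite big_cons.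
Qed.

Lemma ord_geM f g (m m' : int) : ord_ge z p f m -> ord_ge z p g m' ->
  ord_ge z p (fun y => f y * g y) (m + m').
Proof.
move=> /ord_ge_lau[N /(_ N (leqnn N))[c hc c0]] /ord_ge_lau[M /(_ M (leqnn M))[d hd d0]].
apply: (laurent_le_ord_ge (laurent_leM zU Up hc hd)) => k km.
rewrite /lconv; case E: (k + _) => [n|//].
rewrite /cauchy big1 // => i _; rewrite /tail.
case: (ltP (i%:Z - N%:Z) m) => [/c0 -> |im]; first by rewrite mul0r.
rewrite d0 ?mulr0 // -subzn ?leq_ord //.
have -> : n%:Z = k + (N + M)%:Z by rewrite E.
rewrite PoszD; lia.
Qed.

Lemma ord_ge_ddz f (m : int) : ord_ge z p f m -> ord_ge z p (ddz z f) (m - 1).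
Proof.
move=> /ord_ge_lau[N /(_ N (leqnn N))[c h c0]].
have [F [hF dF]] := laurent_le_dcoef X1 zU Up h.
have hd : laurent_le z p N.+1 (ddz z f) (dcoef c).
  apply: laurent_le_ext hF; apply: filterS2 dF (nbhs_dnbhs (lc_near zU Up)) => y hy Uy.
  by rewrite (has_d_ddz (lc_proper zU Uy) hy).
apply: (laurent_le_ord_ge hd) => k km; rewrite /dcoef c0 ?mulr0 //; lia.
Qed.

Lemma laurent_le_ddz N f c : laurent_le z p N f c -> laurent_le z p N.+1 (ddz z f) (dcoef c).
Proof.
move=> h; have [F [hF dF]] := laurent_le_dcoef X1 zU Up h.
apply: laurent_le_ext hF; apply: filterS2 dF (nbhs_dnbhs (lc_near zU Up)) => y hy Uy.
by rewrite (has_d_ddz (lc_proper zU Uy) hy).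
Qed.

(** Unlike a Laurent expansion this holds at p itself. *)
Definition taylor f (a : nat -> C) : Prop :=
  geo_bounded a /\ \forall y \near p, f y = psum a (z y - z p).

(** At p the series has the value c 0, which is the value that holomorphy
    requires of f. *)
Lemma holo_taylor f : holo_at z p f <-> exists a, taylor f a.
Proof.
split=> [[c [h c0 fp]]|[a [ga H]]].
  have [g0 _ H] : laurent_le z p 0 f c by apply: (laurent_le_at zU Up h) => k; rewrite oppr0; apply: c0.
  exists (tail 0 c); split=> //.
  rewrite near_withinE in H; apply: filterS H => y hy.
  have [->|yp] := eqVneq y p; last by rewrite hy // expr0 invr1 mul1r.
  by rewrite subrr psum0 fp /tail.
exists (fun k => if k is Posz n then a n else 0); split=> [|[]//|].
  apply: (laurent_leW zU Up (N := 0)).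
  have E : tail 0 (fun k => if k is Posz n then a n else 0) = a.
    by apply/funext => n; rewrite /tail subr0.
  split; rewrite ?E //; first by case.
  by apply: nbhs_dnbhs; apply: filterS H => y ->; rewrite expr0 invr1 mul1r.
by rewrite (nbhs_singleton H) subrr psum0.
Qed.

Lemma holo_ext f g : (\forall y \near p, f y = g y) -> holo_at z p f -> holo_at z p g.
Proof.
move=> E /holo_taylor[a [ga H]]; apply/holo_taylor; exists a; split => //.
by apply: filterS2 E H => y ->.
Qed.

Lemma holo_ord f : holo_at z p f -> ord_ge z p f 0.
Proof. by move=> [c [h c0 _]]; exists c. Qed.

Lemma holo_cst (k : C) : holo_at z p (fun=> k).
Proof.
apply/holo_taylor; exists (consn k (fun=> 0)); split; first exact/geo_bounded_cons/geo_bounded0.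
apply: filterS (lc_push zU Up (psum_cons k (@geo_bounded0 R))) => y ->.
rewrite (_ : psum _ _ = 0) ?mulr0 ?addr0 //; apply: psum_lim.
apply: cvg_ext (@climC _ _ _ _ 0) _ erefl => m.
by rewrite /series /= big1 // => i _; rewrite mul0r.
Qed.

Lemma holoD f g : holo_at z p f -> holo_at z p g -> holo_at z p (fun y => f y + g y).
Proof.
move=> /holo_taylor[a [ga H]] /holo_taylor[b [hb K]]; apply/holo_taylor.
exists (fun n => a n + b n); split; first exact: geo_boundedD.
by apply: filterS3 H K (lc_push zU Up (psum_add ga hb)) => y -> -> ->.
Qed.

Lemma holoM f g : holo_at z p f -> holo_at z p g -> holo_at z p (fun y => f y * g y).
Proof.
move=> /holo_taylor[a [ga H]] /holo_taylor[b [hb K]]; apply/holo_taylor.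
exists (cauchy a b); split; first exact: geo_bounded_cauchy.
by apply: filterS3 H K (lc_push zU Up (psum_mul ga hb)) => y -> -> ->.
Qed.

Lemma holo_sum I (r : seq I) (f : I -> X -> C) : (forall i, holo_at z p (f i)) ->
  holo_at z p (fun y => \sum_(i <- r) f i y).
Proof.
move=> H; elim: r => [|i r IH].
  by apply: holo_ext (holo_cst 0); apply: nearW => y; rewrite big_nil.
by apply: holo_ext (holoD (H i) IH); apply: nearW => y; rewrite big_cons.
Qed.

Lemma taylor_has_d f a : taylor f a ->
  \forall y \near p, has_d z f y (psum (pderiv_coef a) (z y - z p)).
Proof.
move=> [ga H]; apply: filterS3 (near_join H) (lc_push zU Up (psum_deriv ga)) (lc_near zU Up).
move=> y hy dy Uy; have h := has_d_comp zU Uy dy.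
refine (has_d_ext (lc_proper zU Uy) _ h).
by apply: filterS hy => x ->.
Qed.

Lemma holo_has_d f : holo_at z p f -> has_d z f p (ddz z f p).
Proof.
by move=> /holo_taylor[a /taylor_has_d/nbhs_singleton h]; rewrite (has_d_ddz pF h).
Qed.

Lemma holo_ddz f : holo_at z p f -> holo_at z p (ddz z f).
Proof.
move=> /holo_taylor[a h]; apply/holo_taylor; exists (pderiv_coef a).
split; first by case: h => ga _; apply: geo_bounded_mulS.
apply: filterS2 (taylor_has_d h) (lc_near zU Up) => y hy Uy.
by rewrite (has_d_ddz (lc_proper zU Uy) hy).
Qed.

End Orders.

(** * Matrix identities at a point with a Tyurin vector *)

Section LocalAlgebra.
Variables (K : numFieldType) (n : nat).
Implicit Types (a : 'cV[K]_n) (b : 'rV[K]_n) (L W : 'M[K]_n).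

(** Turns a relation between two matrices into a rule for right-nested words, so
    that rewriting normalises products. *)
Lemma mul2_eq m p q r (A : 'M[K]_(m, p)) (B : 'M[K]_(p, q)) (D : 'M[K]_(m, q)) :
  A *m B = D -> forall Z : 'M[K]_(q, r), A *m (B *m Z) = D *m Z.
Proof. by move=> <- Z; rewrite mulmxA. Qed.

Lemma col_mx11 a (M : 'M[K]_1) : a *m M = M 0 0 *: a.
Proof. by rewrite [M in LHS]mx11_scalar mul_mx_scalar. Qed.

(** An antisymmetric pairing of a vector with itself is a 1 x 1 matrix that is its
    own negative. *)
Lemma mx11_anti (M : 'M[K]_1) : M^T = - M -> M = 0.
Proof.
move=> /matrixP/(_ 0 0); rewrite !mxE => /eqP.
rewrite -subr_eq0 opprK -mulr2n mulrn_eq0 /= => /eqP E.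
by apply/matrixP => i j; rewrite !ord1 mxE.
Qed.

Lemma mx11_trmx (M : 'M[K]_1) : M^T = M.
Proof. by apply/matrixP => i j; rewrite !ord1 mxE. Qed.

Let scal m p q := (fun c A B => esym (@scalemxAl K m p q c A B),
  fun c A B => esym (@scalemxAr K m p q c A B),
   mulmx0, mul0mx, mulmx1, mul1mx).

Ltac mxwords := rewrite ?(mulmxDl, mulmxDr, mulmxBl, mulmxBr, mulmxN, mulNmx, mulmx0, mul0mx, mul1mx, mulmx1);
  rewrite -?mulmxA.
Ltac mxlin := apply/matrixP => ? ?; rewrite !mxE; ring.

Section GL.
Variables (a : 'cV[K]_n) (b tb : 'rV[K]_n) (L0 L1 W0 W1 : 'M[K]_n) (k tk : K).
Hypotheses (ba : b *m a = 0) (tba : tb *m a = 1%:M).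
Hypotheses (L0a : L0 *m a = k *: a) (W0a : W0 *m a = tk *: a).
Let Lm := a *m b.
Let Wm := a *m tb.

Let rules := (ba, tba, L0a, W0a, fun m => @mul2_eq _ _ _ m _ _ _ ba,
  fun m => @mul2_eq _ _ _ m _ _ _ tba, fun m => @mul2_eq _ _ _ m _ _ _ L0a,
  fun m => @mul2_eq _ _ _ m _ _ _ W0a).
(** The double pole of D.  As tb a = 1, the commutator with the residue a tb of w
    fixes a b, and this cancels the term from the derivative. *)
Lemma gl_pole2 : - 1 *: Lm + Wm *m Lm - Lm *m Wm = 0.
Proof.
rewrite /Lm /Wm; mxwords; do 6! rewrite ?rules ?scal -?mulmxA.
mxlin.
Qed.

(** The residue of D has again the form a b' with b' a = 0. *)
Lemma gl_pole1 : exists b', [/\ 0 *: L0 + (Wm *m L0 + W0 *m Lm) - (Lm *m W0 + L0 *m Wm)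
  = a *m b' & b' *m a = 0].
Proof.
(* The row that multiplies a from the right once L0 and W0 have been moved to the left of a. *)
exists (tb *m L0 - k *: tb + tk *: b - b *m W0); split.
  rewrite /Lm /Wm; mxwords; do 6! rewrite ?rules ?scal -?mulmxA.
  mxlin.
mxwords; do 6! rewrite ?rules ?scal -?mulmxA; mxlin.
Qed.

(** a remains an eigenvector of the constant term of D. *)
Lemma gl_const : exists k' : K, (1 *: L1 + (Wm *m L1 + W0 *m L0 + W1 *m Lm)
   - (Lm *m W1 + L0 *m W0 + L1 *m Wm)) *m a = k' *: a.
Proof.
exists ((tb *m L1 *m a) 0 0 - (b *m W1 *m a) 0 0).
rewrite scalerBl -!col_mx11 /Lm /Wm; mxwords; do 6! rewrite ?rules ?scal -?mulmxA.
mxlin.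
Qed.

End GL.

Section SO.
Variables (a : 'cV[K]_n) (b tb : 'rV[K]_n) (L0 L1 W0 W1 : 'M[K]_n) (k tk : K).
Hypotheses (aa : a^T *m a = 0) (ba : b *m a = 0) (tba : tb *m a = 1%:M).
Hypotheses (L0a : L0 *m a = k *: a) (W0a : W0 *m a = tk *: a).
Hypotheses (sL0 : L0^T = - L0) (sL1 : L1^T = - L1) (sW0 : W0^T = - W0) (sW1 : W1^T = - W1).
Let Lm := a *m b - b^T *m a^T.
Let Wm := a *m tb - tb^T *m a^T.
Let s := (tb *m b^T) 0 0.

Let ab : a^T *m b^T = 0. Proof. by rewrite -trmx_mul ba trmx0. Qed.
Let atb : a^T *m tb^T = 1%:M. Proof. by rewrite -trmx_mul tba trmx1. Qed.
Let aL0 : a^T *m L0 = - k *: a^T.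
Proof. by rewrite -[L0]opprK -sL0 mulmxN -trmx_mul L0a linearZ scaleNr. Qed.
Let aW0 : a^T *m W0 = - tk *: a^T.
Proof. by rewrite -[W0]opprK -sW0 mulmxN -trmx_mul W0a linearZ scaleNr. Qed.
Let tbb : tb *m b^T = s%:M. Proof. exact: mx11_scalar. Qed.
Let btb : b *m tb^T = s%:M.
Proof. by rewrite -[b *m _]mx11_trmx trmx_mul trmxK tbb. Qed.
Let aSa (Y : 'M[K]_n) : Y^T = - Y -> a^T *m (Y *m a) = 0.
Proof.
by move=> sY; apply: mx11_anti; rewrite !trmx_mul trmxK sY mulmxN mulNmx -mulmxA.
Qed.
Let aL1a := aSa sL1.
Let aW1a := aSa sW1.

Let rules := (aa, ba, tba, ab, atb, L0a, W0a, aL0, aW0, tbb, btb, aL1a, aW1a,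
  (fun m => @mul2_eq _ _ _ m _ _ _ aa,
  fun m => @mul2_eq _ _ _ m _ _ _ ba,
  fun m => @mul2_eq _ _ _ m _ _ _ tba, fun m => @mul2_eq _ _ _ m _ _ _ ab,
  fun m => @mul2_eq _ _ _ m _ _ _ atb, fun m => @mul2_eq _ _ _ m _ _ _ L0a,
  fun m => @mul2_eq _ _ _ m _ _ _ W0a, fun m => @mul2_eq _ _ _ m _ _ _ aL0,
  fun m => @mul2_eq _ _ _ m _ _ _ aW0, fun m => @mul2_eq _ _ _ m _ _ _ tbb,
  fun m => @mul2_eq _ _ _ m _ _ _ btb), (mul_scalar_mx, mul_mx_scalar)).

(** As for gl; the products of tb and b, which appear with both signs, cancel. *)
Lemma so_pole2 : - 1 *: Lm + Wm *m Lm - Lm *m Wm = 0.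
Proof.
rewrite /Lm /Wm; mxwords; do 6! rewrite ?rules ?scal -?mulmxA.
mxlin.
Qed.

(** The transposed identities for the skew matrices L0 and W0 make the row and the
    column part of the residue opposite transposes. *)
Lemma so_pole1 : exists b' : 'rV[K]_n,
  0 *: L0 + (Wm *m L0 + W0 *m Lm) - (Lm *m W0 + L0 *m Wm)
  = a *m b' - b'^T *m a^T /\ b' *m a = 0.
Proof.
exists (tb *m L0 - k *: tb + tk *: b - b *m W0); split.
  have -> : (tb *m L0 - k *: tb + tk *: b - b *m W0)^T =
     - (L0 *m tb^T) - k *: tb^T + tk *: b^T + W0 *m b^T.
    by rewrite !linearD !linearN !linearZ /= !trmx_mul sL0 sW0 !mulNmx opprK.
  rewrite /Lm /Wm; mxwords; do 6! rewrite ?rules ?scal -?mulmxA.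
  mxlin.
mxwords; do 6! rewrite ?rules ?scal -?mulmxA; mxlin.
Qed.

Lemma so_const : exists k' : K, (1 *: L1 + (Wm *m L1 + W0 *m L0 + W1 *m Lm)
   - (Lm *m W1 + L0 *m W0 + L1 *m Wm)) *m a = k' *: a.
Proof.
exists ((tb *m L1 *m a) 0 0 - (b *m W1 *m a) 0 0).
rewrite scalerBl -!col_mx11 /Lm /Wm; mxwords; do 6! rewrite ?rules ?scal -?mulmxA.
mxlin.
Qed.

End SO.

Section SP.
Variables (a : 'cV[K]_n) (b tb : 'rV[K]_n) (L0 L1 L2 W0 W1 W2 W3 sg : 'M[K]_n).
Variables (k tk nu : K).
Hypotheses (sgT : sg^T = - sg).
Hypotheses (ba : b *m sg *m a = 0) (tba : tb *m sg *m a = 1%:M).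
Hypotheses (L0a : L0 *m a = k *: a) (W0a : W0 *m a = tk *: a).
Hypotheses (sL0 : L0^T *m sg + sg *m L0 = 0) (sW0 : W0^T *m sg + sg *m W0 = 0).
Hypotheses (sW1 : W1^T *m sg + sg *m W1 = 0).
Hypotheses (aL1a : a^T *m sg *m L1 *m a = 0) (aW1a : a^T *m sg *m W1 *m a = 0).
Let Ln := nu *: (a *m a^T *m sg).
Let Lm := (a *m b + b^T *m a^T) *m sg.
Let Wm := (a *m tb + tb^T *m a^T) *m sg.
Let s := (tb *m (sg *m b^T)) 0 0.

Let asa : a^T *m (sg *m a) = 0.
Proof.
by apply: mx11_anti; rewrite !trmx_mul trmxK sgT mulmxN mulNmx -mulmxA.
Qed.
Let bsa : b *m (sg *m a) = 0. Proof. by rewrite mulmxA. Qed.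
Let tbsa : tb *m (sg *m a) = 1%:M. Proof. by rewrite mulmxA. Qed.
Let asb : a^T *m (sg *m b^T) = 0.
Proof.
have := congr1 trmx bsa; rewrite trmx_mul trmx_mul sgT trmx0 mulmxN mulNmx -mulmxA.
by move/eqP; rewrite oppr_eq0 => /eqP.
Qed.
Let astb : a^T *m (sg *m tb^T) = - 1%:M.
Proof.
have := congr1 trmx tbsa; rewrite trmx_mul trmx_mul sgT trmx1 mulmxN mulNmx -mulmxA.
by move=> <-; rewrite opprK.
Qed.
Let sgL0 : sg *m L0 = - (L0^T *m sg).
Proof. by apply/eqP; rewrite -addr_eq0 addrC sL0. Qed.
Let sgW0 : sg *m W0 = - (W0^T *m sg).
Proof. by apply/eqP; rewrite -addr_eq0 addrC sW0. Qed.
Let sgW1 : sg *m W1 = - (W1^T *m sg).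
Proof. by apply/eqP; rewrite -addr_eq0 addrC sW1. Qed.
Let aL0 : a^T *m (sg *m L0) = - k *: (a^T *m sg).
Proof. by rewrite sgL0 mulmxN mulmxA -trmx_mul L0a linearZ /= -scalemxAl scaleNr. Qed.
Let aW0 : a^T *m (sg *m W0) = - tk *: (a^T *m sg).
Proof. by rewrite sgW0 mulmxN mulmxA -trmx_mul W0a linearZ /= -scalemxAl scaleNr. Qed.
Let tbb : tb *m (sg *m b^T) = s%:M. Proof. exact: mx11_scalar. Qed.
Let btb : b *m (sg *m tb^T) = - s%:M.
Proof.
rewrite -[b *m _]mx11_trmx !trmx_mul trmxK sgT mulmxN mulNmx; congr (- _).
by rewrite -mulmxA tbb.
Qed.
Let aL1a' : a^T *m (sg *m (L1 *m a)) = 0. Proof. by rewrite !mulmxA. Qed.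
Let aW1a' : a^T *m (sg *m (W1 *m a)) = 0. Proof. by rewrite !mulmxA. Qed.

Let mul3_eq m p q r t (A : 'M[K]_(m, p)) (B : 'M[K]_(p, q)) (D : 'M[K]_(q, r)) (E : 'M[K]_(m, r)) :
  A *m (B *m D) = E -> forall Z : 'M[K]_(r, t), A *m (B *m (D *m Z)) = E *m Z.
Proof. by move=> <- Z; rewrite !mulmxA. Qed.

Let rules := (asa, bsa, tbsa, asb, astb, L0a, W0a, aL0, aW0, tbb, btb, aL1a', aW1a',
  (fun m => @mul3_eq _ _ _ _ m _ _ _ _ asa,
  fun m => @mul3_eq _ _ _ _ m _ _ _ _ bsa,
  fun m => @mul3_eq _ _ _ _ m _ _ _ _ tbsa, fun m => @mul3_eq _ _ _ _ m _ _ _ _ asb,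
  fun m => @mul3_eq _ _ _ _ m _ _ _ _ astb, fun m => @mul2_eq _ _ _ m _ _ _ L0a,
  fun m => @mul2_eq _ _ _ m _ _ _ W0a, fun m => @mul3_eq _ _ _ _ m _ _ _ _ aL0,
  fun m => @mul3_eq _ _ _ _ m _ _ _ _ aW0, fun m => @mul3_eq _ _ _ _ m _ _ _ _ tbb,
  fun m => @mul3_eq _ _ _ _ m _ _ _ _ btb), (mul_scalar_mx, mul_mx_scalar)).

Ltac spn := mxwords; do 8! rewrite ?rules ?scal ?(mulmxN, mulNmx) -?mulmxA.

(** The commutator with the residue of w multiplies a a^T sg by 2, the order of
    the pole. *)
Lemma sp_pole3 : - 2 *: Ln + Wm *m Ln - Ln *m Wm = 0.
Proof. rewrite /Ln /Wm; spn; mxlin. Qed.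

(** The simple-pole part of L is fixed by the commutator up to a multiple of
    a a^T sg, so only such a multiple survives. *)
Lemma sp_pole2 : exists nu' : K, - 1 *: Lm + (Wm *m Lm + W0 *m Ln) - (Ln *m W0 + Lm *m Wm)
  = nu' *: (a *m a^T *m sg).
Proof. exists (2 * s + 2 * tk * nu); rewrite /Ln /Lm /Wm; spn; mxlin. Qed.

Lemma sp_pole1 : exists b' : 'rV[K]_n,
  0 *: L0 + (Wm *m L0 + W0 *m Lm + W1 *m Ln) - (Ln *m W1 + Lm *m W0 + L0 *m Wm)
  = (a *m b' + b'^T *m a^T) *m sg /\ b' *m sg *m a = 0.
Proof.
(* Read off from the coefficient of a on the left; transposes replace sg-conjugates of L0, W0 and W1. *)
exists (- (tb *m L0^T) - k *: tb + tk *: b + b *m W0^T + nu *: (a^T *m W1^T)); split.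
  have -> : (- (tb *m L0^T) - k *: tb + tk *: b + b *m W0^T + nu *: (a^T *m W1^T))^T =
     - (L0 *m tb^T) - k *: tb^T + tk *: b^T + W0 *m b^T + nu *: (W1 *m a).
    by rewrite !linearD !linearN !linearZ /= !trmx_mul !trmxK.
  have tL : tb *m (L0^T *m sg) = - (tb *m (sg *m L0)) by rewrite sgL0 mulmxN opprK.
  have bW : b *m (W0^T *m sg) = - (b *m (sg *m W0)) by rewrite sgW0 mulmxN opprK.
  have aW : a^T *m (W1^T *m sg) = - (a^T *m (sg *m W1)) by rewrite sgW1 mulmxN opprK.
  rewrite /Ln /Lm /Wm; spn; rewrite ?(tL, bW, aW, mulmxN, scalerN); mxlin.
have tL : tb *m (L0^T *m (sg *m a)) = - (tb *m (sg *m (L0 *m a))).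
  by rewrite !mulmxA -[tb *m sg *m L0]mulmxA sgL0 mulmxN mulNmx opprK !mulmxA.
have bW : b *m (W0^T *m (sg *m a)) = - (b *m (sg *m (W0 *m a))).
  by rewrite !mulmxA -[b *m sg *m W0]mulmxA sgW0 mulmxN mulNmx opprK !mulmxA.
have aW : a^T *m (W1^T *m (sg *m a)) = - (a^T *m (sg *m (W1 *m a))).
  by rewrite !mulmxA -[a^T *m sg *m W1]mulmxA sgW1 mulmxN mulNmx opprK !mulmxA.
spn; rewrite ?(tL, bW, aW); spn; mxlin.
Qed.

Lemma sp_const : exists k' : K,
  (1 *: L1 + (Wm *m L1 + W0 *m L0 + W1 *m Lm + W2 *m Ln)
   - (Ln *m W2 + Lm *m W1 + L0 *m W0 + L1 *m Wm)) *m a = k' *: a.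
Proof.
exists ((tb *m sg *m L1 *m a) 0 0 - (b *m sg *m W1 *m a) 0 0
  - nu * (a^T *m sg *m W2 *m a) 0 0).
rewrite !scalerBl -scalerA -!col_mx11 /Ln /Lm /Wm; spn; mxlin.
Qed.

(** The derivative contributes 2 L2 and the commutator with the residue - 2 L2
    between a^T sg and a; all other terms vanish separately. *)
Lemma sp_linear : a^T *m sg *m
  (2 *: L2 + (Wm *m L2 + W0 *m L1 + W1 *m L0 + W2 *m Lm + W3 *m Ln)
   - (Ln *m W3 + Lm *m W2 + L0 *m W1 + L1 *m W0 + L2 *m Wm)) *m a = 0.
Proof. rewrite /Ln /Lm /Wm; spn; mxlin. Qed.

End SP.
End LocalAlgebra.

(** * The conditions on Laurent coefficients *)

Section LaxCoefficients.
Variables (R : realType) (n : nat).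
Notation C := (R[i]).
Notation M := ('M[C]_n).
Implicit Types (c d : int -> M) (t : lax_type R n) (al : 'cV[C]_n).

(** Coefficients of a product of matrix-valued expansions with poles of orders at
    most N1 and N2; it vanishes below - (N1 + N2). *)
Definition mx_conv (N1 N2 : nat) c d (k : int) : M :=
  if k + (N1 + N2)%:Z is Posz m
  then \sum_(i < m.+1) c (i%:Z - N1%:Z) *m d ((m - i)%N%:Z - N2%:Z) else 0.

(** The lowest coefficients of a product are needed one by one; the number in the
    name is the number of terms. *)
Lemma conv1 N1 N2 c d k : k + (N1 + N2)%:Z = Posz 0 ->
  mx_conv N1 N2 c d k = c (- N1%:Z) *m d (- N2%:Z).
Proof. by rewrite /mx_conv => ->; rewrite big_ord_recl big_ord0 addr0 !sub0r. Qed.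

Lemma conv_lt N1 N2 c d k : k < - (N1 + N2)%:Z -> mx_conv N1 N2 c d k = 0.
Proof.
move=> h; rewrite /mx_conv; case E: (k + _) => [m|//].
by have : k + (N1 + N2)%:Z < 0; [rewrite -ltrBrDr sub0r|rewrite E].
Qed.

Lemma conv2 N1 N2 c d k : k + (N1 + N2)%:Z = Posz 1 ->
  mx_conv N1 N2 c d k = c (- N1%:Z) *m d (1 - N2%:Z) + c (1 - N1%:Z) *m d (- N2%:Z).
Proof.
by rewrite /mx_conv => ->; rewrite !big_ord_recl big_ord0 addr0 !sub0r.
Qed.

Lemma conv3 N1 N2 c d k : k + (N1 + N2)%:Z = Posz 2 ->
  mx_conv N1 N2 c d k = c (- N1%:Z) *m d (2 - N2%:Z) + c (1 - N1%:Z) *m d (1 - N2%:Z)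
   + c (2 - N1%:Z) *m d (- N2%:Z).
Proof.
by rewrite /mx_conv => ->; rewrite !big_ord_recl big_ord0 addr0 !sub0r addrA.
Qed.

Lemma conv4 N1 N2 c d k : k + (N1 + N2)%:Z = Posz 3 ->
  mx_conv N1 N2 c d k = c (- N1%:Z) *m d (3 - N2%:Z) + c (1 - N1%:Z) *m d (2 - N2%:Z)
   + c (2 - N1%:Z) *m d (1 - N2%:Z) + c (3 - N1%:Z) *m d (- N2%:Z).
Proof.
by rewrite /mx_conv => ->; rewrite !big_ord_recl big_ord0 addr0 !sub0r !addrA.
Qed.

Lemma conv5 N1 N2 c d k : k + (N1 + N2)%:Z = Posz 4 ->
  mx_conv N1 N2 c d k = c (- N1%:Z) *m d (4 - N2%:Z) + c (1 - N1%:Z) *m d (3 - N2%:Z)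
   + c (2 - N1%:Z) *m d (2 - N2%:Z) + c (3 - N1%:Z) *m d (1 - N2%:Z)
   + c (4 - N1%:Z) *m d (- N2%:Z).
Proof.
by rewrite /mx_conv => ->; rewrite !big_ord_recl big_ord0 addr0 !sub0r !addrA.
Qed.

Definition pole_bound t : nat := match t with Ts => 0 | Tsp _ => 2 | _ => 1 end.

Lemma lax_condition_lt t al c : lax_condition t al c ->
  forall k : int, k < - (pole_bound t)%:Z -> c k = 0.
Proof. by case: t => [|||sg|] /=; try by case. Qed.

(** Coefficients of dL/dz + [w, L], where w has at most a simple pole and L a pole
    of order at most N. *)
Definition conn_coef (N : nat) cw c (k : int) : M :=
  (k + 1)%:~R *: c (k + 1) + mx_conv 1 N cw c k - mx_conv N 1 c cw k.

Lemma conn_coef_gl_aux cw c :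
  (forall k : int, k < -1 -> c k = 0) ->
  conn_coef 1 cw c (-2) = - 1 *: c (-1) + cw (-1) *m c (-1) - c (-1) *m cw (-1) /\
  conn_coef 1 cw c (-1) = 0 *: c 0 + (cw (-1) *m c 0 + cw 0 *m c (-1)) -
     (c (-1) *m cw 0 + c 0 *m cw (-1)) /\
  conn_coef 1 cw c 0 = 1 *: c 1 + (cw (-1) *m c 1 + cw 0 *m c 0 + cw 1 *m c (-1)) -
     (c (-1) *m cw 1 + c 0 *m cw 0 + c 1 *m cw (-1)) /\
  forall k : int, k < -2 -> conn_coef 1 cw c k = 0.
Proof.
move=> c0; split; last split; last split.
- by rewrite /conn_coef !conv1.
- by rewrite /conn_coef !conv2.
- by rewrite /conn_coef !conv3.
- move=> k k2; rewrite /conn_coef !conv_lt // c0 ?scaler0 ?subr0 ?addr0 //; lia.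
Qed.

Lemma lax_conn_gl al cw c :
  connection_condition Tgl al cw -> lax_condition Tgl al c ->
  lax_condition Tgl al (conn_coef 1 cw c).
Proof.
move=> [w0 [[tk W0a] [tb [Wm tba]]]] [c0 [b [Lm ba]] [k L0a]].
have [E2 [E1 [E0 El]]] := conn_coef_gl_aux cw c0.
split.
- move=> j j1; have [->|j2] := eqVneq j (-2); last by apply: El; lia.
  by rewrite E2 Wm Lm; apply: gl_pole2 ba tba.
- have [b' [e1 e2]] := gl_pole1 (L0 := c 0) (W0 := cw 0) ba tba L0a W0a.
  exists b'^T; rewrite trmxK E1 Wm Lm; split; [exact: e1|exact: e2].
- have [k' e] := gl_const (c 1) (cw 1) ba tba L0a W0a.
  by exists k'; rewrite E0 Wm Lm e.
Qed.

Lemma lax_conn_so al cw c : al^T *m al = 0 ->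
  (forall k, (c k)^T = - c k) -> (forall k, (cw k)^T = - cw k) ->
  connection_condition Tso al cw -> lax_condition Tso al c ->
  lax_condition Tso al (conn_coef 1 cw c).
Proof.
move=> aa sc sw [w0 [[tk W0a] [tb [Wm tba]]]] [c0 [b [Lm ba]] [k L0a]].
have [E2 [E1 [E0 El]]] := conn_coef_gl_aux cw c0.
rewrite -[b in X in _ - X]trmxK in Lm; rewrite -[tb in X in _ - X]trmxK in Wm.
split.
- move=> j j1; have [->|j2] := eqVneq j (-2); last by apply: El; lia.
  by rewrite E2 Wm Lm; apply: so_pole2 aa ba tba.
- have [b' [e1 e2]] := so_pole1 ba tba L0a W0a (sc 0) (sw 0).
  exists b'^T; rewrite trmxK E1 Wm Lm; split; [exact: e1|exact: e2].
- have [k' e] := so_const aa ba tba L0a W0a (sc 1) (sw 1).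
  by exists k'; rewrite E0 Wm Lm e.
Qed.

Lemma conn_coef_sp_aux cw c :
  [/\ conn_coef 2 cw c (-3) = - 2 *: c (-2) + cw (-1) *m c (-2) - c (-2) *m cw (-1),
  conn_coef 2 cw c (-2) = - 1 *: c (-1) + (cw (-1) *m c (-1) + cw 0 *m c (-2)) -
     (c (-2) *m cw 0 + c (-1) *m cw (-1)),
  conn_coef 2 cw c (-1) = 0 *: c 0 + (cw (-1) *m c 0 + cw 0 *m c (-1) + cw 1 *m c (-2)) -
     (c (-2) *m cw 1 + c (-1) *m cw 0 + c 0 *m cw (-1)),
  conn_coef 2 cw c 0 = 1 *: c 1 +
     (cw (-1) *m c 1 + cw 0 *m c 0 + cw 1 *m c (-1) + cw 2 *m c (-2)) -
     (c (-2) *m cw 2 + c (-1) *m cw 1 + c 0 *m cw 0 + c 1 *m cw (-1))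
  & conn_coef 2 cw c 1 = 2 *: c 2 +
     (cw (-1) *m c 2 + cw 0 *m c 1 + cw 1 *m c 0 + cw 2 *m c (-1) + cw 3 *m c (-2)) -
     (c (-2) *m cw 3 + c (-1) *m cw 2 + c 0 *m cw 1 + c 1 *m cw 0 + c 2 *m cw (-1))].
Proof.
split.
- by rewrite /conn_coef !conv1.
- by rewrite /conn_coef !conv2.
- by rewrite /conn_coef !conv3.
- by rewrite /conn_coef !conv4.
- by rewrite /conn_coef !conv5.
Qed.

Lemma lax_conn_sp sg al cw c : sg^T = - sg ->
  (forall k, (c k)^T *m sg + sg *m c k = 0) -> (forall k, (cw k)^T *m sg + sg *m cw k = 0) ->
  connection_condition (Tsp sg) al cw -> lax_condition (Tsp sg) al c ->
  lax_condition (Tsp sg) al (conn_coef 2 cw c).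
Proof.
move=> sgT sc sw [w0 [[tk W0a] [[tb [Wm tba]] aW1]]] [c0 [nu Ln] [b [Lm ba]] [k L0a] aL1].
have [E3 E2 E1 E0 El] := conn_coef_sp_aux cw c.
rewrite -[b in X in _ + X]trmxK in Lm; rewrite -[tb in X in _ + X]trmxK in Wm.
split.
- move=> j j1; have [->|j3] := eqVneq j (-3); last first.
    by rewrite /conn_coef !conv_lt ?c0 ?scaler0 ?subr0 ?addr0 //; lia.
  by rewrite E3 Wm Ln; apply: sp_pole3 nu sgT tba.
- have [nu' e] := sp_pole2 nu sgT ba tba W0a (sw 0).
  by exists nu'; rewrite E2 Wm Lm Ln e.
- have [b' [e1 e2]] := sp_pole1 nu ba tba L0a W0a (sc 0) (sw 0) (sw 1) aW1.
  exists b'^T; rewrite trmxK E1 Wm Lm Ln; split; [exact: e1|exact: e2].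
- have [k' e] := sp_const (cw 2) nu sgT ba tba L0a W0a aL1 aW1.
  by exists k'; rewrite E0 Wm Lm Ln e.
- rewrite El Wm Lm Ln.
  exact: (sp_linear (c 2) (cw 2) (cw 3) nu sgT ba tba L0a W0a (sc 0) (sw 0) aL1 aW1).
Qed.

(** The polar coefficients, which multiplication by h mixes into the others,
    annihilate alpha, so the eigenvector conditions survive.  For sp the new
    residue vector is shifted by a multiple of alpha, which accounts for the double
    pole. *)
Lemma lax_scale t al (h : int -> C) c : tyurin_ok t al ->
  (forall sg, t = Tsp sg -> sg^T = - sg) ->
  lax_condition t al c ->
  lax_condition t al (mx_conv 0 (pole_bound t) (fun k => (h k)%:M) c).
Proof.
have e1 c0 : mx_conv 0 1 (fun k => (h k)%:M) c0 (-1) = h 0 *: c0 (-1).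
  by rewrite conv1 // mul_scalar_mx.
have e0 c0 : mx_conv 0 1 (fun k => (h k)%:M) c0 0 = h 0 *: c0 0 + h 1 *: c0 (-1).
  by rewrite conv2 // !mul_scalar_mx.
have d2 : mx_conv 0 2 (fun k => (h k)%:M) c (-2) = h 0 *: c (-2).
  by rewrite conv1 // mul_scalar_mx.
have d1 : mx_conv 0 2 (fun k => (h k)%:M) c (-1) = h 0 *: c (-1) + h 1 *: c (-2).
  by rewrite conv2 // !mul_scalar_mx.
have d0 : mx_conv 0 2 (fun k => (h k)%:M) c 0 = h 0 *: c 0 + h 1 *: c (-1) + h 2 *: c (-2).
  by rewrite conv3 // !mul_scalar_mx.
have d1' : mx_conv 0 2 (fun k => (h k)%:M) c 1 =
    h 0 *: c 1 + h 1 *: c 0 + h 2 *: c (-1) + h 3 *: c (-2).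
  by rewrite conv4 // !mul_scalar_mx.
have GL : lax_condition Tgl al c ->
  lax_condition Tgl al (mx_conv 0 1 (fun k => (h k)%:M) c).
  move=> [c0 [b [Lm ba]] [k L0a]]; split; first by move=> j j1; rewrite conv_lt.
    exists (h 0 *: b); rewrite e1 Lm linearZ /= -scalemxAr; split=> //.
    by rewrite -scalemxAl ba scaler0.
  exists (h 0 * k); rewrite e0 Lm mulmxDl -!scalemxAl L0a -mulmxA ba mulmx0 scaler0 addr0.
  by rewrite scalerA.
case: t => [||| sg |] ok skew //=.
- move=> [c0 [b [Lm ba]] [k L0a]]; split; first by move=> j j1; rewrite conv_lt.
    exists (h 0 *: b); rewrite e1 Lm linearZ /= -scalemxAr -scalemxAl scalerBr; split=> //.
    by rewrite -scalemxAl ba scaler0.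
  exists (h 0 * k); rewrite e0 Lm mulmxDl -!scalemxAl L0a mulmxBl -!mulmxA ba.
  by rewrite ok !mulmx0 subr0 scaler0 addr0 scalerA.
- move=> [c0 [nu Ln] [b [Lm ba]] [k L0a] aL1]; have sgT := skew _ erefl.
  have asa : al^T *m sg *m al = 0.
    by apply: mx11_anti; rewrite !trmx_mul trmxK sgT mulNmx mulmxN -mulmxA.
  have Lna : c (-2) *m al = 0.
    by rewrite Ln -scalemxAl -!mulmxA (mulmxA al^T) asa mulmx0 scaler0.
  have Lma : c (-1) *m al = 0.
    by rewrite Lm -!mulmxA mulmxDl -!mulmxA !(mulmxA _ sg) ba asa !mulmx0 addr0.
  split; first by move=> j j1; rewrite conv_lt.
  - by exists (h 0 * nu); rewrite d2 Ln scalerA.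
  (* Half of h 1 * nu goes to each of the two symmetric terms. *)
  - exists (h 0 *: b + (h 1 * nu / 2) *: al); split; last first.
      by rewrite linearD !linearZ /= !mulmxDl -!scalemxAl ba asa !scaler0 addr0.
    have -> : (h 0 *: b + (h 1 * nu / 2) *: al)^T = h 0 *: b^T + (h 1 * nu / 2) *: al^T.
      by rewrite linearD !linearZ.
    rewrite d1 Lm Ln !(mulmxDr, mulmxDl) -!scalemxAr -!scalemxAl.
    move: (al *m b^T *m sg) (b *m al^T *m sg) (al *m al^T *m sg) => P Q T.
    by apply/matrixP => i j; rewrite !mxE; field.
  - exists (h 0 * k); rewrite d0 !mulmxDl -!scalemxAl L0a Lna Lma !scaler0 !addr0.
    by rewrite scalerA.
  rewrite d1' -(mulmxA _ _ al) !mulmxDl -!scalemxAl Lna Lma L0a !scaler0 !addr0.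
  by rewrite mulmxDr -!scalemxAr asa !scaler0 addr0 mulmxA aL1 scaler0.
- by move=> c0 k k0; rewrite conv_lt.
Qed.

End LaxCoefficients.

(** * Matrix-valued Laurent expansions *)

Section MatrixFunctions.
Variables (R : realType) (X : topologicalType) (n : nat).
Notation C := (R[i]^o).
Notation M := ('M[R[i]]_n).
Hypothesis X1 : accessible_space X.
Variables (z : X -> C) (U : set X) (p : X).
Hypotheses (zU : local_coord z U) (Up : U p).
Implicit Types (L A B : X -> M) (c d : int -> M).

Let pF : ProperFilter p^' := lc_proper zU Up.
Let p_filter : Filter p^' := @filter_filter _ _ pF.

Definition mx_laurent_le N L c : Prop :=
  forall a b, laurent_le z p N (fun y => L y a b) (fun k => c k a b).

Lemma mx_laurent_le_at N L c : mx_laurent z p L c -> (forall k : int, k < - N%:Z -> c k = 0) ->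
  mx_laurent_le N L c.
Proof.
move=> h c0 a b; apply: (laurent_le_at zU Up (h a b)) => k kN.
by rewrite c0 // mxE.
Qed.

Lemma mx_laurent_leW N L c : mx_laurent_le N L c -> mx_laurent z p L c.
Proof. by move=> h a b; apply: (laurent_leW zU Up (h a b)). Qed.

Lemma mx_laurent_le_ext N A B c : (\forall y \near p^', A y = B y) -> mx_laurent_le N A c -> mx_laurent_le N B c.
Proof.
by move=> E h a b; apply: (laurent_le_ext _ (h a b)); apply: filterS E => y ->.
Qed.

Lemma mx_laurent_leD N A B c d : mx_laurent_le N A c -> mx_laurent_le N B d ->
  mx_laurent_le N (fun y => A y + B y) (fun k => c k + d k).
Proof.
move=> h1 h2 a b; have := laurent_leD zU Up (h1 a b) (h2 a b).
have -> : (fun k => c k a b + d k a b) = (fun k => (c k + d k) a b).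
  by apply/funext => k; rewrite mxE.
by apply: laurent_le_ext; apply: nearW => y; rewrite mxE.
Qed.

Lemma mx_laurent_leZ N (k : C) A c : mx_laurent_le N A c ->
  mx_laurent_le N (fun y => (k : R[i]) *: A y) (fun j => (k : R[i]) *: c j).
Proof.
move=> h1 a b; have := laurent_leZ zU Up k (h1 a b).
have -> : (fun j => k * c j a b) = (fun j => ((k : R[i]) *: c j) a b).
  by apply/funext => j; rewrite mxE.
by apply: laurent_le_ext; apply: nearW => y; rewrite mxE.
Qed.

Lemma mx_laurent_leM N1 N2 A B c d : mx_laurent_le N1 A c -> mx_laurent_le N2 B d ->
  mx_laurent_le (N1 + N2) (fun y => A y *m B y) (mx_conv N1 N2 c d).
Proof.
move=> h1 h2 a b.
have := laurent_le_sum zU Up (index_enum 'I_n) (fun j => laurent_leM zU Up (h1 a j) (h2 j b)).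
have -> : (fun k => \sum_(j : 'I_n) lconv N1 N2 (fun k => c k a j) (fun k => d k j b) k)
   = (fun k => mx_conv N1 N2 c d k a b).
  apply/funext => k; rewrite /lconv /mx_conv; case: (k + _) => m.
    rewrite summxE /cauchy exchange_big /=; apply: eq_bigr => i _.
    by rewrite mxE; apply: eq_bigr.
  by rewrite mxE big1.
by apply: laurent_le_ext; apply: nearW => y; rewrite mxE.
Qed.

Lemma mx_laurent_le_scalar (h : X -> C) (ch : int -> C) : laurent_le z p 0 h ch ->
  mx_laurent_le 0 (fun y => ((h y : R[i])%:M : M)) (fun k => ((ch k : R[i])%:M : M)).
Proof.
move=> hh a b; have [ab|ab] := eqVneq a b.
  have -> : (fun k => ((ch k : R[i])%:M : M) a b) = ch.
    by apply/funext => k; rewrite mxE ab eqxx.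
  apply: (laurent_le_ext _ hh); apply: nearW => y.
  by rewrite mxE ab eqxx.
have -> : (fun k => ((ch k : R[i])%:M : M) a b) = fun=> 0.
  by apply/funext => k; rewrite mxE (negPf ab).
apply: (laurent_le_ext _ (laurent_le0 z p 0)); apply: nearW => y.
by rewrite mxE (negPf ab).
Qed.

Lemma mx_laurent_le_scale N (h : X -> C) ch A c : laurent_le z p 0 h ch -> mx_laurent_le N A c ->
  mx_laurent_le N (fun y => (h y : R[i]) *: A y) (mx_conv 0 N (fun k => (ch k : R[i])%:M) c).
Proof.
move=> hh hA; have := mx_laurent_leM (mx_laurent_le_scalar hh) hA; rewrite add0n.
by apply: mx_laurent_le_ext; apply: nearW => y; rewrite mul_scalar_mx.
Qed.

Lemma mx_laurent_le_ddz N A c : mx_laurent_le N A c ->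
  mx_laurent_le N.+1 (mx_ddz z A) (fun k => (k + 1)%:~R *: c (k + 1)).
Proof.
move=> h a b; have := laurent_le_ddz X1 zU Up (h a b).
have -> : dcoef (fun k => c k a b) = (fun k => ((k + 1)%:~R *: c (k + 1)) a b).
  by apply/funext => k; rewrite mxE.
by apply: laurent_le_ext; apply: nearW => y; rewrite mxE.
Qed.

Lemma mx_laurent_le_conn N A W c cw : mx_laurent_le N A c -> mx_laurent_le 1 W cw ->
  mx_laurent_le N.+1 (fun y => mx_ddz z A y + comm (W y) (A y)) (conn_coef N cw c).
Proof.
move=> hA hW.
have h1 := mx_laurent_le_ddz hA; have h2 := mx_laurent_leM hW hA; have h3 := mx_laurent_leM hA hW.
rewrite add1n in h2; rewrite addn1 in h3.
have h := mx_laurent_leD (mx_laurent_leD h1 h2) (mx_laurent_leZ (-1) h3).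
have -> : conn_coef N cw c = (fun k => (k + 1)%:~R *: c (k + 1) + mx_conv 1 N cw c k +
  (-1) *: mx_conv N 1 c cw k).
  by apply/funext => k; rewrite /conn_coef scaleN1r.
by apply: mx_laurent_le_ext h; apply: nearW => y; rewrite scaleN1r -addrA.
Qed.

(** A linear map is determined by its values on elementary matrices; this turns it
    into a linear combination of entries, to which the scalar theory applies. *)
Lemma linear_entry m (F : M -> 'M[R[i]]_m) : linear F -> forall Y i j,
  F Y i j = \sum_a \sum_b Y a b * F (delta_mx a b) i j.
Proof.
move=> lF Y i j.
have F0 : F 0 = 0 by have := lF (-1) 0 0; rewrite addr0 scaler0 scaleN1r addNr.
have FD u v : F (u + v) = F u + F v by have := lF 1 u v; rewrite !scale1r.
have FZ a u : F (a *: u) = a *: F u by have := lF a u 0; rewrite F0 !addr0.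
rewrite [Y in LHS]matrix_sum_delta (big_morph F FD F0) summxE.
apply: eq_bigr => a _; rewrite (big_morph F FD F0) summxE.
by apply: eq_bigr => b _; rewrite FZ mxE.
Qed.

(** A linear relation between the values of L passes to its Laurent coefficients,
    by uniqueness. *)
Lemma linear_coef m (F : M -> 'M[R[i]]_m) N L c : linear F ->
  (\forall y \near p^', F (L y) = 0) -> mx_laurent_le N L c -> forall k, F (c k) = 0.
Proof.
move=> lF E h k; apply/matrixP => i j; rewrite mxE linear_entry //.
have := laurent_le_sum zU Up (index_enum 'I_n) (fun a =>
  laurent_le_sum zU Up (index_enum 'I_n) (fun b => laurent_leZ zU Up (F (delta_mx a b) i j : C) (h a b))).
move=> /(laurent_le_eq0 zU Up) h0.
rewrite -[RHS](h0 _ k) => [|]; last first.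
  apply: filterS E => y /matrixP/(_ i j); rewrite mxE linear_entry //.
  move=> E; rewrite -[RHS]E; apply: eq_bigr => a _; apply: eq_bigr => b _; exact: mulrC.
by apply: eq_bigr => a _; apply: eq_bigr => b _; exact: mulrC.
Qed.

(** A linear relation between the values of L passes to its derivative. *)
Lemma mx_ddz_linear m (F : M -> 'M[R[i]]_m) L x : linear F -> U x ->
  (\forall y \near x, F (L y) = 0) ->
  (forall a b, holo_at z x (fun y => L y a b)) -> F (mx_ddz z L x) = 0.
Proof.
move=> lF Ux E h; apply/matrixP => i j; rewrite mxE linear_entry //.
have xF := lc_proper zU Ux.
have H a b : has_d z (fun y => (F (delta_mx a b) i j : C) * L y a b) x
     (F (delta_mx a b) i j * ddz z (fun y => L y a b) x).
  by apply: (has_dZ xF (lc_cont zU Ux) (lc_inj zU Ux)); apply: (holo_has_d zU Ux (h a b)).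
have := has_d_sum xF (r := index_enum 'I_n) (fun a => has_d_sum xF (r := index_enum 'I_n) (H a)).
move=> H1; have H2 := has_d_cst z x (0 : C).
have E2 : \forall y \near x, \sum_a \sum_b F (delta_mx a b) i j * L y a b = 0.
  apply: filterS E => y /matrixP/(_ i j); rewrite mxE linear_entry // => E.
  by rewrite -[RHS]E; apply: eq_bigr => a _; apply: eq_bigr => b _; exact: mulrC.
have := has_d_ddz xF (has_d_ext xF E2 H1); rewrite (has_d_ddz xF H2) => e.
rewrite [RHS]e.
by apply: eq_bigr => a _; apply: eq_bigr => b _; rewrite mxE; exact: mulrC.
Qed.

End MatrixFunctions.

(** * The matrix Lie algebras as kernels of linear maps *)

Section LieAlgebras.
Variables (R : realType) (n : nat).
Implicit Types (t : lax_type R n) (Y Z : 'M[R[i]]_n).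

(** Each of the Lie algebras is given by linear equations.  This one fact yields
    closure under linear combinations, derivatives and Laurent coefficients. *)
Lemma lie_alg_linear t : exists m (F : 'M[R[i]]_n -> 'M[R[i]]_m),
  linear F /\ forall Y, lie_alg t Y <-> F Y = 0.
Proof.
case: t => [||| sg |].
- by exists n, (fun=> 0); split=> // a u v; rewrite scaler0 addr0.
- exists 1, (fun Y => (\tr Y)%:M); split.
    by move=> a u v; rewrite linearD linearZ /= raddfD /= scale_scalar_mx.
  move=> Y; split=> /= [->|]; first by rewrite raddf0.
  by move=> /matrixP/(_ 0 0); rewrite !mxE.
- exists n, (fun Y => Y^T + Y); split.
    by move=> a u v; rewrite linearD linearZ /= scalerDr addrACA.
  move=> Y; split=> /= [->|/eqP]; first by rewrite addNr.
  by rewrite addr_eq0 => /eqP.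
- exists n, (fun Y => Y^T *m sg + sg *m Y); split=> // a u v.
  rewrite linearD linearZ /= mulmxDl mulmxDr scalerDr -scalemxAl -scalemxAr.
  by rewrite addrACA.
- case: n => [|m].
    exists 0, (fun=> 0); split=> [a u v|Y]; first by rewrite scaler0 addr0.
    by split=> // _; exists 0; apply/matrixP => -[].
  exists m.+1, (fun Y : 'M[R[i]]_m.+1 => Y - (Y 0 0)%:M); split.
    move=> a u v; rewrite !mxE raddfD /= scalerBr scale_scalar_mx opprD.
    by rewrite addrACA.
  move=> Y; split=> [[a ->]|/eqP]; first by rewrite !mxE eqxx mulr1n subrr.
  by rewrite subr_eq0 => /eqP e; exists (Y 0 0).
Qed.

Lemma lie_alg_sub t a Y Z : lie_alg t Y -> lie_alg t Z -> lie_alg t (a *: Y + Z).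
Proof.
have [m [F [lF FE]]] := lie_alg_linear t.
by rewrite !FE lF => -> ->; rewrite scaler0 addr0.
Qed.

Lemma lie_alg0 t : lie_alg t 0.
Proof.
have [m [F [lF FE]]] := lie_alg_linear t; rewrite FE.
by have := lF (-1) 0 0; rewrite addr0 scaler0 scaleN1r addNr.
Qed.

(** For sl and s the form w has values in gl: commutators are traceless, and
    scalar matrices commute with everything. *)
Lemma lie_alg_comm t W Y : connection_values t W -> lie_alg t Y -> lie_alg t (comm W Y).
Proof.
rewrite /comm; case: t => [||| sg |] //=.
- by move=> _ _; rewrite linearB /= mxtrace_mulC subrr.
- move=> w y; rewrite linearB /= !trmx_mul w y !mulmxN !mulNmx !opprK.
  by rewrite opprB.
- move=> w y.
  have sw : W^T *m sg = - (sg *m W) by apply/eqP; rewrite -addr_eq0 w.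
  have sy : Y^T *m sg = - (sg *m Y) by apply/eqP; rewrite -addr_eq0 y.
  rewrite linearB /= !trmx_mul mulmxBl mulmxBr -!mulmxA sw sy !mulmxN.
  rewrite !mulmxA sw sy !mulNmx !opprK -!mulmxA.
  move: (sg *m (W *m Y)) (sg *m (Y *m W)) => P Q.
  by apply/matrixP => i j; rewrite !mxE; ring.
- by move=> _ [a ->]; exists 0; rewrite scalar_mxC subrr raddf0.
Qed.

End LieAlgebras.

(** * Orders of matrix-valued functions *)

Section MatrixOrders.
Variables (R : realType) (X : topologicalType) (n : nat).
Notation C := (R[i]^o).
Implicit Types (z : X -> C) (p : X) (L : X -> 'M[R[i]]_n).

Definition mx_ord_ge z p L (m : int) : Prop :=
  forall a b, ord_ge z p (fun y => L y a b) m.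

Lemma mx_ord_laurent z p L m : mx_ord_ge z p L m ->
  exists2 c, mx_laurent z p L c & forall k : int, k < m -> c k = 0.
Proof.
move=> H; pose c (k : int) : 'M[R[i]]_n := \matrix_(a, b) s2val (cid2 (H a b)) k.
exists c => [a b|k km].
  have -> : (fun k => c k a b) = s2val (cid2 (H a b)) by apply/funext => k; rewrite mxE.
  exact: s2valP (cid2 (H a b)).
by apply/matrixP => a b; rewrite !mxE; apply: s2valP' (cid2 (H a b)) _ km.
Qed.

Lemma laurent_mx_ord z p L c m : mx_laurent z p L c -> (forall k : int, k < m -> c k = 0) ->
  mx_ord_ge z p L m.
Proof. by move=> h c0 a b; exists (fun k => c k a b) => // k km; rewrite c0 // mxE. Qed.

Lemma mero_ord z p (f : X -> C) : mero_at z p f -> exists N : nat, ord_ge z p f (- N%:Z).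
Proof. by move=> [c h]; case: (h) => N [c0 _]; exists N; exists c. Qed.

(** The orders of the finitely many entries have a common bound. *)
Lemma mx_mero_ord z p L : mx_mero_at z p L -> exists N : nat, mx_ord_ge z p L (- N%:Z).
Proof.
move=> [c h].
have H a b : exists N : nat, forall k : int, k < - N%:Z -> c k a b = 0.
  by case: (h a b) => N [c0 _]; exists N.
pose N := \max_a \max_b projT1 (cid (H a b)).
exists N => a b; exists (fun k => c k a b) => // k kN.
apply: (projT2 (cid (H a b))); apply: (lt_le_trans kN).
rewrite lerN2 lez_nat /N; apply: (leq_trans _ (leq_bigmax a)).
exact: leq_bigmax.
Qed.

Lemma mx_ord_mero z p L m : mx_ord_ge z p L m -> mx_mero_at z p L.
Proof. by move=> /mx_ord_laurent[c h _]; exists c. Qed.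

End MatrixOrders.

(** * Charts of a Riemann surface *)

Section Geometry.
Variables (R : realType) (X : riemann_surface R).
Notation C := (R[i]^o).
Notation chart := (rs_chart X).
Notation dom := (@rs_dom R X).
Notation z := (@rs_coord R X).

Lemma X_accessible : accessible_space X.
Proof. exact: hausdorff_accessible (@rs_hausdorff R X). Qed.

Lemma chart_lc (i : chart) : local_coord (z i) (dom i).
Proof.
split; [exact: rs_dom_open|exact: rs_coord_inj| |exact: rs_coord_open].
exact: rs_coord_cont.
Qed.

(** Finite sets are closed in a Hausdorff space. *)
Lemma near_finite_compl (A : set X) (x : X) : finite_set A -> \forall y \near x^', ~ A y.
Proof.
move=> fA; have cA : closed (A `\` [set x]).
  apply: (accessible_finite_set_closed.1 X_accessible).
  exact: finite_setD.
have oA : open (~` (A `\` [set x])) by rewrite openC.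
have nx : nbhs x (~` (A `\` [set x])).
  by apply: open_nbhs_nbhs; split=> // -[_]; apply.
rewrite near_withinE; apply: filterS nx => y hy yx Ay; apply: hy; split => //.
exact/eqP.
Qed.

Lemma near_finite (A : set X) (x : X) : finite_set A -> ~ A x -> \forall y \near x, ~ A y.
Proof.
move=> fA nA; have := near_finite_compl x fA; rewrite near_withinE.
by apply: filterS => y h; have [->|/h] := eqVneq y x.
Qed.

Lemma chart_atP x : dom (chart_at x) x.
Proof. exact: projT2 (cid (rs_cover x)). Qed.

(** The charts are compatible, so the chain rule applies to f as a function of the
    second coordinate. *)
Lemma ddz_change i j (f : X -> C) x : dom i x -> dom j x -> holo_at (z j) x f ->
  ddz (z i) f x = ddz (z i) (z j) x * ddz (z j) f x.
Proof.
move=> ix jx hf.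
have xF := lc_proper (chart_lc i) ix.
apply: (has_d_ddz xF).
apply: (has_d_chain xF (lc_inj (chart_lc i) ix) (lc_inj (chart_lc j) jx)).
  by apply: (holo_has_d (chart_lc i) ix); apply: rs_compat.
exact: (holo_has_d (chart_lc j) jx hf).
Qed.

Lemma mx_ddz_change n i j (L : X -> 'M[R[i]]_n) x : dom i x -> dom j x ->
  mx_holo_at (z j) x L ->
  mx_ddz (z i) L x = (ddz (z i) (z j) x : R[i]) *: mx_ddz (z j) L x.
Proof.
by move=> ix jx hL; apply/matrixP => a b; rewrite !mxE; apply: ddz_change.
Qed.

End Geometry.

(** * The Lax operator algebra is a subspace *)

Section LaxSubspace.
Variables (R : realType) (X : riemann_surface R) (r N : nat).
Variables (S : marked_points X r) (al : 'I_r -> 'cV[R[i]]_N) (t : lax_type R N).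
Notation C := (R[i]^o).
Notation chart := (rs_chart X).
Notation dom := (@rs_dom R X).
Notation z := (@rs_coord R X).
Notation lax := (lax_algebra S al t).
Implicit Types (L : X -> 'M[R[i]]_N) (h : X -> C) (e : chart -> X -> C).

Lemma finite_marked : finite_set (marked S).
Proof.
rewrite /marked finite_setU; split; first exact: finite_set2.
by apply: finite_image; exact: finite_finset.
Qed.

Lemma near_unmarked x : \forall y \near x^', ~ marked S y.
Proof. exact: near_finite_compl finite_marked. Qed.

Lemma unmarked_near x : ~ marked S x -> \forall y \near x, ~ marked S y.
Proof. by apply: near_finite; exact: finite_marked. Qed.

Lemma marked_Pp : marked S (Pp S). Proof. by left; left. Qed.
Lemma marked_Pm : marked S (Pm S). Proof. by left; right. Qed.
Lemma unmarkedP x : ~ marked S x -> [/\ x <> Pp S, x <> Pm S & ~ gammas S x].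
Proof.
move=> mx; split; first by move=> E; apply: mx; rewrite E; apply: marked_Pp.
  by move=> E; apply: mx; rewrite E; apply: marked_Pm.
by move=> E; apply: mx; right.
Qed.

Lemma dom_zp : dom (zp S) (Pp S). Proof. by case: (zp_centred S). Qed.
Lemma dom_zm : dom (zm S) (Pm S). Proof. by case: (zm_centred S). Qed.
Lemma dom_zs s : dom (zs S s) (gam S s). Proof. by case: (zs_centred S s). Qed.

Lemma lax_cond_sub a (v : 'cV[R[i]]_N) c d : lax_condition t v c -> lax_condition t v d ->
  lax_condition t v (fun k => (a : R[i]) *: c k + d k).
Proof.
have trD (b b' : 'cV[R[i]]_N) : (a *: b + b')^T = a *: b^T + b'^T.
  by apply/matrixP => i j; rewrite !mxE.
have GL c0 d0 : lax_condition Tgl v c0 -> lax_condition Tgl v d0 ->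
    lax_condition Tgl v (fun k => (a : R[i]) *: c0 k + d0 k).
  move=> [c1 [b [cm ba]] [k ck]] [d1 [b' [dm ba']] [k' dk]]; split.
  - by move=> j j1; rewrite c1 // d1 // scaler0 addr0.
  - exists (a *: b + b'); rewrite cm dm trD mulmxDr mulmxDl.
    by rewrite -scalemxAr -scalemxAl ba ba' scaler0 addr0.
  - by exists (a * k + k'); rewrite mulmxDl -scalemxAl ck dk scalerDl scalerA.
case: t => [||| sg |] //=; try exact: GL.
- move=> [c1 [b [cm ba]] [k ck]] [d1 [b' [dm ba']] [k' dk]]; split.
  - by move=> j j1; rewrite c1 // d1 // scaler0 addr0.
  - exists (a *: b + b'); rewrite cm dm trD mulmxDr !mulmxDl.
    rewrite -scalemxAr -!scalemxAl ba ba' scaler0 addr0; split=> //.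
    by rewrite scalerBr opprD addrACA.
  - by exists (a * k + k'); rewrite mulmxDl -scalemxAl ck dk scalerDl scalerA.
- move=> [c1 [nu cn] [b [cm ba]] [k ck] ca] [d1 [nu' dn] [b' [dm ba']] [k' dk] da].
  split.
  - by move=> j j1; rewrite c1 // d1 // scaler0 addr0.
  - by exists (a * nu + nu'); rewrite cn dn scalerDl scalerA.
  - exists (a *: b + b'); rewrite cm dm trD mulmxDr !mulmxDl.
    rewrite -!scalemxAr -!scalemxAl ba ba' scaler0 addr0; split=> //.
    by rewrite scalerDr addrACA.
  - by exists (a * k + k'); rewrite mulmxDl -scalemxAl ck dk scalerDl scalerA.
  - by rewrite mulmxDr mulmxDl -scalemxAr -scalemxAl ca da scaler0 addr0.
- by move=> c1 d1 k k0; rewrite c1 // d1 // scaler0 addr0.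
Qed.

Lemma lax_cond0 v : lax_condition t v (fun=> 0).
Proof.
case: t => [||| sg |] //=; split=> //; try (by exists 0; rewrite mul0mx scale0r);
 try (by exists 0; rewrite trmx0 ?mulmx0 ?mul0mx ?subr0 ?addr0 ?mul0mx).
  by exists 0; rewrite scale0r.
by rewrite mulmx0 mul0mx.
Qed.

(** Without a pole the conditions are about the eigenvector alpha only; they are
    void for alpha = 0. *)
Lemma lax_cond_holo v c : v = 0 \/ t = Ts -> (forall k : int, k < 0 -> c k = 0) ->
  lax_condition t v c.
Proof.
move=> vt c0; have c1 (j : int) : j < -1 -> c j = 0 by move=> j1; apply: c0; lia.
have c2 (j : int) : j < -2 -> c j = 0 by move=> j1; apply: c0; lia.
case: vt => [->|->] //.
case: t => [||| sg |] //=; split=> //; rewrite ?(c0 (-1)) ?(c0 (-2)) //;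
  try (by exists 0; rewrite ?mul0mx ?mulmx0 ?scaler0 ?trmx0 ?mulmx0 ?subr0 ?addr0 ?mul0mx);
  by rewrite mulmx0.
Qed.

(** The conditions at gamma_s are linear in the coefficients up to the choice of
    the auxiliary vector and scalars, which can be combined linearly too. *)
Lemma lax_subspace : Defs.subspace lax.
Proof.
split.
  split.
  - by move=> x; exact: (lie_alg0 t).
  - by move=> x _.
  - move=> i x ix mx a b; apply: (@holo_ext _ _ _ _ _ (chart_lc i) ix (fun=> 0)).
      by apply: nearW => y; rewrite mxE.
    by apply: (holo_cst (chart_lc i) ix).
  - split.
      apply: (@mx_ord_mero _ _ _ _ _ _ 0) => a b.
      apply: (ord_ge_ext (chart_lc (zp S)) dom_zp _ (ord_ge0 (chart_lc (zp S)) dom_zp 0)).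
      by apply: nearW => y; rewrite mxE.
    apply: (@mx_ord_mero _ _ _ _ _ _ 0) => a b.
    apply: (ord_ge_ext (chart_lc (zm S)) dom_zm _ (ord_ge0 (chart_lc (zm S)) dom_zm 0)).
    by apply: nearW => y; rewrite mxE.
  - move=> s; exists (fun=> 0); split; last exact: lax_cond0.
    apply: (mx_laurent_leW (chart_lc (zs S s)) (dom_zs s) (N := 0)) => a b.
    have -> : (fun k : int => (0 : 'M[R[i]]_N) a b) = fun=> 0.
      by apply/funext => k; rewrite mxE.
    by apply: laurent_le_ext (laurent_le0 _ _ _); apply: nearW => y; rewrite mxE.
move=> a L1 L2 [v1 m1 h1 [p1 q1] s1] [v2 m2 h2 [p2 q2] s2].
have ordD i p m : dom i p -> mx_ord_ge (z i) p L1 m -> mx_ord_ge (z i) p L2 m ->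
    mx_ord_ge (z i) p (a *: L1 + L2) m.
  move=> ip o1 o2 k l.
  apply: (ord_ge_ext (chart_lc i) ip _ (ord_geD (chart_lc i) ip
    (ord_geZ (chart_lc i) ip a (o1 k l)) (o2 k l))).
  by apply: nearW => y; rewrite /= !fctE !mxE.
have meroD i p : dom i p -> mx_mero_at (z i) p L1 -> mx_mero_at (z i) p L2 ->
    mx_mero_at (z i) p (a *: L1 + L2).
  move=> ip /mx_mero_ord[k1 o1] /mx_mero_ord[k2 o2].
  apply: (@mx_ord_mero _ _ _ _ _ _ (- (k1 + k2)%:Z)); apply: ordD => // k l.
    by apply: (ord_geW _ (o1 k l)); rewrite lerN2 lez_nat leq_addr.
  by apply: (ord_geW _ (o2 k l)); rewrite lerN2 lez_nat leq_addl.
split.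
- by move=> x; rewrite !fctE; apply: lie_alg_sub.
- by move=> x mx; rewrite !fctE m1 // m2 // scaler0 addr0.
- move=> i x ix mx k l.
  have hc := chart_lc i.
  have := holoD hc ix (holoM hc ix (holo_cst hc ix (a : C)) (h1 i x ix mx k l)) (h2 i x ix mx k l).
  by apply: (holo_ext hc ix); apply: nearW => y; rewrite /= !fctE !mxE.
- by split; apply: meroD => //; [exact: dom_zp|exact: dom_zm].
- move=> s; have [c [hc lc]] := s1 s; have [d [hd ld]] := s2 s.
  exists (fun k => (a : R[i]) *: c k + d k); split; last exact: lax_cond_sub.
  have zc := chart_lc (zs S s); have ds := dom_zs s.
  apply: (mx_laurent_leW zc ds (N := pole_bound t)).
  have l1 := mx_laurent_le_at zc ds hc (lax_condition_lt lc).
  have l2 := mx_laurent_le_at zc ds hd (lax_condition_lt ld).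
  apply: mx_laurent_le_ext (mx_laurent_leD zc ds (mx_laurent_leZ zc ds a l1) l2).
  by apply: nearW => y; rewrite !fctE.
Qed.

End LaxSubspace.

(** * Stability under functions and vector fields *)

Section NoPole.
Variables (R : realType) (X : topologicalType) (n : nat).
Notation C := (R[i]^o).
Hypothesis X1 : accessible_space X.
Variables (z : X -> C) (U : set X) (p : X).
Hypotheses (zU : local_coord z U) (Up : U p).

(** A function without pole has a derivative without pole: the coefficient of z^-1
    is 0 times c 0. *)
Lemma ord_ge_ddz0 (f : X -> C) : ord_ge z p f 0 -> ord_ge z p (ddz z f) 0.
Proof.
move=> /(ord_ge_lau zU Up)[M /(_ M (leqnn M))[c h c0]].
apply: (laurent_le_ord_ge zU Up (laurent_le_ddz X1 zU Up h)) => k k0; rewrite /dcoef.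
have [->|k1] := eqVneq k (-1); first by rewrite addNr mul0r.
by rewrite c0 ?mulr0 //; lia.
Qed.

Lemma lie_coef (t : lax_type R n) M (L : X -> 'M[R[i]]_n) c :
  (\forall y \near p^', lie_alg t (L y)) -> mx_laurent_le z p M L c -> forall k, lie_alg t (c k).
Proof.
have [m [F [lF FE]]] := lie_alg_linear t => E h k; apply/FE.
by apply: (linear_coef zU Up lF _ h); apply: filterS E => y /FE.
Qed.

(** Conversely to [lax_cond_holo], a vanishing alpha leaves no room for a pole. *)
Lemma lax_cond_zero (t : lax_type R n) v c : v = 0 \/ t = Ts -> lax_condition t v c ->
  forall k : int, k < 0 -> c k = 0.
Proof.
move=> vt lc k k0; have lt := lax_condition_lt lc.
case: vt lc => [->|->]; last by apply.
case: t lt => [||| sg |] /= lt lc; last exact: lc.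
- case: lc => _ [b [cm _]] _; have [->|k1] := eqVneq k (-1); last by apply: lt; lia.
  by rewrite cm mul0mx.
- case: lc => _ [b [cm _]] _; have [->|k1] := eqVneq k (-1); last by apply: lt; lia.
  by rewrite cm mul0mx.
- case: lc => _ [b [cm _]] _; have [->|k1] := eqVneq k (-1); last by apply: lt; lia.
  by rewrite cm mul0mx trmx0 mulmx0 subr0.
- case: lc => _ [nu cn] [b [cm _]] _ _; have [->|k1] := eqVneq k (-1).
    by rewrite cm mul0mx trmx0 mulmx0 addr0 mul0mx.
  have [->|k2] := eqVneq k (-2); last by apply: lt; lia.
  by rewrite cn !mul0mx scaler0.
Qed.

End NoPole.

Section LaxAction.
Variables (R : realType) (X : riemann_surface R) (r N : nat).
Variables (S : marked_points X r) (al : 'I_r -> 'cV[R[i]]_N) (t : lax_type R N).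
Variable w : rs_chart X -> X -> 'M[R[i]]_N.
Notation C := (R[i]^o).
Notation chart := (rs_chart X).
Notation dom := (@rs_dom R X).
Notation z := (@rs_coord R X).
Notation lax := (lax_algebra S al t).
Implicit Types (L : X -> 'M[R[i]]_N) (h : X -> C) (e : chart -> X -> C).

Let X1 := @X_accessible R X.

Hypothesis al_ok : forall s, tyurin_ok t (al s).
Hypothesis t_skew : forall sg, t = Tsp sg -> sg^T = - sg.
Hypothesis w_conn : connection_form S al t w.

Lemma kn_functions_holo h i x : kn_functions S h -> dom i x -> x <> Pp S -> x <> Pm S ->
  holo_at (z i) x h.
Proof. by case=> H _ _ _; apply: H. Qed.

Lemma kn_fields_holo e i x : kn_fields S e -> dom i x -> x <> Pp S -> x <> Pm S ->
  holo_at (z i) x (e i).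
Proof. by case=> _ _ H _ _; apply: H. Qed.

Lemma holo_lau0 i p h : dom i p -> holo_at (z i) p h -> exists ch, laurent_le (z i) p 0 h ch.
Proof.
move=> ip [c [hc c0 _]]; exists c; apply: (laurent_le_at (chart_lc i) ip hc) => k.
by rewrite oppr0; apply: c0.
Qed.

Lemma mx_ordM i p h L (m m' : int) : dom i p -> ord_ge (z i) p h m -> mx_ord_ge (z i) p L m' ->
  mx_ord_ge (z i) p (fun y => (h y : R[i]) *: L y) (m + m').
Proof.
move=> ip oh oL a b; have hc := chart_lc i.
apply: (ord_ge_ext hc ip _ (ord_geM hc ip oh (oL a b))).
by apply: nearW => y; rewrite mxE.
Qed.

(** At gamma_s the function h is holomorphic, so [lax_scale] applies. *)
Lemma lax_mul h L : kn_functions S h -> lax L -> lax (fun y => (h y : R[i]) *: L y).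
Proof.
move=> kh [v m hL [p q] s]; have [_ hp hq _] := kh; split.
- by move=> x; rewrite -[_ *: _]addr0; apply: lie_alg_sub => //; apply: lie_alg0.
- by move=> x mx; rewrite m // scaler0.
- move=> i x ix mx a b; have hc := chart_lc i; have [xp xm _] := unmarkedP mx.
  have := holoM hc ix (kn_functions_holo kh ix xp xm) (hL i x ix mx a b).
  by apply: (holo_ext hc ix); apply: nearW => y; rewrite mxE.
- have [k1 o1] := mero_ord hp; have [k2 o2] := mero_ord hq.
  have [k3 o3] := mx_mero_ord p; have [k4 o4] := mx_mero_ord q.
  by split; apply: mx_ord_mero (mx_ordM _ _ _); [exact: dom_zp|exact: o1|exact: o3|
    exact: dom_zm|exact: o2|exact: o4].
- move=> s0; have [c [hc lc]] := s s0.
  have zc := chart_lc (zs S s0); have ds := dom_zs S s0.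
  have [ch hch] := holo_lau0 ds (kn_functions_holo kh ds (@gam_neq_Pp _ _ _ S s0)
    (@gam_neq_Pm _ _ _ S s0)).
  exists (mx_conv 0 (pole_bound t) (fun k => (ch k : R[i])%:M) c).
  split; last exact: lax_scale.
  apply: (mx_laurent_leW zc ds (N := pole_bound t)).
  exact: mx_laurent_le_scale zc ds _ _ _ _ _ hch (mx_laurent_le_at zc ds hc (lax_condition_lt lc)).
Qed.

(** The factors by which e, w and d/dz change between charts cancel. *)
Lemma nabla_chart e L i y : kn_fields S e -> lax L -> dom i y -> ~ marked S y ->
  nabla S w e L y =
  (e i y : R[i]) *: (mx_ddz (z i) L y + comm (w i y) (L y)).
Proof.
move=> ke [_ _ hL _ _] iy my; rewrite /nabla; case: ifPn => [/set_mem//|_].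
set j := chart_at y; have jy : dom j y := chart_atP y.
have [yp ym yg] := unmarkedP my.
have [_ wE _ _ _] := w_conn; have [_ eE _ _ _] := ke.
rewrite (mx_ddz_change iy jy (hL j y jy my)) (wE i j y iy jy yg ym) (eE i j y iy jy).
rewrite /comm -!scalemxAl -!scalemxAr.
move: (mx_ddz _ _ _) (w j y *m L y) (L y *m w j y) => M P Q.
by apply/matrixP => a b; rewrite !mxE; ring.
Qed.

Lemma near_nabla e L i p : kn_fields S e -> lax L -> dom i p ->
  \forall y \near p^', nabla S w e L y =
    (e i y : R[i]) *: (mx_ddz (z i) L y + comm (w i y) (L y)).
Proof.
move=> ke lL ip.
apply: filterS2 (near_unmarked S p) (nbhs_dnbhs (lc_near (chart_lc i) ip)) => y my iy.
exact: nabla_chart.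
Qed.

(** The first bound comes from the derivative, which lowers the order by one, the
    second from the commutator. *)
Lemma nabla_ord e L i p (me mL mw m : int) : kn_fields S e -> lax L -> dom i p ->
  ord_ge (z i) p (e i) me -> mx_ord_ge (z i) p L mL -> mx_ord_ge (z i) p (w i) mw ->
  m <= me + (mL - 1) -> m <= me + (mL + mw) ->
  mx_ord_ge (z i) p (nabla S w e L) m.
Proof.
move=> ke lL ip oe oL ow m1 m2 a b; have hc := chart_lc i.
have o1 := ord_geW m1 (ord_geM hc ip oe (ord_ge_ddz X1 hc ip (oL a b))).
have o2 : ord_ge (z i) p (fun y => e i y * (\sum_j w i y a j * L y j b)) m.
  apply: (ord_geW m2); apply: (ord_geM hc ip oe); apply: (ord_ge_sum hc ip) => j.
  by rewrite addrC; apply: (ord_geM hc ip).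
have o3 : ord_ge (z i) p (fun y => e i y * (\sum_j L y a j * w i y j b)) m.
  apply: (ord_geW m2); apply: (ord_geM hc ip oe); apply: (ord_ge_sum hc ip) => j.
  by apply: (ord_geM hc ip).
have := ord_geD hc ip o1 (ord_geD hc ip o2 (ord_geZ hc ip (-1) o3)).
apply: (ord_ge_ext hc ip); apply: filterS (near_nabla ke lL ip) => y ->.
by rewrite /comm !mxE /=; ring.
Qed.

(** Near gamma_s the two cases are those of the connection form.  If alpha_s = 0 or
    all values are scalar there is no pole.  Otherwise the coefficients of
    dL/dz + [w, L] satisfy the conditions by the matrix identities above, which use
    that coefficients of L and w lie in the Lie algebra for so and sp. *)
Lemma lax_nabla e L : kn_fields S e -> lax L -> lax (nabla S w e L).
Proof.
move=> ke lL; have [v m hL [p q] s] := lL.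
have [wv wE wh wm ws] := w_conn.
have [_ _ _ ep em] := ke.
split.
- move=> x; rewrite /nabla; case: ifPn => [_|/negP mx]; first exact: lie_alg0.
  have {}mx : ~ marked S x by move=> mx'; apply: mx; apply: mem_set.
  set j := chart_at x; have jx : dom j x := chart_atP x.
  have [xp xm xg] := unmarkedP mx.
  apply: lie_alg_sub.
    have [k [F [lF FE]]] := lie_alg_linear t.
    apply/FE; apply: (mx_ddz_linear (chart_lc j) lF jx); last exact: hL.
    by apply: nearW => y; apply/FE.
  rewrite /comm -scalemxAl -scalemxAr -scalerBr -[_ *: _]addr0.
  apply: lie_alg_sub; last exact: lie_alg0.
  by apply: lie_alg_comm; [exact: wv|exact: v].
- by move=> x mx; rewrite /nabla mem_set.
- move=> i x ix mx a b; have hc := chart_lc i; have [xp xm xg] := unmarkedP mx.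
  have he := kn_fields_holo ke ix xp xm.
  have h1 := holo_ddz hc ix (hL i x ix mx a b).
  have h2 : holo_at (z i) x (fun y => \sum_j w i y a j * L y j b).
    apply: (holo_sum hc ix) => j; apply: (holoM hc ix); first exact: wh.
    exact: hL.
  have h3 : holo_at (z i) x (fun y => \sum_j L y a j * w i y j b).
    apply: (holo_sum hc ix) => j; apply: (holoM hc ix); first exact: hL.
    exact: wh.
  have h4 := holoM hc ix (holo_cst hc ix (-1)) h3.
  have := holoM hc ix he (holoD hc ix h1 (holoD hc ix h2 h4)).
  apply: (holo_ext hc ix).
  apply: filterS2 (unmarked_near mx) (lc_near hc ix) => y my iy.
  by rewrite (nabla_chart ke lL iy my) /comm !mxE /=; ring.
- have [k1 o1] := mero_ord ep; have [k2 o2] := mero_ord em.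
  have [k3 o3] := mx_mero_ord p; have [k4 o4] := mx_mero_ord q.
  have [k6 o6] := mx_mero_ord wm.
  have wp : mx_ord_ge (z (zp S)) (Pp S) (w (zp S)) 0.
    move=> a b; apply: holo_ord; apply: wh; [exact: dom_zp| |exact: Pp_neq_Pm].
    by case=> s0 _; apply: gam_neq_Pp.
  split.
    apply: (@mx_ord_mero _ _ _ _ _ _ (- k1%:Z + (- k3%:Z - 1))).
    by apply: (nabla_ord ke lL (dom_zp S) o1 o3 wp); lia.
  apply: (@mx_ord_mero _ _ _ _ _ _ (- k2%:Z + (- k4%:Z - 1 - k6%:Z))).
  by apply: (nabla_ord ke lL (dom_zm S) o2 o4 o6); lia.
- move=> s0; have [c [hc lc]] := s s0; have [cw [hcw lcw]] := ws s0.
  have zc := chart_lc (zs S s0); have ds := dom_zs S s0.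
  have he := kn_fields_holo ke ds (@gam_neq_Pp _ _ _ S s0) (@gam_neq_Pm _ _ _ S s0).
  have [ch hch] := holo_lau0 ds he.
  have lL0 := mx_laurent_le_at zc ds hc (lax_condition_lt lc).
  have [H0|[al0 tTs]] : (al s0 = 0 \/ t = Ts) \/ (al s0 != 0 /\ t <> Ts).
    have [->|a0] := eqVneq (al s0) 0; first by left; left.
    by case: (t) => [||| sg |]; [right|right|right|right|left; right].
    suff : mx_ord_ge (z (zs S s0)) (gam S s0) (nabla S w e L) 0.
      by move=> /mx_ord_laurent[d hd d0]; exists d; split=> //; apply: lax_cond_holo.
    have oL := laurent_mx_ord hc (lax_cond_zero H0 lc).
    have oc : mx_ord_ge (z (zs S s0)) (gam S s0) (fun y => comm (w (zs S s0) y) (L y)) 0.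
      case: H0 => [a0|tTs] a b.
        rewrite a0 eqxx in lcw; have ow := laurent_mx_ord hcw lcw.
        have o1 : ord_ge (z (zs S s0)) (gam S s0) (fun y => \sum_j w (zs S s0) y a j * L y j b) 0.
          apply: (ord_ge_sum zc ds) => j.
          by have := ord_geM zc ds (ow a j) (oL j b); rewrite addr0.
        have o2 : ord_ge (z (zs S s0)) (gam S s0) (fun y => \sum_j L y a j * w (zs S s0) y j b) 0.
          apply: (ord_ge_sum zc ds) => j.
          by have := ord_geM zc ds (oL a j) (ow j b); rewrite addr0.
        have := ord_geD zc ds o1 (ord_geZ zc ds (-1) o2).
        by apply: (ord_ge_ext zc ds); apply: nearW => y; rewrite /comm !mxE mulN1r.
      apply: (ord_ge_ext zc ds _ (ord_ge0 zc ds 0)); apply: nearW => y.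
      by have := v y; rewrite tTs => -[k ->]; rewrite /comm scalar_mxC subrr mxE.
    have oe := holo_ord he.
    move=> a b; have o1 := ord_geD zc ds (ord_ge_ddz0 X1 zc ds (oL a b)) (oc a b).
    have := ord_geM zc ds oe o1; rewrite addr0.
    apply: (ord_ge_ext zc ds); apply: filterS (near_nabla ke lL ds) => y ->.
    by rewrite !mxE.
  rewrite (negPf al0) in lcw; have lcw1 := lcw.1.
  have lw := mx_laurent_le_at zc ds hcw (N := 1) lcw1.
  have ccD : lax_condition t (al s0) (conn_coef (pole_bound t) cw c).
    have nv : \forall y \near (gam S s0)^', lie_alg t (L y) by apply: nearW.
    have vc := lie_coef zc ds nv lL0.
    have vw : (forall x, connection_values t x -> lie_alg t x) -> forall k, lie_alg t (cw k).
      move=> Hv; apply: (lie_coef zc ds _ lw).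
      apply: filterS2 (near_unmarked S (gam S s0)) (nbhs_dnbhs (lc_near zc ds)) => y my iy.
      have [yp ym yg] := unmarkedP my; apply: Hv; exact: wv.
    move: (al_ok s0) (@t_skew); case: (t) lc lcw vc vw tTs => [||| sg |] /= lc lcw vc vw tTs ok sk //.
    - exact: lax_conn_gl.
    - exact: lax_conn_gl.
    - exact: lax_conn_so ok vc (vw (fun _ H => H)) lcw lc.
    - exact: lax_conn_sp (sk _ erefl) vc (vw (fun _ H => H)) lcw lc.
  have lD := mx_laurent_leW zc ds (mx_laurent_le_conn X1 zc ds lL0 lw).
  have lD' := mx_laurent_le_at zc ds lD (lax_condition_lt ccD).
  have lE := mx_laurent_le_scale zc ds hch lD'.
  exists (mx_conv 0 (pole_bound t) (fun k => (ch k : R[i])%:M) (conn_coef (pole_bound t) cw c)).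
  split; last exact: lax_scale.
  apply: (mx_laurent_leW zc ds); apply: mx_laurent_le_ext lE.
  by apply: filterS (near_nabla ke lL ds) => y ->.
Qed.

End LaxAction.

(** * The Lie module identities *)

Section MatrixDerivatives.
Variables (R : realType) (X : topologicalType) (n : nat).
Notation C := (R[i]^o).
Variables (z : X -> C) (U : set X) (p : X).
Hypotheses (zU : local_coord z U) (Up : U p).
Implicit Types (A B : X -> 'M[R[i]]_n) (h : X -> C) (D E : 'M[R[i]]_n).

Let pF := lc_proper zU Up.
Let pc := lc_cont zU Up.
Let pi := lc_inj zU Up.

Definition mx_has_d A D : Prop := forall a b, has_d z (fun y => A y a b) p (D a b).

Lemma mx_has_d_ddz A D : mx_has_d A D -> mx_ddz z A p = D.
Proof. by move=> h; apply/matrixP => a b; rewrite mxE (has_d_ddz pF (h a b)). Qed.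

Lemma mx_holo_has_d A : mx_holo_at z p A -> mx_has_d A (mx_ddz z A p).
Proof. by move=> hA a b; rewrite mxE; apply: (holo_has_d zU Up). Qed.

Lemma mx_has_d_ext A B D : (\forall y \near p, A y = B y) -> mx_has_d A D -> mx_has_d B D.
Proof.
by move=> E h a b; apply: (has_d_ext pF _ (h a b)); apply: filterS E => y ->.
Qed.

Lemma mx_has_dD A B D E : mx_has_d A D -> mx_has_d B E ->
  mx_has_d (fun y => A y + B y) (D + E).
Proof.
move=> hA hB a b; rewrite mxE; have := has_dD pF (hA a b) (hB a b).
by apply: (has_d_ext pF); apply: nearW => y; rewrite mxE.
Qed.

Lemma mx_has_dZ h A d D : has_d z h p d -> mx_has_d A D ->
  mx_has_d (fun y => (h y : R[i]) *: A y) ((d : R[i]) *: A p + (h p : R[i]) *: D).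
Proof.
move=> hh hA a b; rewrite !mxE; have := has_dM pF pc pi hh (hA a b).
by apply: (has_d_ext pF); apply: nearW => y; rewrite mxE.
Qed.

Lemma mx_has_dM A B D E : mx_has_d A D -> mx_has_d B E ->
  mx_has_d (fun y => A y *m B y) (D *m B p + A p *m E).
Proof.
move=> hA hB a b; rewrite !mxE -big_split /=.
have := has_d_sum pF (r := index_enum 'I_n) (fun j => has_dM pF pc pi (hA a j) (hB j b)).
by apply: (has_d_ext pF); apply: nearW => y; rewrite mxE.
Qed.

Lemma mx_has_d_comm A B D E : mx_has_d A D -> mx_has_d B E ->
  mx_has_d (fun y => comm (A y) (B y)) (comm D (B p) + comm (A p) E).
Proof.
move=> hA hB.
(* Subtraction is written as multiplication by the constant function -1. *)
have h0 := mx_has_dZ (has_d_cst z p (-1)) (mx_has_dM hB hA).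
have h1 := mx_has_dD (mx_has_dM hA hB) h0.
have -> : comm D (B p) + comm (A p) E = D *m B p + A p *m E +
   (0 *: (B p *m A p) + -1 *: (E *m A p + B p *m D)).
  rewrite /comm; move: (D *m B p) (B p *m D) (A p *m E) (E *m A p) (B p *m A p) => M1 M2 M3 M4 M5.
  by apply/matrixP => a b; rewrite !mxE; ring.
by apply: mx_has_d_ext h1; apply: nearW => y; rewrite /comm scaleN1r.
Qed.

End MatrixDerivatives.

Section LieModule.
Variables (R : realType) (X : riemann_surface R) (r N : nat).
Variables (S : marked_points X r) (al : 'I_r -> 'cV[R[i]]_N) (t : lax_type R N).
Variable w : rs_chart X -> X -> 'M[R[i]]_N.
Notation C := (R[i]^o).
Notation chart := (rs_chart X).
Notation dom := (@rs_dom R X).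
Notation z := (@rs_coord R X).
Notation lax := (lax_algebra S al t).
Implicit Types (L : X -> 'M[R[i]]_N) (h : X -> C) (e : chart -> X -> C).

Hypothesis al_ok : forall s, tyurin_ok t (al s).
Hypothesis t_skew : forall sg, t = Tsp sg -> sg^T = - sg.
Hypothesis w_conn : connection_form S al t w.

Lemma nablaE e L p : ~ marked S p -> let i := chart_at p in
  nabla S w e L p = (e i p : R[i]) *: (mx_ddz (z i) L p + comm (w i p) (L p)).
Proof.
move=> mp i; rewrite /nabla; case: ifPn => [/set_mem//|_].
by rewrite /comm -scalemxAl -scalemxAr -scalerBr -scalerDr.
Qed.

Lemma nabla_marked e L p : marked S p -> nabla S w e L p = 0.
Proof. by move=> mp; rewrite /nabla mem_set. Qed.

Lemma D1_actE x L p : D1_act S w x L p = (x.1 p : R[i]) *: L p + nabla S w x.2 L p.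
Proof. by []. Qed.

Lemma D1_act_lax x L : D1 S x -> lax L -> lax (D1_act S w x L).
Proof.
move=> [kx1 kx2] lL.
have := (lax_subspace S al t).2 1 _ _ (lax_mul al_ok t_skew kx1 lL)
  (lax_nabla al_ok t_skew w_conn kx2 lL).
by rewrite scale1r.
Qed.

Lemma comm_linear W a (A B : 'M[R[i]]_N) : comm W (a *: A + B) = a *: comm W A + comm W B.
Proof.
rewrite /comm mulmxDr mulmxDl -scalemxAr -scalemxAl.
by rewrite scalerBr opprD addrACA.
Qed.

Lemma comm_scale W a (A : 'M[R[i]]_N) : comm W (a *: A) = a *: comm W A.
Proof. by rewrite /comm -scalemxAr -scalemxAl scalerBr. Qed.

Lemma comm_add W (A B : 'M[R[i]]_N) : comm W (A + B) = comm W A + comm W B.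
Proof. by have := comm_linear W 1 A B; rewrite !scale1r. Qed.

Lemma D1_act_linl (a : R[i]) (x y : (X -> C) * (chart -> X -> C)) L : D1_act S w (a *: x + y) L =
  (a : R[i]) *: D1_act S w x L + D1_act S w y L.
Proof.
apply/funext => p; rewrite [RHS]/= !fctE !D1_actE.
have E1 : (a *: x + y).1 p = a * x.1 p + y.1 p by [].
have E2 j : (a *: x + y).2 j p = a * x.2 j p + y.2 j p.
  reflexivity.
have [mp|mp] := pselect (marked S p).
  rewrite !nabla_marked // !addr0 E1.
  by move: (L p) => M; apply/matrixP => i j; rewrite !mxE; ring.
rewrite !nablaE // E1 E2.
move: (L p) (mx_ddz _ _ _ + _) => M P.
by apply/matrixP => i j; rewrite !mxE; ring.
Qed.

Lemma D1_act_linr a x L1 L2 : lax L1 -> lax L2 ->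
  D1_act S w x ((a : R[i]) *: L1 + L2) =
  (a : R[i]) *: D1_act S w x L1 + D1_act S w x L2.
Proof.
move=> [_ _ h1 _ _] [_ _ h2 _ _].
apply/funext => p; rewrite [RHS]/= !fctE !D1_actE.
have [mp|mp] := pselect (marked S p).
  rewrite !nabla_marked // !addr0 /= ?fctE.
  by apply/matrixP => i j; rewrite !mxE; ring.
rewrite !nablaE //; set i := chart_at p; have ip : dom i p := chart_atP p.
have hc := chart_lc i.
have d1 := mx_holo_has_d hc ip (h1 i p ip mp); have d2 := mx_holo_has_d hc ip (h2 i p ip mp).
have := mx_has_dD hc ip (mx_has_dZ hc ip (has_d_cst (z i) p a) d1) d2.
move=> /(mx_has_d_ddz hc ip) E.
have -> : mx_ddz (z i) (a *: L1 + L2) p = a *: mx_ddz (z i) L1 p + mx_ddz (z i) L2 p.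
  by rewrite -[RHS]add0r -(scale0r (L1 p)) addrA -E; congr (mx_ddz _ _ _); apply/funext.
rewrite comm_linear.
move: (comm _ _) (comm _ _) (mx_ddz _ _ _) (mx_ddz _ _ _) => P1 P2 P3 P4.
by apply/matrixP => k l; rewrite !mxE; ring.
Qed.

(** Flatness of the connection in one chart: after all derivatives are expanded by
    the product rule, both sides are polynomials in values and derivatives at the
    point and in the iterated commutators with w. *)
Lemma D1_act_br x y L : D1 S x -> D1 S y -> lax L ->
  D1_act S w (@D1_bracket R X x y) L =
  D1_act S w x (D1_act S w y L) - D1_act S w y (D1_act S w x L).
Proof.
move=> Dx Dy lL; have [_ mL hL _ _] := lL.
apply/funext => p; rewrite [RHS]/= !fctE.
have [mp|mp] := pselect (marked S p).
  by rewrite !D1_actE !nabla_marked // !addr0 mL // !scaler0 ?addr0 ?scaler0 subr0.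
set i := chart_at p; have ip : dom i p := chart_atP p; have hc := chart_lc i.
have [pp pm pg] := unmarkedP mp.
have [_ _ wh _ _] := w_conn.
set L0 := L p; set L1 := mx_ddz (z i) L p; set L2 := mx_ddz (z i) (mx_ddz (z i) L) p.
set W := w i p; set W1 := mx_ddz (z i) (w i) p.
have hL1 : mx_has_d (z i) p L L1 by apply: (mx_holo_has_d hc ip); apply: hL.
have hL2 : mx_has_d (z i) p (mx_ddz (z i) L) L2.
  apply: (mx_holo_has_d hc ip) => a b.
  apply: (holo_ext hc ip _ (holo_ddz hc ip (hL i p ip mp a b))).
  by apply: nearW => y0; rewrite mxE.
have hW : mx_has_d (z i) p (w i) W1 by apply: (mx_holo_has_d hc ip); apply: wh.
have act_d v : D1 S v -> mx_ddz (z i) (D1_act S w v L) p =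
    (ddz (z i) v.1 p : R[i]) *: L0 + (v.1 p : R[i]) *: L1 +
    ((ddz (z i) (v.2 i) p : R[i]) *: (L1 + comm W L0) +
     (v.2 i p : R[i]) *: (L2 + (comm W1 L0 + comm W L1))).
  move=> [k1 k2]; apply: (mx_has_d_ddz hc ip).
  have dh := holo_has_d hc ip (kn_functions_holo k1 ip pp pm).
  have de := holo_has_d hc ip (kn_fields_holo k2 ip pp pm).
  have := mx_has_dD hc ip (mx_has_dZ hc ip dh hL1)
    (mx_has_dZ hc ip de (mx_has_dD hc ip hL2 (mx_has_d_comm hc ip hW hL1))).
  apply: (mx_has_d_ext hc ip).
  apply: filterS2 (unmarked_near mp) (lc_near hc ip) => y0 my iy.
  by rewrite D1_actE (nabla_chart w_conn k2 lL iy my).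
have actE v M : D1_act S w v M p = (v.1 p : R[i]) *: M p +
    (v.2 i p : R[i]) *: (mx_ddz (z i) M p + comm W (M p)).
  by rewrite D1_actE nablaE.
have commE v : comm W (D1_act S w v L p) = (v.1 p : R[i]) *: comm W L0 +
    (v.2 i p : R[i]) *: (comm W L1 + comm W (comm W L0)).
  by rewrite actE comm_linear comm_scale comm_add.
rewrite (actE x (D1_act S w y L)) (actE y (D1_act S w x L)).
rewrite (actE (D1_bracket x y) L).
move: (act_d x Dx) (act_d y Dy) (commE x) (commE y) (actE x L) (actE y L).
move: (D1_act S w x L) (D1_act S w y L) => Ax Ay.
move=> -> -> -> -> -> -> {act_d actE commE}.
rewrite /D1_bracket /= /field_act /field_bracket -/i !fctE -/L0 -/L1.
move: (comm W (comm W L0)) (comm W L1) (comm W1 L0) (comm W L0) => K2 K1 Kw K.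
by apply/matrixP => k l; rewrite !mxE; ring.
Qed.

End LieModule.

(** * Degrees and orders *)

Section DirectSums.
Variables (K : fieldType) (V : lmodType K) (A : set V) (G : int -> set V).
Hypothesis AG : Defs.direct_sum A G.

Lemma component_sub m v : G m v -> A v.
Proof.
move=> Gv; case: AG => _ -> _; exists [:: m], (fun=> v); split => //.
  by move=> h; rewrite inE => /eqP ->.
by rewrite big_seq1.
Qed.

(** A component of degree a is independent of the other ones, so it meets their
    sum only in zero. *)
Lemma component_indep a (s : seq int) (v : int -> V) : uniq s -> a \notin s ->
  (forall h, h \in s -> G h (v h)) -> G a (\sum_(h <- s) v h) -> \sum_(h <- s) v h = 0.
Proof.
move=> us as' Gv Ga; case: AG => subG _ ind.
pose v' h := if h == a then - \sum_(h <- s) v h else v h.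
have E : \sum_(h <- s) v' h = \sum_(h <- s) v h.
  rewrite !big_seq; apply: eq_bigr => h hs; rewrite /v'; case: eqP => // ha.
  by move: as'; rewrite -ha hs.
suff H : v' a = 0.
  by apply/eqP; rewrite -oppr_eq0; move: H; rewrite /v' eqxx => ->.
apply: (ind (a :: s) v'); last exact: mem_head.
- by rewrite /= as'.
- move=> h; rewrite inE /v'; case: eqP => [->|_ /= hs]; last exact: Gv.
  move=> _; case: (subG a) => G0 GS.
  by have := GS (-1) _ _ Ga G0; rewrite scaleN1r addr0.
- by rewrite big_cons E /v' eqxx addNr.
Qed.

End DirectSums.

Lemma subspace_sum (K : fieldType) (V : lmodType K) (A : set V) (s : seq int) (P : pred int)
  (v : int -> V) : Defs.subspace A -> (forall h, h \in s -> A (v h)) ->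
  A (\sum_(h <- s | P h) v h).
Proof.
move=> [A0 AS] H; rewrite big_seq_cond; apply: (big_ind A) => //.
  by move=> x y Ax Ay; rewrite -[x]scale1r; apply: AS.
by move=> h /andP[/H].
Qed.

Section Grading.
Variables (R : realType) (X : riemann_surface R) (r N : nat).
Variables (S : marked_points X r) (al : 'I_r -> 'cV[R[i]]_N) (t : lax_type R N).
Variables (g : nat) (A : int -> X -> R[i]^o).
Notation C := (R[i]^o).
Notation chart := (rs_chart X).
Notation dom := (@rs_dom R X).
Notation z := (@rs_coord R X).
Notation lax := (lax_algebra S al t).
Notation G := (lax_grading S al g t A).
Implicit Types (L : X -> 'M[R[i]]_N) (h : X -> C).

Hypothesis HA : kn_function_basis S g A.

Let hp := chart_lc (zp S).
Let hm := chart_lc (zm S).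
Let dp := dom_zp S.
Let dm := dom_zm S.

Lemma mx_ordW (i : chart) (p : X) L (m m' : int) : m' <= m -> mx_ord_ge (z i) p L m ->
  mx_ord_ge (z i) p L m'.
Proof. by move=> mm o a b; apply: ord_geW mm (o a b). Qed.

Lemma mx_ord_sub (i : chart) (p : X) m : dom i p ->
  Defs.subspace [set L : X -> 'M[R[i]]_N | mx_ord_ge (z i) p L m].
Proof.
move=> ip; have hc := chart_lc i; split=> [a b|k L1 L2 o1 o2 a b].
  by apply: (ord_ge_ext hc ip _ (ord_ge0 hc ip m)); apply: nearW => y; rewrite mxE.
apply: (ord_ge_ext hc ip _ (ord_geD hc ip (ord_geZ hc ip (k : C) (o1 a b)) (o2 a b))).
by apply: nearW => y; rewrite /= !mxE.
Qed.

(** Only finitely many members of the family lack the prescribed order, and each of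
    these is meromorphic. *)
Lemma uniform_order (p : X) (i : chart) (f : int -> X -> C) (d : int) :
  (exists M : nat, forall m : int, (M < `|m|)%N -> has_order (z i) p (f m) (- m - d)) ->
  (forall m, mero_at (z i) p (f m)) ->
  exists q : nat, forall m, ord_ge (z i) p (f m) (- m - q%:Z).
Proof.
move=> [M hM] hf.
have H m : exists n : nat, ord_ge (z i) p (f m) (- m - n%:Z).
  have [k ok] := mero_ord (hf m); exists (`|(k%:Z - m)%R|%N).
  by apply: ord_geW ok; lia.
pose q0 := (\max_(j < M.+1) (projT1 (cid (H j%:Z)) + projT1 (cid (H (- j%:Z)))))%N.
exists (q0 + `|d|)%N => m; case: (leqP `|m| M) => mM; last first.
  by case: (hM m mM) => c [h c0 _]; exists c => // k km; apply: c0; lia.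
have Hq : (projT1 (cid (H (`|m|%N%:Z))) + projT1 (cid (H (- `|m|%N%:Z))) <= q0)%N.
  exact: (leq_bigmax (Ordinal (mM : (`|m| < M.+1)%N))).
have [mE|mE] : m = `|m|%N%:Z \/ m = - `|m|%N%:Z by lia.
  rewrite [in X in ord_ge _ _ (f X)]mE; apply: ord_geW (projT2 (cid (H (`|m|%N%:Z)))); lia.
rewrite [in X in ord_ge _ _ (f X)]mE; apply: ord_geW (projT2 (cid (H (- `|m|%N%:Z)))); lia.
Qed.

Lemma A_kn m : kn_functions S (A m).
Proof.
case: HA => dA _ _; apply: (component_sub dA (m := m)).
by exists 1; rewrite scale1r.
Qed.

Lemma A_ord_Pp m : ord_ge (z (zp S)) (Pp S) (A m) m.
Proof. by case: HA => _ /(_ m)[c [h c0 _]] _; exists c. Qed.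

Lemma A_ord_Pm : exists q : nat, forall m, ord_ge (z (zm S)) (Pm S) (A m) (- m - q%:Z).
Proof.
case: HA => _ _ HM; apply: uniform_order HM _ => m.
by case: (A_kn m).
Qed.

(** The degrees in which the component is cut out by orders at both points for
    every type of Lie algebra. *)
Definition standard_degree (m : int) := (1 <= m) || (m <= - g%:Z - 1).

Lemma standard_ord t' m L : standard_component S al g t' m L ->
  mx_ord_ge (z (zp S)) (Pp S) L m /\ mx_ord_ge (z (zm S)) (Pm S) L (- m - g%:Z).
Proof.
move=> [_ [Y _ [c [h c0 _]]] [Y' _ [c' [h' c0' _]]]].
by split; [apply: laurent_mx_ord h c0|apply: laurent_mx_ord h' c0'].
Qed.

Lemma tensor_ord t' i p m m' L : dom i p -> ord_ge (z i) p (A m) m' ->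
  tensor_component S t' A m L -> mx_ord_ge (z i) p L m'.
Proof.
move=> ip oA [Y _ ->] a b; have hc := chart_lc i.
apply: (ord_ge_ext hc ip _ (ord_geZ hc ip (Y a b : C) oA)).
apply: filterS (near_unmarked S p) => y my.
by case: ifPn => [/set_mem//|_]; rewrite mxE mulrC.
Qed.

(** In all cases the order at P_+ is at least the degree.  At P_- the expected bound
    can fail for the adapted components, hence the constant q. *)
Lemma grading_ord : exists q : nat, forall m L, G m L ->
  [/\ mx_ord_ge (z (zp S)) (Pp S) L m,
      mx_ord_ge (z (zm S)) (Pm S) L (- m - q%:Z)
    & standard_degree m -> mx_ord_ge (z (zm S)) (Pm S) L (- m - g%:Z)].
Proof.
have [q hq] := A_ord_Pm; exists (q + g)%N => m L; rewrite /lax_grading -/(standard_degree m).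
have ST t' L' : standard_component S al g t' m L' ->
  [/\ mx_ord_ge (z (zp S)) (Pp S) L' m,
      mx_ord_ge (z (zm S)) (Pm S) L' (- m - (q + g)%N%:Z)
    & standard_degree m -> mx_ord_ge (z (zm S)) (Pm S) L' (- m - g%:Z)].
  by move=> /standard_ord[hp1 hm1]; split=> //; apply: mx_ordW hm1; lia.
case: ifP => [sd|sf]; first by move=> /ST[hp1 hm1 ho]; split=> // _; exact: ho sd.
case: ifP => _; first by move=> /ST[hp1 hm1 _]; split.
have TT t' L' : tensor_component S t' A m L' ->
  [/\ mx_ord_ge (z (zp S)) (Pp S) L' m,
      mx_ord_ge (z (zm S)) (Pm S) L' (- m - (q + g)%N%:Z)
    & false -> mx_ord_ge (z (zm S)) (Pm S) L' (- m - g%:Z)].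
  move=> TL; split=> //; first exact: tensor_ord dp (A_ord_Pp m) TL.
  by apply: mx_ordW (tensor_ord dm (hq m) TL); lia.
have TG : (if `[< some_al_neq0 al >] then
     [set L0 | exists L1 L2, [/\ standard_component S al g Tsl m L1,
        tensor_component S Ts A m L2 & L0 = L1 + L2]]
     else tensor_component S Tgl A m) L ->
  [/\ mx_ord_ge (z (zp S)) (Pp S) L m,
      mx_ord_ge (z (zm S)) (Pm S) L (- m - (q + g)%N%:Z)
    & false -> mx_ord_ge (z (zm S)) (Pm S) L (- m - g%:Z)].
  case: ifP => _; last exact: TT.
  move=> [L1 [L2 [/ST[hp1 hm1 _] /TT[hp3 hm3 _] ->]]].
  have sp := (mx_ord_sub m dp).2 1 L1 L2 hp1 hp3.
  have sm := (mx_ord_sub (- m - (q + g)%N%:Z) dm).2 1 L1 L2 hm1 hm3.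
  by rewrite scale1r in sp sm; split.
by case: t => [||| sg |]; [exact: TG|exact: TT|exact: TT|exact: TT|exact: TT].
Qed.

(** The order conditions determine the leading coefficients, and these lie in the
    Lie algebra because all values do. *)
Lemma in_standard a L : standard_degree a -> lax L ->
  mx_ord_ge (z (zp S)) (Pp S) L a -> mx_ord_ge (z (zm S)) (Pm S) L (- a - g%:Z) -> G a L.
Proof.
move=> sa lL op om; rewrite /lax_grading -/(standard_degree a) sa.
have lead i p m : dom i p -> mx_ord_ge (z i) p L m ->
    exists2 Y, lie_alg t Y & mx_has_leading (z i) p L m Y.
  move=> ip /mx_ord_laurent[c hc c0]; exists (c m); last by exists c.
  have lc := mx_laurent_le_at (N := `|m|%N) (chart_lc i) ip hc.
  have nv : \forall y \near p^', lie_alg t (L y) by apply: nearW; case: lL.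
  apply: (lie_coef (chart_lc i) ip nv (lc _)) => k km; apply: c0; lia.
by split=> //; apply: lead.
Qed.

End Grading.

(** * Almost-gradedness *)

Section AlmostGrading.
Variables (R : realType) (X : riemann_surface R) (r N : nat).
Variables (S : marked_points X r) (al : 'I_r -> 'cV[R[i]]_N) (t : lax_type R N).
Variables (g : nat) (A : int -> X -> R[i]^o) (q : nat).
Notation C := (R[i]^o).
Notation chart := (rs_chart X).
Notation dom := (@rs_dom R X).
Notation z := (@rs_coord R X).
Notation lax := (lax_algebra S al t).
Notation G := (lax_grading S al g t A).
Implicit Types (L : X -> 'M[R[i]]_N).

Hypothesis HG : Defs.direct_sum lax G.
Hypothesis Gord : forall m L, G m L ->
  [/\ mx_ord_ge (z (zp S)) (Pp S) L m,
      mx_ord_ge (z (zm S)) (Pm S) L (- m - q%:Z)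
    & standard_degree g m -> mx_ord_ge (z (zm S)) (Pm S) L (- m - g%:Z)].
Hypothesis gq : (g < q)%N.

Let dp := dom_zp S.
Let dm := dom_zm S.

(** Above q the pole orders at P_- of the adapted components, which have degrees
    between - g and 0, are dominated as well. *)
Definition good_degree (b : int) := (b <= - g%:Z - 1) || (q%:Z <= b).

Lemma good_standard b : good_degree b -> standard_degree g b.
Proof. by rewrite /good_degree /standard_degree; lia. Qed.

(** This is where the window of adapted degrees has to be avoided: every component
    of degree at most b obeys the bound at P_- that defines degree b. *)
Lemma good_ord_Pm b h L : good_degree b -> h <= b -> G h L ->
  mx_ord_ge (z (zm S)) (Pm S) L (- b - g%:Z).
Proof.
move=> gdb hb /Gord[_ o1 o2].
have [sh|nsh] := boolP (standard_degree g h).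
  by apply: mx_ordW (o2 sh); lia.
apply: mx_ordW o1; move: gdb nsh; rewrite /good_degree /standard_degree; lia.
Qed.

(** A partial sum that omits degree b but satisfies the order conditions of that
    degree is zero. *)
Lemma part_in_G b (s : seq int) (P : pred int) (v : int -> X -> 'M[R[i]]_N) :
  good_degree b -> uniq s -> (forall h, h \in s -> G h (v h)) -> ~~ P b ->
  mx_ord_ge (z (zp S)) (Pp S) (\sum_(h <- s | P h) v h) b ->
  mx_ord_ge (z (zm S)) (Pm S) (\sum_(h <- s | P h) v h) (- b - g%:Z) ->
  \sum_(h <- s | P h) v h = 0.
Proof.
move=> gdb us Gv Pb o1 o2.
rewrite -big_filter in o1 o2 *; apply: (component_indep HG (a := b)).
- exact: filter_uniq.
- by rewrite mem_filter (negPf Pb).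
- by move=> h; rewrite mem_filter => /andP[_ /Gv].
- apply: in_standard => //; first exact: good_standard.
  rewrite big_filter; apply: (subspace_sum _ (lax_subspace S al t)) => h /Gv Gh.
  exact: (component_sub HG Gh).
Qed.

Lemma split_sum (V : zmodType) (s : seq int) (P : pred int) (v : int -> V) :
  \sum_(h <- s | P h) v h = \sum_(h <- s) v h - \sum_(h <- s | ~~ P h) v h.
Proof. by rewrite [X in _ = X - _](bigID P) /= addrK. Qed.

Lemma mx_ordB (i : chart) (p : X) m L1 L2 : dom i p ->
  mx_ord_ge (z i) p L1 m -> mx_ord_ge (z i) p L2 m -> mx_ord_ge (z i) p (L1 - L2) m.
Proof.
move=> ip o1 o2; have := (mx_ord_sub N m ip).2 (-1) L2 L1 o2 o1.
by rewrite scaleN1r addrC.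
Qed.

Lemma mx_ord_sum (i : chart) (p : X) m (s : seq int) (P : pred int)
  (v : int -> X -> 'M[R[i]]_N) : dom i p ->
  (forall h, h \in s -> P h -> mx_ord_ge (z i) p (v h) m) ->
  mx_ord_ge (z i) p (\sum_(h <- s | P h) v h) m.
Proof.
move=> ip H; rewrite -big_filter.
apply: (subspace_sum xpredT (mx_ord_sub N m ip)) => h.
by rewrite mem_filter => /andP[Ph hs]; apply: H.
Qed.

(** The partial sum is L minus components of degree at least a, so it keeps the
    order of L at P_+; at P_- its terms have low degree. *)
Lemma trim_low a (s : seq int) (v : int -> X -> 'M[R[i]]_N) :
  good_degree a -> uniq s -> (forall h, h \in s -> G h (v h)) ->
  mx_ord_ge (z (zp S)) (Pp S) (\sum_(h <- s) v h) a ->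
  \sum_(h <- s | h < a) v h = 0.
Proof.
move=> ga us Gv o1; apply: (part_in_G ga us Gv); first by rewrite /= ltxx.
  rewrite (split_sum s (fun h => h < a) v).
  apply: (mx_ordB dp o1).
  apply: (mx_ord_sum dp) => h hs ha; have [ho _ _] := Gord (Gv h hs).
  by apply: mx_ordW ho; rewrite leNgt.
apply: (mx_ord_sum dm) => h hs ha; exact: good_ord_Pm ga (ltW ha) (Gv h hs).
Qed.

(** As [trim_low] with the roles of P_+ and P_- exchanged. *)
Lemma trim_high b (s : seq int) (v : int -> X -> 'M[R[i]]_N) :
  good_degree b -> uniq s -> (forall h, h \in s -> G h (v h)) ->
  mx_ord_ge (z (zm S)) (Pm S) (\sum_(h <- s) v h) (- b - g%:Z) ->
  \sum_(h <- s | b < h) v h = 0.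
Proof.
move=> gdb us Gv o1; apply: (part_in_G gdb us Gv); first by rewrite /= ltxx.
  apply: (mx_ord_sum dp) => h hs bh; have [ho _ _] := Gord (Gv h hs).
  by apply: mx_ordW ho; apply: ltW.
rewrite (split_sum s (fun h => b < h) v).
apply: (mx_ordB dm o1).
apply: (mx_ord_sum dm) => h hs; rewrite -leNgt => hb.
exact: good_ord_Pm gdb hb (Gv h hs).
Qed.

(** The bounds a and b are first moved out of the window of adapted degrees, which
    costs at most q + g + 1. *)
Lemma trim L (a b : int) : lax L ->
  mx_ord_ge (z (zp S)) (Pp S) L a -> mx_ord_ge (z (zm S)) (Pm S) L (- b - g%:Z) ->
  sum_over G [set h | a - (q + g + 1)%N%:Z <= h <= b + (q + g + 1)%N%:Z] L.
Proof.
move=> lL oa ob.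
have [a' [ga a1 a2]] : exists a', [/\ good_degree a', a' <= a & a - (q + g + 1)%N%:Z <= a'].
  have [h|h] := boolP (good_degree a); first by exists a; split=> //; lia.
  exists (- g%:Z - 1); move: h; rewrite /good_degree; split; lia.
have [b' [gdb b1 b2]] : exists b', [/\ good_degree b', b <= b' & b' <= b + (q + g + 1)%N%:Z].
  have [h|h] := boolP (good_degree b); first by exists b; split=> //; lia.
  exists q%:Z; move: h; rewrite /good_degree; split; lia.
have [_ EA _] := HG; have : sum_over G setT L by rewrite -EA.
move=> [s [v [us Gv EL]]].
have Gv' h : h \in s -> G h (v h) by move=> /Gv[].
have low : \sum_(h <- s | h < a') v h = 0.
  by apply: trim_low => //; rewrite -EL; apply: mx_ordW oa.
pose s1 := [seq h <- s | a' <= h].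
have EL1 : L = \sum_(h <- s1) v h.
  rewrite /s1 big_filter EL (bigID (fun h => h < a')) /= low add0r.
  by apply: eq_bigl => h; rewrite -leNgt.
have Gv1 h : h \in s1 -> G h (v h) by rewrite mem_filter => /andP[_ /Gv'].
have high : \sum_(h <- s1 | b' < h) v h = 0.
  apply: trim_high => //; first exact: filter_uniq.
  by rewrite -EL1; apply: mx_ordW ob; lia.
exists [seq h <- s1 | h <= b'], v; split.
- by rewrite !filter_uniq.
- move=> h; rewrite !mem_filter => /andP[h2 /andP[h1 /Gv' Gh]]; split=> //=.
  by apply/andP; split; lia.
rewrite big_filter EL1 (bigID (fun h => b' < h)) /= high add0r.
by apply: eq_bigl => h; rewrite -leNgt.
Qed.

End AlmostGrading.

Section ActionOrders.
Variables (R : realType) (X : riemann_surface R) (r N : nat).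
Variables (S : marked_points X r) (al : 'I_r -> 'cV[R[i]]_N) (t : lax_type R N).
Variables (g : nat) (A : int -> X -> R[i]^o) (e : int -> rs_chart X -> X -> R[i]^o).
Variable w : rs_chart X -> X -> 'M[R[i]]_N.
Notation C := (R[i]^o).
Notation z := (@rs_coord R X).
Notation lax := (lax_algebra S al t).
Notation G := (lax_grading S al g t A).

Hypothesis HA : kn_function_basis S g A.
Hypothesis He : kn_field_basis S g e.
Hypothesis w_conn : connection_form S al t w.

Lemma D1_grading_sub k x : D1_grading A e k x -> D1 S x.
Proof.
case: HA => dA _ _; case: He => de _ _ [x1 x2].
by split; [exact: (component_sub dA x1)|exact: (component_sub de x2)].
Qed.

Lemma e_ord_Pp k : ord_ge (z (zp S)) (Pp S) (e k (zp S)) (k + 1).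
Proof. by case: He => _ /(_ k)[c [h c0 _]] _; exists c. Qed.

Lemma e_ord_Pm : exists q : nat, forall k, ord_ge (z (zm S)) (Pm S) (e k (zm S)) (- k - q%:Z).
Proof.
case: He => de _ [M HM]; apply: (uniform_order (d := 3 * g%:Z - 1)).
  by exists M => m mM; have := HM m mM; congr has_order; lia.
move=> m; have : kn_fields S (e m).
  by apply: (component_sub de (m := m)); exists 1; rewrite scale1r.
by case.
Qed.

(** At P_+ the form w is holomorphic; the derivative loses one order and the field
    of degree k has order k + 1. *)
Lemma act_ord_Pp k m x L : D1_grading A e k x -> lax L ->
  mx_ord_ge (z (zp S)) (Pp S) L m ->
  mx_ord_ge (z (zp S)) (Pp S) (D1_act S w x L) (k + m).
Proof.
move=> Dx lL oL; have [_ k2] := D1_grading_sub Dx; case: Dx => -[a Ea] [b Eb].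
have dp := dom_zp S; have hp := chart_lc (zp S).
have o1 : ord_ge (z (zp S)) (Pp S) x.1 k.
  by rewrite Ea; exact: (ord_geZ hp dp a (A_ord_Pp HA k)).
have o2 : ord_ge (z (zp S)) (Pp S) (x.2 (zp S)) (k + 1).
  by rewrite Eb; exact: (ord_geZ hp dp b (e_ord_Pp k)).
have [_ _ wh _ _] := w_conn.
have wp : mx_ord_ge (z (zp S)) (Pp S) (w (zp S)) (-1).
  move=> i j; apply: (@ord_geW _ _ _ _ _ 0) => //; apply: holo_ord; apply: wh => //.
    by case=> s0 _; apply: gam_neq_Pp.
  exact: Pp_neq_Pm.
have oN : mx_ord_ge (z (zp S)) (Pp S) (nabla S w x.2 L) (k + m).
  by apply: (nabla_ord w_conn k2 lL dp o2 oL wp); lia.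
have := (mx_ord_sub N (k + m) dp).2 1 _ _ (mx_ordM dp o1 oL) oN.
by rewrite scale1r.
Qed.

Lemma act_ord_Pm : exists q : nat, forall k m d x L, D1_grading A e k x -> lax L ->
  mx_ord_ge (z (zm S)) (Pm S) L (- m - d) ->
  mx_ord_ge (z (zm S)) (Pm S) (D1_act S w x L) (- (k + m) - d - q%:Z).
Proof.
have [q1 hq1] := A_ord_Pm HA; have [q2 hq2] := e_ord_Pm.
have [_ _ _ wm _] := w_conn; have [q3 o3] := mx_mero_ord wm.
exists (q1 + q2 + q3 + 1)%N => k m d x L Dx lL oL.
have [_ k2] := D1_grading_sub Dx; case: Dx => -[a Ea] [b Eb].
have dm := dom_zm S; have hm := chart_lc (zm S).
have o1 : ord_ge (z (zm S)) (Pm S) x.1 (- k - q1%:Z).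
  by rewrite Ea; exact: (ord_geZ hm dm a (hq1 k)).
have o2 : ord_ge (z (zm S)) (Pm S) (x.2 (zm S)) (- k - q2%:Z).
  by rewrite Eb; exact: (ord_geZ hm dm b (hq2 k)).
set m' := - (k + m) - d - _.
have oN : mx_ord_ge (z (zm S)) (Pm S) (nabla S w x.2 L) m'.
  by apply: (nabla_ord w_conn k2 lL dm o2 oL o3); rewrite /m'; lia.
have oM : mx_ord_ge (z (zm S)) (Pm S) (fun y => (x.1 y : R[i]) *: L y) m'.
  by apply: mx_ordW (mx_ordM dm o1 oL); rewrite /m'; lia.
have := (mx_ord_sub N m' dm).2 1 _ _ oM oN.
by rewrite scale1r.
Qed.

End ActionOrders.

Theorem proposition2p10 (R : realType) (X : riemann_surface R) (g n N : nat)
    (S : marked_points X (n * g)) (t : lax_type R N)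
    (al : 'I_(n * g) -> 'cV[R[i]]_N)
    (A : int -> X -> R[i]^o) (e : int -> rs_chart X -> X -> R[i]^o)
    (w : rs_chart X -> X -> 'M[R[i]]_N) :
  compact [set: X] ->
  has_genus X g ->
  lax_type_wf n t ->
  (forall s, tyurin_ok t (al s)) ->
  kn_function_basis S g A ->
  kn_field_basis S g e ->
  direct_sum (lax_algebra S al t) (lax_grading S al g t A) ->
  (exists d, has_dim (lie_alg t) d /\
     forall m, has_dim (lax_grading S al g t A m) d) ->
  connection_form S al t w ->
  almost_graded_lie_module (D1 S) (@D1_bracket R X) (D1_grading A e)
    (lax_algebra S al t) (lax_grading S al g t A) (D1_act S w).
Proof.
move=> _ _ wf al_ok HA He HG [d [_ dimG]] w_conn.
have t_skew sg : t = Tsp sg -> sg^T = - sg.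
  by move=> E; move: wf; rewrite E => -[_ ].
split.
- split.
  + exact: lax_subspace.
  + move=> x L; exact: D1_act_lax.
  + move=> a x y L _ _ _; exact: D1_act_linl.
  + move=> a x L1 L2 _; exact: D1_act_linr.
  + move=> x y L; exact: D1_act_br.
- exact: HG.
- by move=> m; exists d.
have [q0 Gord0] := grading_ord al t HA.
pose q := (q0 + g + 1)%N.
have Gord m L : lax_grading S al g t A m L ->
  [/\ mx_ord_ge (rs_coord (zp S)) (Pp S) L m,
      mx_ord_ge (rs_coord (zm S)) (Pm S) L (- m - q%:Z)
    & standard_degree g m -> mx_ord_ge (rs_coord (zm S)) (Pm S) L (- m - g%:Z)].
  by move=> /Gord0[h1 h2 h3]; split=> //; apply: mx_ordW h2; rewrite /q; lia.
have gq : (g < q)%N by rewrite /q; lia.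
have [q1 actm] := act_ord_Pm HA He w_conn.
exists (q + g + 1)%N%:Z, (q + q1 + (q + g + 1))%N%:Z => k m x L Dx GL.
have lL := component_sub HG GL; have [op om _] := Gord m L GL.
have la := D1_act_lax al_ok t_skew w_conn (D1_grading_sub HA He Dx) lL.
have oa := act_ord_Pp HA He w_conn Dx lL op.
have ob := actm k m q%:Z x L Dx lL om.
have ob' : mx_ord_ge (rs_coord (zm S)) (Pm S) (D1_act S w x L) (- (k + m + (q + q1)%N%:Z) - g%:Z).
  by apply: mx_ordW ob; lia.
have := trim HG Gord gq la oa ob'.
rewrite (_ : k + m + (q + q1)%N%:Z + (q + g + 1)%N%:Z = k + m + (q + q1 + (q + g + 1))%N%:Z); last lia.
exact.
Qed.
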